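(* Let $\Sigma$ be a system node on $(U,X,U)$ with generating triple $(A,B,C)$ and transfer function $\mathbf G$. For any $E\in\mathcal L(U)$ denote by $\Sigma_E$ the system node with the same generating triple and with the transfer function $\mathbf G+E$. Assume that $E=E^*\in\mathcal L(U)$ is such that $\Sigma_E$ is impedance passive. Denote $c=\|E^+\|$ and $\kappa_0=1/c$ ($\kappa_0=\infty$ if $c=0$), where $E^+$ is the positive part of $E$. Then for every $\kappa\in(0,\kappa_0)$, $K=-\kappa I$ is a well-posed feedback operator for $\Sigma$ and the corresponding closed-loop system $\Sigma^\kappa$ is system stable. Moreover, the semigroup of $\Sigma^\kappa$ is a contraction semigroup on $X$.
   Context: Spaces. $U,X,Y$ are complex Hilbert spaces. If $A:\mathcal D(A)\to X$ generates a strongly continuous semigroup on $X$ and $\alpha\in\rho(A)$, then $X_1$ is $\mathcal D(A)$ with the norm $\|(\alpha I-A)x\|$, and $X_{-1}$ is the completion of $X$ with respect to the norm $\|(\alpha I-A)^{-1}x\|$. The operator $A$ extends uniquely to an operator in $\mathcal L(X,X_{-1})$, and $(sI-A)^{-1}$ extends to an operator in $\mathcal L(X_{-1},X)$ for $s\in\rho(A)$. System node. A system node on $(U,X,Y)$ is $\Sigma=(A,B,C,\mathbf G)$, where $A$ generates a strongly continuous semigroup on $X$, $B\in\mathcal L(U,X_{-1})$, $C\in\mathcal L(X_1,Y)$ and $\mathbf G:\rho(A)\to\mathcal L(U,Y)$ satisfies $\mathbf G(s)-\mathbf G(\beta)=C[(sI-A)^{-1}-(\beta I-A)^{-1}]B$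 for all $s,\beta\in\rho(A)$. $(A,B,C)$ is the generating triple, $\mathbf G$ the transfer function. Trajectories. $\mathcal D_0$ is the set of pairs $(z_0,u)\in X\times C^2([0,\infty),U)$ with $Az_0+Bu(0)\in X$. For $(z_0,u)\in\mathcal D_0$ the equation $\dot z=Az+Bu$, $z(0)=z_0$, has a unique solution $z\in C^1([0,\infty),X)$ (the state trajectory), and the output function is the continuous function $y(t)=C[z(t)-(\beta I-A)^{-1}Bu(t)]+\mathbf G(\beta)u(t)$, independent of $\beta\in\rho(A)$. Impedance passivity. A system node with $Y=U$ is impedance passive if for all $(z_0,u)\in\mathcal D_0$ and all $\tau>0$, $\|z(\tau)\|^2-\|z_0\|^2\le2\int_0^\tau\mathrm{Re}\,\langle u(t),y(t)\rangle\,dt$. Positive part. For $E=E^*\in\mathcal L(U)$ there is a unique orthogonal decomposition $U=U^-\oplus U^+$ into $E$-invariant subspaces with $\langle Ev,v\rangle\le0$ for $v\in U^-$ and $\langle Ev,v\rangle>0$ for all non-zero $v\in U^+$; $E^+$ is the operator obtained by redefining $E$ to be zero on $U^-$. Well-posedness. $\Sigma$ is well-posed if for some (hence every) $t>0$ there is $M_t\ge0$ with $\|z(t)\|^2+\|y\|^2_{L^2([0,t],Y)}\le M_t(\|z_0\|^2+\|u\|^2_{L^2([0,t],U)})$ for all $(z_0,u)\in\mathcal D_0$ and corresponding $z,y$. Then the maps $(z_0,u)\mapsto z,y$ extend by continuity to all $z_0\in X$, $u\in L^2_{loc}([0,\infty),U)$. System stability. A well-posed $\Sigma$ is: input stable if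 for every $v\in L^2([0,\infty),U)$ the state trajectory with zero initial state and input $v$ is bounded; output stable if for every $z_0\in X$ the output function with initial state $z_0$ and zero input is in $L^2([0,\infty),Y)$; input-output stable if for every $v\in L^2([0,\infty),U)$ the output function with zero initial state and input $v$ is in $L^2([0,\infty),Y)$ (equivalently, $\mathbf G$ is a bounded analytic function on the open right half-plane). It is system stable if all three hold. Feedback. $K\in\mathcal L(Y,U)$ is an admissible feedback operator for $\Sigma$ if the feedback $u=Ky+v$ results in a system node: $I-K\mathbf G(s)$ has a bounded inverse for all $s$ in some right half-plane and there is a system node $\Sigma^K=(A^K,B^K,C^K,\mathbf G^K)$ (the closed-loop system) such that, for $s\in\rho(A)\cap\rho(A^K)$, $\mathbf G^K=\mathbf G(I-K\mathbf G)^{-1}$, $(sI-A^K)^{-1}=(sI-A)^{-1}+(sI-A)^{-1}BK(I-\mathbf G(s)K)^{-1}C(sI-A)^{-1}$, $C^K(sI-A^K)^{-1}=(I-\mathbf G(s)K)^{-1}C(sI-A)^{-1}$ and $(sI-A^K)^{-1}B^K=(sI-A)^{-1}B(I-K\mathbf G(s))^{-1}$. It is a well-posed feedback operator if moreover $\Sigma^K$ is well-posed. For $K=-\kappa I$ we write $\Sigma^\kappa$ for $\Sigma^K$. *)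

(* Defs.v *)
From HB Require Import structures.
From mathcomp Require Import all_boot all_order all_algebra.
From mathcomp Require Import complex.
From mathcomp Require Import all_classical all_reals all_analysis.

Set Implicit Arguments.
Unset Strict Implicit.
Unset Printing Implicit Defensive.

Import Order.TTheory GRing.Theory Num.Theory.
Import numFieldNormedType.Exports.

Local Open Scope classical_set_scope.
Local Open Scope ring_scope.
Local Open Scope complex_scope.

(* Complex Hilbert spaces; the inner product is linear in its first argument. *)
HB.mixin Record isHilbert (R : realType) H & CompleteNormedModule R[i] H := {
  hdot : {dot H for (@Num.conj R[i])} ;
  hdot_norm : forall x : H, `|x| ^+ 2 = hdot x x
}.

#[short(type="hilbertType")]
HB.structure Definition Hilbert (R : realType) :=
  {H of CompleteNormedModule R[i] H & isHilbert R H}.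

Section Operators.
Variable R : realType.

Definition hnorm (V : normedModType R[i]) (x : V) : R := complex.Re `|x|.

(* The elements of L(V, W). *)
Definition bounded_op (V W : normedModType R[i]) (f : V -> W) : Prop :=
  linear f /\ continuous f.

Definition opnorm (V W : normedModType R[i]) (f : V -> W) : R :=
  sup [set hnorm (f x) | x in [set x | hnorm x <= 1]].

Definition bounded_inverse (V W : normedModType R[i])
    (f : V -> W) (g : W -> V) : Prop :=
  [/\ bounded_op g, cancel f g & cancel g f].

Definition subspace_set (V : lmodType R[i]) (M : set V) : Prop :=
  M 0 /\ forall (a : R[i]) x y, M x -> M y -> M (a *: x + y).

Definition selfadjoint (U : hilbertType R) (E : U -> U) : Prop :=
  forall u v : U, hdot (E u) v = hdot u (E v).

(* [Ep] is E^+: the order on R[i] makes [x <= 0] and [0 < x] assert that x is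
   real. *)
Definition is_positive_part (U : hilbertType R) (E Ep : U -> U) : Prop :=
  exists Um Up : set U,
    [/\ subspace_set Um /\ subspace_set Up,
        (forall v w, Um v -> Up w -> hdot v w = 0) /\
          (forall u, exists v w, [/\ Um v, Up w & u = v + w]),
        (forall v, Um v -> Um (E v)) /\ (forall w, Up w -> Up (E w)),
        (forall v, Um v -> hdot (E v) v <= 0) /\
          (forall w, Up w -> w != 0 -> 0 < hdot (E w) w)
      & forall v w, Um v -> Up w -> Ep (v + w) = E w].

End Operators.

Section Semigroups.
Variables (R : realType) (X : hilbertType R).

Definition C0_semigroup (T : R -> X -> X) : Prop :=
  [/\ forall t : R, 0 <= t -> bounded_op (T t),
      forall x, T 0 x = x,
      forall (s t : R) x, 0 <= s -> 0 <= t -> T (s + t) x = T s (T t x)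
    & forall x, T t x @[t --> 0^'+] --> x].

(* An unbounded operator is given by its domain [D] and a total function [A]
   whose values outside [D] are irrelevant. *)
Definition generates (D : set X) (A : X -> X) (T : R -> X -> X) : Prop :=
  C0_semigroup T /\
  forall x y, (D x /\ A x = y) <->
    ((h^-1)%:C *: (T h x - x)) @[h --> 0^'+] --> y.

Definition is_resolvent_at (D : set X) (A : X -> X) (s : R[i]) (Q : X -> X) :=
  [/\ bounded_op Q,
      forall x, D (Q x) /\ s *: Q x - A (Q x) = x
    & forall x, D x -> Q (s *: x - A x) = x].

Definition resolvent_set (D : set X) (A : X -> X) : set R[i] :=
  [set s | exists Q, is_resolvent_at D A s Q].

Definition resolvent (D : set X) (A : X -> X) (s : R[i]) : X -> X :=
  xget (fun=> 0) [set Q | is_resolvent_at D A s Q].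

End Semigroups.

(* The data of a system node. [nemb : X -> nXm1] is the canonical embedding of X
   into its completion X_{-1}, [nalpha] is the point of rho(A) that fixes the
   norms of X_1 and X_{-1}, and [nC], [nG s] are only relevant on D(A) and for
   s in rho(A). *)
Record node (R : realType) (U X Y : hilbertType R) := Node {
  ndom : set X ;
  nA : X -> X ;
  nalpha : R[i] ;
  nXm1 : completeNormedModType R[i] ;
  nemb : X -> nXm1 ;
  nB : U -> nXm1 ;
  nC : X -> Y ;
  nG : R[i] -> U -> Y
}.
Arguments ndom {R U X Y} _ _.
Arguments nA {R U X Y} _ _.
Arguments nemb {R U X Y} _ _.
Arguments nB {R U X Y} _ _.
Arguments nC {R U X Y} _ _.
Arguments nG {R U X Y} _ _ _.

Section SystemNode.
Variables (R : realType) (U X Y : hilbertType R).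
Implicit Type S : node U X Y.

Definition rho S : set R[i] := resolvent_set (ndom S) (nA S).

Definition res S (s : R[i]) : X -> X := resolvent (ndom S) (nA S) s.

(* The unique extension of A to an operator in L(X, X_{-1}). *)
Definition Aext S : X -> nXm1 S :=
  xget (fun=> 0) [set f : X -> nXm1 S | bounded_op f /\
    forall x, ndom S x -> f x = nemb S (nA S x)].

(* The unique extension of (sI - A)^-1 to an operator in L(X_{-1}, X). *)
Definition Rext S (s : R[i]) : nXm1 S -> X :=
  xget (fun=> 0) [set f : nXm1 S -> X | bounded_op f /\
    forall x, f (nemb S x) = res S s x].
Arguments Rext : clear implicits.

Definition is_completion S : Prop :=
  [/\ linear (nemb S),
      forall x, `|nemb S x| = `|res S (nalpha S) x|
    & dense (range (nemb S))].

(* nC S is in L(X_1, Y) *)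
Definition bounded_on_X1 S : Prop :=
  (forall (a : R[i]) x y, ndom S x -> ndom S y ->
     nC S (a *: x + y) = a *: nC S x + nC S y) /\
  exists M : R, forall x, ndom S x ->
     hnorm (nC S x) <= M * hnorm (nalpha S *: x - nA S x).

Definition is_system_node S : Prop :=
  [/\ (exists T, generates (ndom S) (nA S) T),
      rho S (nalpha S) /\ is_completion S,
      bounded_op (nB S) /\ bounded_on_X1 S,
      forall s, rho S s -> bounded_op (nG S s)
    & forall s b u, rho S s -> rho S b ->
        nG S s u - nG S b u = nC S (Rext S s (nB S u) - Rext S b (nB S u))].

(* Sigma_E: same generating triple, transfer function G + E. *)
Definition shift_node S (E : U -> Y) : node U X Y :=
  @Node R U X Y (ndom S) (nA S) (nalpha S) (nXm1 S) (nemb S)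
    (nB S) (nC S) (fun s u => nG S s u + E u).

Lemma shift_node_is_system_node S (E : U -> Y) :
  bounded_op E -> is_system_node S -> is_system_node (shift_node S E).
Proof.
move=> [Elin Econt] [HA Halpha HBC HG Hid]; split=> //.
- move=> s Hs; have [Glin Gcont] := HG s Hs; split.
    by move=> a u v /=; rewrite Glin Elin scalerDr addrACA.
  by move=> u; apply: continuousD; [exact: Gcont | exact: Econt].
- move=> s b u Hs Hb /=; rewrite -(Hid s b u Hs Hb).
  by rewrite opprD addrACA subrr addr0.
Qed.

End SystemNode.
Arguments Rext {R U X Y} S s _.

Section Trajectories.
Variable R : realType.

(* [g] is the derivative of [f] on [0, +oo[, one-sided at 0. *)
Definition derivative_on (V : normedModType R[i]) (f g : R -> V) : Prop :=
  forall t : R, 0 <= t ->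
    ((h^-1)%:C *: (f (t + h) - f t))
      @[h --> within [set h : R | 0 <= t + h] 0^'] --> g t.

Definition C1_on (V : normedModType R[i]) (f g : R -> V) : Prop :=
  derivative_on f g /\ {within `[0, +oo[, continuous g}.

Definition C2 (V : normedModType R[i]) (f : R -> V) : Prop :=
  exists f1 f2, derivative_on f f1 /\ C1_on f1 f2.

Variables U X Y : hilbertType R.
Implicit Type S : node U X Y.

Definition in_D0 S (z0 : X) (u : R -> U) : Prop :=
  C2 u /\ exists x, Aext S z0 + nB S (u 0) = nemb S x.

Definition is_output S (u : R -> U) (z : R -> X) (y : R -> Y) : Prop :=
  forall b, rho S b -> forall t : R, 0 <= t ->
    y t = nC S (z t - Rext S b (nB S (u t))) + nG S b (u t).

Definition trajectory S (z0 : X) (u : R -> U) (z : R -> X) (y : R -> Y) :=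
  [/\ in_D0 S z0 u,
      z 0 = z0,
      (exists dz, C1_on z dz /\
         forall t : R, 0 <= t -> nemb S (dz t) = Aext S (z t) + nB S (u t))
    & is_output S u z y].

End Trajectories.

Definition impedance_passive (R : realType) (U X : hilbertType R)
    (S : node U X U) : Prop :=
  forall z0 u z y, trajectory S z0 u z y -> forall tau : R, 0 < tau ->
    hnorm (z tau) ^+ 2 - hnorm z0 ^+ 2 <=
    2 * \int[lebesgue_measure]_(t in `[0, tau]) complex.Re (hdot (u t) (y t)).

Section WellPosed.
Variable R : realType.

(* The square of the norm of [f] in L^2(D, V). *)
Definition L2sq (V : normedModType R[i]) (D : set R) (f : R -> V) : \bar R :=
  (\int[lebesgue_measure]_(t in D) (hnorm (f t) ^+ 2)%:E)%E.

(* Bochner measurability: almost everywhere on [D], [f] is the limit of a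
   sequence of simple functions. *)
Definition strongly_measurable (V : normedModType R[i]) (D : set R)
    (f : R -> V) : Prop :=
  exists s : nat -> R -> V,
    (forall n, finite_set (range (s n)) /\
       forall v, measurable (s n @^-1` [set v])) /\
    {ae (@lebesgue_measure R), forall t, D t -> s n t @[n --> \oo] --> f t}.

Definition L2 (V : normedModType R[i]) (f : R -> V) : Prop :=
  strongly_measurable `[0, +oo[ f /\ (L2sq `[0%R, +oo[ f < +oo)%E.

Definition L2loc (V : normedModType R[i]) (f : R -> V) : Prop :=
  strongly_measurable `[0, +oo[ f /\
  forall tau : R, 0 < tau -> (L2sq `[0%R, tau] f < +oo)%E.

Definition cvg_L2loc (V : normedModType R[i]) (f : nat -> R -> V)
    (g : R -> V) : Prop :=
  forall tau : R, 0 < tau ->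
    L2sq `[0, tau] (fun t => f n t - g t) @[n --> \oo] --> 0%E.

Variables U X Y : hilbertType R.
Implicit Type S : node U X Y.

Definition well_posed S : Prop :=
  exists t M : R, [/\ 0 < t, 0 <= M &
    forall z0 u z y, trajectory S z0 u z y ->
      ((hnorm (z t) ^+ 2)%:E + L2sq `[0%R, t] y <=
       M%:E * ((hnorm z0 ^+ 2)%:E + L2sq `[0%R, t] u))%E].

(* The extension by continuity of the maps (z0, u) |-> z, y of a well-posed
   node to z0 in X and u in L^2_loc; [y] is determined almost everywhere. *)
Definition ext_trajectory S (z0 : X) (u : R -> U) (z : R -> X) (y : R -> Y) :=
  L2loc u /\ L2loc y /\
  exists (z0n : nat -> X) (un : nat -> R -> U) (zn : nat -> R -> X)
         (yn : nat -> R -> Y),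
    [/\ forall n, trajectory S (z0n n) (un n) (zn n) (yn n),
        z0n n @[n --> \oo] --> z0 /\ cvg_L2loc un u,
        forall t : R, 0 <= t -> zn n t @[n --> \oo] --> z t
      & cvg_L2loc yn y].

Definition input_stable S : Prop :=
  forall v, L2 v -> exists z y, ext_trajectory S 0 v z y /\
    exists M : R, forall t : R, 0 <= t -> hnorm (z t) <= M.

Definition output_stable S : Prop :=
  forall z0, exists z y, ext_trajectory S z0 (fun=> 0) z y /\ L2 y.

Definition input_output_stable S : Prop :=
  forall v, L2 v -> exists z y, ext_trajectory S 0 v z y /\ L2 y.

Definition system_stable S : Prop :=
  [/\ well_posed S, input_stable S, output_stable S & input_output_stable S].

Definition has_contraction_semigroup S : Prop :=
  exists T, generates (ndom S) (nA S) T /\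
    forall (t : R) x, 0 <= t -> hnorm (T t x) <= hnorm x.

End WellPosed.

Section Feedback.
Variables (R : realType) (U X Y : hilbertType R).
Implicit Types (S : node U X Y) (K : Y -> U).

(* [SK] is the closed-loop system node; [P] and [Q] are (I - K G(s))^-1 and
   (I - G(s) K)^-1. *)
Definition is_closed_loop S K (SK : node U X Y) : Prop :=
  is_system_node SK /\
  forall s, rho S s -> rho SK s -> exists P Q,
    [/\ bounded_inverse (fun u => u - K (nG S s u)) P /\
          bounded_inverse (fun y => y - nG S s (K y)) Q,
        forall u, nG SK s u = nG S s (P u),
        forall x, res SK s x =
          res S s x + Rext S s (nB S (K (Q (nC S (res S s x))))),
        forall x, nC SK (res SK s x) = Q (nC S (res S s x))
      & forall u, Rext SK s (nB SK u) = Rext S s (nB S (P u))].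

Definition invertible_on_half_plane S K : Prop :=
  exists w : R, forall s : R[i], w < complex.Re s ->
    rho S s /\ exists P, bounded_inverse (fun u => u - K (nG S s u)) P.

Definition admissible_feedback S K : Prop :=
  [/\ bounded_op K, invertible_on_half_plane S K
    & exists SK, is_closed_loop S K SK].

Definition well_posed_feedback S K : Prop :=
  admissible_feedback S K /\ exists SK, is_closed_loop S K SK /\ well_posed SK.

End Feedback.

(* Main.v *)
(* Write [nrel S x u w y] for "w = Ax + Bu in X and y is the corresponding output".
   Testing passivity of Sigma_E on short exponential inputs turns it into the pointwise
   inequality Re <w, x> <= Re <u, y + E u>. Substituting u = v - kappa y and
   Re <E u, u> <= c |u|^2, the condition kappa c < 1 leaves a strict margin:
     Re <w, x> <= b |v|^2 - a |y|^2   with a, b > 0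
   along the feedback relation. With v = 0 it says that the closed-loop operator is
   dissipative; for Re s > 0 it makes I + kappa G(s) coercive, so the
   feedback relation can be solved, and the Lumer-Phillips theorem shows that it is the
   relation of a system node. Integrated along trajectories it gives
     |z(t)|^2 + 2a int_0^t |y|^2 <= |z(0)|^2 + 2b int_0^t |v|^2,
   which is well-posedness, with constants independent of t. Inputs e^{lt} w are dense
   in L^2, so the estimate passes to all inputs in L^2 and yields the three
   stability properties. *)
Require Import Defs.
From HB Require Import structures.
From mathcomp Require Import all_boot all_order all_algebra.
From mathcomp Require Import complex.
From mathcomp Require Import all_classical all_reals all_analysis.
From mathcomp Require Import measurable_realfun ring lra.

Set Implicit Arguments.
Unset Strict Implicit.
Unset Printing Implicit Defensive.

Import Order.TTheory GRing.Theory Num.Theory.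
Import numFieldNormedType.Exports.

Local Open Scope classical_set_scope.
Local Open Scope ring_scope.
Local Open Scope complex_scope.

(** The space X_{-1} is isometric to X through (alpha I - A)^-1. Arguments are therefore made in X
    with b = (alpha I - A)^-1 B: Ax + Bu lies in X exactly when x - bu lies in the domain of A. The
    closed-loop generator arises as a graph, so the density of its domain has to be proved: for x in
    the domain of A and large real l, l times the closed-loop resolvent is compared with l times the
    open-loop one, and the margin 1/kappa - c controls the difference. The closed-loop node is then
    built with X itself as extrapolation space. The conclusion concerns every node that satisfies
    the closed-loop resolvent identities; those at one common point s already return the feedback
    relation, hence the energy estimate. Inputs are growing exponentials, because the open right
    half-plane lies in the resolvent set of a contraction semigroup. As the initial state must be
    compatible with u(0), states and inputs are approximated together. Integrals of orbits are
    limits of Riemann sums, and the closed-loop semigroup is a limit of implicit Euler schemes. *)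

Section AbelianIdentities.
Variable V : zmodType.

Inductive abel_expr :=
  AAtom of nat | AAdd of abel_expr & abel_expr | AOpp of abel_expr | AZero.

Fixpoint abel_eval (s : seq V) (e : abel_expr) : V :=
  match e with
  | AAtom i => nth 0 s i
  | AAdd a b => abel_eval s a + abel_eval s b
  | AOpp a => - abel_eval s a
  | AZero => 0
  end.

Fixpoint abel_coef (e : abel_expr) (i : nat) : int :=
  match e with
  | AAtom j => (i == j)%:Z
  | AAdd a b => abel_coef a i + abel_coef b i
  | AOpp a => - abel_coef a i
  | AZero => 0
  end.

(** Normal form of a reified term. Atoms beyond the end of [s] evaluate to 0, so the coefficients at
    indices below [size s] decide equality. *)
Lemma abel_evalE s e : abel_eval s e = \sum_(i < size s) s`_i *~ abel_coef e i.
Proof.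
elim: e => [j|a IHa b IHb|a IHa|] /=.
- case: (ltnP j (size s)) => js.
    rewrite (bigD1 (Ordinal js)) //= eqxx mulr1z big1 ?addr0// => i ij.
    by rewrite (_ : (i : nat) == j = false) ?mulr0z//; apply: contraNF ij => /eqP ij; apply/eqP/val_inj.
  rewrite nth_default// big1// => i _.
  by rewrite (_ : (i : nat) == j = false) ?mulr0z// ltn_eqF// (leq_trans _ js).
- by rewrite IHa IHb -big_split; apply: eq_bigr => i _; rewrite mulrzDr.
- by rewrite IHa -sumrN; apply: eq_bigr => i _; rewrite mulrNz.
- by rewrite big1// => i _; rewrite mulr0z.
Qed.

Lemma abel_eq s e f : all (fun i => abel_coef e i == abel_coef f i) (iota 0 (size s)) ->
  abel_eval s e = abel_eval s f.
Proof.
move=> /allP h; rewrite !abel_evalE; apply: eq_bigr => i _.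
by have /h /eqP -> : (i : nat) \in iota 0 (size s) by rewrite mem_iota /=.
Qed.

End AbelianIdentities.

(* The same scaled vector may occur with several inferred ring structures, so
   scaled atoms are compared up to conversion. *)
Ltac abel_same x y :=
  match x with
  | y => idtac
  | @GRing.scale _ _ ?a ?v =>
      match y with @GRing.scale _ _ ?b ?w => unify v w; unify a b end
  end.
Ltac abel_index x s :=
  match s with
  | ?y :: _ => let _ := match goal with _ => abel_same x y end in constr:(0%N)
  | _ :: ?s' => let n := abel_index x s' in constr:(n.+1)
  end.
Ltac abel_insert x s :=
  match s with
  | _ => let _ := abel_index x s in s
  | _ => constr:(x :: s)
  end.
Ltac abel_atoms t s :=
  match t with
  | @GRing.add _ ?a ?b => let s := abel_atoms a s in abel_atoms b s
  | @GRing.opp _ ?a => abel_atoms a s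
  | @GRing.zero _ => s
  | _ => abel_insert t s
  end.
Ltac abel_reify t s :=
  match t with
  | @GRing.add _ ?a ?b =>
      let a := abel_reify a s in let b := abel_reify b s in constr:(AAdd a b)
  | @GRing.opp _ ?a => let a := abel_reify a s in constr:(AOpp a)
  | @GRing.zero _ => constr:(AZero)
  | _ => let i := abel_index t s in constr:(AAtom i)
  end.
(* Decides linear identities with integer coefficients in an abelian group. *)
Ltac abel :=
  match goal with
  | |- @eq ?T ?l ?r =>
      let s := abel_atoms l (@nil T) in
      let s := abel_atoms r s in
      let e := abel_reify l s in
      let f := abel_reify r s in
      exact: (@abel_eq _ s e f isT)
  end.

(** * Hilbert spaces and bounded operators *)

Section Basics.
Variable R : realType.
Implicit Types V W Z : normedModType R[i].

Lemma hnormE V (x : V) : `|x| = (hnorm x)%:C.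
Proof. by rewrite /hnorm RRe_real// ger0_real. Qed.

Lemma hnorm_ge0 V (x : V) : 0 <= hnorm x.
Proof. by rewrite -ler0c -hnormE normr_ge0. Qed.
#[local] Hint Resolve hnorm_ge0 : core.

Lemma hnorm0 V : hnorm (0 : V) = 0.
Proof. by rewrite /hnorm normr0. Qed.

Lemma hnorm_eq0 V (x : V) : hnorm x = 0 -> x = 0.
Proof. by move=> h; apply: normr0_eq0; rewrite hnormE h. Qed.

Lemma hnormN V (x : V) : hnorm (- x) = hnorm x.
Proof. by rewrite /hnorm normrN. Qed.

Lemma hnormB V (x y : V) : hnorm (x - y) = hnorm (y - x).
Proof. by rewrite /hnorm distrC. Qed.

Lemma hnormD V (x y : V) : hnorm (x + y) <= hnorm x + hnorm y.
Proof. by rewrite -lecR rmorphD /= -!hnormE; exact: ler_normD. Qed.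

Lemma hnormDB V (x y : V) : hnorm (x - y) <= hnorm x + hnorm y.
Proof. by rewrite -[hnorm y]hnormN hnormD. Qed.

Lemma hnorm_tri V (z x y : V) : hnorm (x - y) <= hnorm (x - z) + hnorm (z - y).
Proof. by rewrite -[x - y](subrKA z) hnormD. Qed.

Lemma hnorm_lip V (x y : V) : `|hnorm x - hnorm y| <= hnorm (x - y).
Proof.
rewrite ler_norml; apply/andP; split.
  rewrite hnormB lerNl opprB lerBlDr -[in leLHS](subrK x y); exact: hnormD.
by rewrite lerBlDr -[in leLHS](subrK y x); exact: hnormD.
Qed.

(** [|a|] is an element of [R[i]]; its real part is the same number in the ordered field [R], where
    the estimates are made. *)
Definition cabs (a : R[i]) : R := complex.Re `|a|.

Lemma cabsE (a : R[i]) : `|a| = (cabs a)%:C.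
Proof. by rewrite /cabs RRe_real// ger0_real. Qed.

Lemma hnormZ V (a : R[i]) (x : V) : hnorm (a *: x) = cabs a * hnorm x.
Proof. by apply: complexI; rewrite -hnormE normrZ rmorphM /= -hnormE cabsE. Qed.

Lemma cabsC (a : R) : cabs a%:C = `|a|.
Proof. by rewrite /cabs normc_def /= expr0n addr0 sqrtr_sqr. Qed.

Lemma cabs_ge0 (a : R[i]) : 0 <= cabs a.
Proof. by rewrite /cabs normc_def /= sqrtr_ge0. Qed.

Lemma hnormZr V (a : R) (x : V) : hnorm (a%:C *: x) = `|a| * hnorm x.
Proof. by rewrite hnormZ cabsC. Qed.

Lemma hnorm_sum V (I : Type) (r : seq I) (P : pred I) (f : I -> V) :
  hnorm (\sum_(i <- r | P i) f i) <= \sum_(i <- r | P i) hnorm (f i).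
Proof.
elim/big_ind2 : _ => //; first by rewrite hnorm0.
by move=> x a y b xa yb; apply: (le_trans (hnormD _ _)); exact: lerD.
Qed.

(** Balls of a complex normed module have radii in [R[i]], but a positive radius is real; hence
    convergence can be tested with real tolerances. *)
Lemma cvg_hnorm V (T : Type) (F : set_system T) {FF : Filter F} (f : T -> V)
  (l : V) : f @ F --> l <-> (fun t => hnorm (f t - l)) @ F --> (0 : R).
Proof.
split.
  move=> /cvgrPdist_lt h; apply/cvgrPdist_lt => e e0.
  have e0' : 0 < e%:C by rewrite ltcR.
  move: (h _ e0'); apply: filterS => t.
  by rewrite sub0r normrN ger0_norm// hnormB hnormE ltcR.
move=> /cvgrPdist_lt h; apply/cvgrPdist_lt => e e0.
have [e1 e2] : 0 < complex.Re e /\ e = (complex.Re e)%:C.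
  have er := gtr0_real e0; split; last by rewrite RRe_real.
  by move: e0; rewrite -{1}(RRe_real er) ltcR.
move: (h _ e1); apply: filterS => t.
by rewrite sub0r normrN ger0_norm// hnormB [in X in _ -> X]e2 hnormE ltcR.
Qed.

Lemma cvg_hnormP V (T : Type) (F : set_system T) {FF : Filter F} (f : T -> V)
  (l : V) : f @ F --> l <->
  (forall e : R, 0 < e -> \forall t \near F, hnorm (f t - l) < e).
Proof.
rewrite cvg_hnorm; split.
  move=> /cvgrPdist_lt h e /h; apply: filterS => t.
  by rewrite sub0r normrN ger0_norm.
move=> h; apply/cvgrPdist_lt => e /h; apply: filterS => t.
by rewrite sub0r normrN ger0_norm.
Qed.

Lemma cvg_hnorm_le V (T : Type) (F : set_system T) {FF : Filter F}
    (f : T -> V) (l : V) (g : T -> R) :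
  (\forall t \near F, hnorm (f t - l) <= g t) -> g @ F --> (0 : R) ->
  f @ F --> l.
Proof.
move=> fg /cvgrPdist_lt g0; apply/cvg_hnormP => e /g0 ge.
near=> t; apply: (@le_lt_trans _ _ (g t)); first by near: t.
apply: le_lt_trans (ler_norm _) _.
by rewrite -normrN -[- g t]sub0r; near: t.
Unshelve. all: by end_near. Qed.

Lemma cvg_hnorm_cst V (T : Type) (F : set_system T) {FF : Filter F}
    (f : T -> V) (l : V) : f @ F --> l -> (fun t => hnorm (f t)) @ F --> hnorm l.
Proof.
move=> /cvg_hnormP h; apply/cvgrPdist_lt => e /h; apply: filterS => t /=.
by apply: le_lt_trans; rewrite distrC hnorm_lip.
Qed.

Lemma hnorm_cvg_le V (T : Type) (F : set_system T) {FF : ProperFilter F}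
    (f : T -> V) (l : V) (M : R) :
  f @ F --> l -> (\forall t \near F, hnorm (f t) <= M) -> hnorm l <= M.
Proof.
move=> /cvg_hnorm_cst fl fM; rewrite -(cvg_lim (@Rhausdorff R) fl).
by apply: limr_le => //; apply/cvg_ex; exists (hnorm l).
Qed.

Lemma cvg_uniq V (T : Type) (F : set_system T) {FF : ProperFilter F}
    (f : T -> V) (l m : V) : f @ F --> l -> f @ F --> m -> l = m.
Proof. by move=> fl fm; exact: (cvg_unique _ fl fm). Qed.

Lemma cauchy_hnorm (V : completeNormedModType R[i]) (u : nat -> V) :
  (forall e : R, 0 < e -> exists N : nat, forall m n : nat,
     (N <= m)%N -> (N <= n)%N -> hnorm (u m - u n) < e) ->
  exists l : V, u @ \oo --> l.
Proof.
move=> h; suff : cvg (u @ \oo) by move=> /cvg_ex.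
apply/cauchy_cvgP/cauchy_ballP => e e0.
have er := gtr0_real e0.
have [|N HN] := h (complex.Re e).
  by move: e0; rewrite -{1}(RRe_real er) ltcR.
exists (u @` [set n | (N <= n)%N], u @` [set n | (N <= n)%N]).
  by split; exists N => // n Nn; exists n.
move=> [_ _] [/= [m Nm <-] [n Nn <-]]; rewrite -ball_normE /ball_/= hnormE -(RRe_real er) ltcR.
exact: HN.
Qed.

Lemma cauchy_hnorm_bound (V : completeNormedModType R[i]) (u : nat -> V)
  (a : nat -> R) : a @ \oo --> (0 : R) ->
  (forall m n : nat, (n <= m)%N -> hnorm (u m - u n) <= a n) ->
  exists l : V, u @ \oo --> l.
Proof.
move=> /cvgrPdist_lt a0 h; apply: cauchy_hnorm => e /a0 [N _ HN].
have HN' n : (N <= n)%N -> a n < e.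
  move=> Nn; have := HN n Nn; rewrite /= sub0r normrN.
  by apply: le_lt_trans; exact: ler_norm.
exists N => m n Nm Nn; case: (leqP n m) => [nm|/ltnW mn].
  by apply: le_lt_trans (h _ _ nm) _; exact: HN'.
by rewrite hnormB; apply: le_lt_trans (h _ _ mn) _; exact: HN'.
Qed.

Lemma denseP V (A : set V) : dense A <->
  (forall x (e : R), 0 < e -> exists2 y, A y & hnorm (y - x) < e).
Proof.
split.
  move=> dA x e e0.
  have e0' : 0 < e%:C by rewrite ltcR.
  have [y [By Ay]] := dA (ball x e%:C)
    (ex_intro _ x (ballxx x e0')) (ball_open x _).
  by exists y => //; move: By; rewrite -ball_normE /ball_/= hnormE ltcR hnormB.
move=> h O [x Ox] oO.
have /nbhs_ballP[e /= e0 eO] : nbhs x O by exact: open_nbhs_nbhs.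
have er := gtr0_real e0.
have [|y Ay yx] := h x (complex.Re e).
  by move: e0; rewrite -{1}(RRe_real er) ltcR.
exists y; split => //; apply: eO.
by rewrite -ball_normE /ball_/= hnormE hnormB -(RRe_real er) ltcR.
Qed.

Lemma dense_seq V (A : set V) : dense A ->
  forall x, exists u : nat -> V, (forall n, A (u n)) /\ u @ \oo --> (x : V).
Proof.
move=> /denseP dA x.
have /choice[u hu] : forall n : nat, exists y, A y /\ hnorm (y - x) < n.+1%:R^-1.
  by move=> n; have [|y] := dA x n.+1%:R^-1; [rewrite invr_gt0|exists y].
exists u; split; first by move=> n; case: (hu n).
apply: (@cvg_hnorm_le _ _ _ _ _ _ (fun n => n.+1%:R^-1)).
  by apply: nearW => n; apply: ltW; case: (hu n).
exact: (@cvg_harmonic R).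
Qed.

(** [bounded_op] with an explicit constant (see [bounded_opP]), the form that composes in
    estimates. *)
Definition bop V W (f : V -> W) := linear f /\
  exists2 M : R, 0 <= M & forall x, hnorm (f x) <= M * hnorm x.

Lemma lin0 V W (f : V -> W) : linear f -> f 0 = 0.
Proof.
by move=> lf; have := lf (-1) 0 0; rewrite scaler0 addr0 scaleN1r addNr.
Qed.

Lemma linD V W (f : V -> W) : linear f -> forall x y, f (x + y) = f x + f y.
Proof. by move=> lf x y; rewrite -[x]scale1r lf !scale1r. Qed.

Lemma linZ V W (f : V -> W) : linear f -> forall a x, f (a *: x) = a *: f x.
Proof. by move=> lf a x; rewrite -[a *: x]addr0 lf lin0// !addr0. Qed.

Lemma linN V W (f : V -> W) : linear f -> forall x, f (- x) = - f x.
Proof. by move=> lf x; rewrite -scaleN1r linZ// scaleN1r. Qed.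

Lemma linB V W (f : V -> W) : linear f -> forall x y, f (x - y) = f x - f y.
Proof. by move=> lf x y; rewrite linD// linN. Qed.

Lemma lin_sum V W (f : V -> W) : linear f ->
  forall (I : Type) (r : seq I) (P : pred I) (F : I -> V),
  f (\sum_(i <- r | P i) F i) = \sum_(i <- r | P i) f (F i).
Proof.
move=> lf I r P F; elim/big_rec2 : _ => [|i a b _ <-]; first by rewrite lin0.
by rewrite linD.
Qed.

Lemma bop_cvg V W (f : V -> W) (T : Type) (F : set_system T) {FF : Filter F}
    (g : T -> V) (l : V) : bop f ->
  g @ F --> l -> (fun t => f (g t)) @ F --> f l.
Proof.
move=> [lf [M M0 fM]] /cvg_hnorm gl.
apply: (@cvg_hnorm_le _ _ _ _ _ _ (fun t => M * hnorm (g t - l))).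
  by apply: nearW => t; rewrite -linB.
by rewrite -[0](mulr0 M); apply: cvgMr.
Qed.

Lemma bounded_opP V W (f : V -> W) : bounded_op f <-> bop f.
Proof.
split; last first.
  by move=> bf; split; [case: bf|move=> x; apply: (bop_cvg bf)].
move=> [lf cf]; split => //.
have /cvg_hnormP/(_ 1 ltr01) := cf 0.
rewrite nearE => /nbhs_ballP[e /= e0 he].
have er := gtr0_real e0.
have r0 : 0 < complex.Re e.
  by move: e0; rewrite -{1}(RRe_real er) ltcR.
exists (2 / complex.Re e); first by rewrite divr_ge0// ltW.
move=> x; have [->|x0] := eqVneq x 0; first by rewrite lin0// !hnorm0 mulr0.
have nx : 0 < hnorm x.
  by rewrite lt_def hnorm_ge0 andbT; apply: contra_neq x0; exact: hnorm_eq0.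
(* Brings x to half the radius of a ball around 0 whose image stays in the unit ball; this is the
   origin of the constant 2 over the radius. *)
pose k := complex.Re e / 2 / hnorm x.
have k0 : 0 < k by rewrite divr_gt0// divr_gt0.
have : hnorm (f (k%:C *: x) - f 0) < 1.
  apply: he; rewrite -ball_normE /ball_/= sub0r normrN hnormE -(RRe_real er) ltcR.
  rewrite hnormZr gtr0_norm// /k divfK ?gt_eqF//.
  by rewrite ltr_pdivrMr// ltr_pMr// ltr1n.
rewrite lin0// subr0 linZ// hnormZr gtr0_norm// /k => /ltW.
rewrite mulrAC ler_pdivrMr// mul1r -ler_pdivlMl ?divr_gt0//.
by rewrite invf_div.
Qed.

Lemma bop_comp V W Z (f : V -> W) (g : W -> Z) : bop f -> bop g -> bop (g \o f).
Proof.
move=> [lf [M M0 fM]] [lg [N N0 gN]]; split.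
  by move=> a x y /=; rewrite lf lg.
exists (N * M); first exact: mulr_ge0.
move=> x /=; apply: le_trans (gN _) _; rewrite -mulrA ler_wpM2l//.
Qed.

Lemma bop_id V : bop (@id V).
Proof. by split=> //; exists 1 => // x; rewrite mul1r. Qed.

Lemma bopD V W (f g : V -> W) : bop f -> bop g -> bop (fun x => f x + g x).
Proof.
move=> [lf [M M0 fM]] [lg [N N0 gN]]; split.
  by move=> a x y /=; rewrite lf lg scalerDr addrACA.
exists (M + N); first exact: addr_ge0.
move=> x; apply: le_trans (hnormD _ _) _; rewrite mulrDl lerD//.
Qed.

Lemma bopZ V W (a : R[i]) (f : V -> W) : bop f -> bop (fun x => a *: f x).
Proof.
move=> [lf [M M0 fM]]; split.
  by move=> b x y /=; rewrite lf scalerDr !scalerA mulrC.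
exists (cabs a * M); first by rewrite mulr_ge0// cabs_ge0.
by move=> x; rewrite hnormZ -mulrA ler_wpM2l// cabs_ge0.
Qed.

Lemma bopB V W (f g : V -> W) : bop f -> bop g -> bop (fun x => f x - g x).
Proof.
move=> bf bg; have := bopD bf (bopZ (-1) bg).
by under eq_fun do rewrite scaleN1r.
Qed.

Lemma bop_ext_dense V W (f g : V -> W) (A : set V) : bop f -> bop g ->
  dense A -> (forall x, A x -> f x = g x) -> f =1 g.
Proof.
move=> bf bg dA fg x; have [u [Au ux]] := dense_seq dA x.
apply: (cvg_uniq (bop_cvg bf ux)).
have -> : (fun t => f (u t)) = (fun t => g (u t)).
  by apply/funext => n; exact: fg.
exact: bop_cvg bg ux.
Qed.

End Basics.

#[export] Hint Extern 0 (is_true (0 <= hnorm _)) => exact: hnorm_ge0 : core.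

Section Inverses.
Variable R : realType.

Lemma bounded_inverse_surj (V W : normedModType R[i]) (f : V -> W) (m : R) :
  linear f -> 0 < m -> (forall x, m * hnorm x <= hnorm (f x)) ->
  (forall y, exists x, f x = y) -> exists g, bounded_inverse f g.
Proof.
move=> lf m0 fm /choice[g fg].
have fI x : f x = 0 -> x = 0.
  move=> fx; apply/hnorm_eq0/le_anti/andP; split => //.
  by rewrite -(pmulr_rle0 _ m0) -(hnorm0 W) -fx.
have fi x x' : f x = f x' -> x = x'.
  by move=> e; apply/subr0_eq/fI; rewrite linB// e subrr.
exists g; split => //; last by move=> x; apply: fi; rewrite fg.
apply/bounded_opP; split.
  by move=> a x y; apply: fi; rewrite lf !fg.
exists m^-1; first by rewrite invr_ge0 ltW.
by move=> y; rewrite ler_pdivlMl// -[in leRHS](fg y).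
Qed.

(** The iterates u(n+1) = T(u(n)) + y are Cauchy: u(n+k) - u(n) is the image of u(k) under the n-th
    power of T, hence at most q^n times a common bound of all iterates. *)
Lemma neumann (V : completeNormedModType R[i]) (T : V -> V) (q : R) :
  linear T -> 0 <= q < 1 -> (forall x, hnorm (T x) <= q * hnorm x) ->
  forall y, exists x, x - T x = y.
Proof.
move=> lT /andP[q0 q1] Tq y.
pose u := fix u n := if n is n'.+1 then T (u n') + y else 0.
(* The solution of c = q c + |y|, hence a bound that the iteration preserves. *)
pose c := hnorm y / (1 - q).
have q1' : 0 < 1 - q by rewrite subr_gt0.
have c0 : 0 <= c by rewrite divr_ge0// ltW.
have uc n : hnorm (u n) <= c.
  elim: n => [|n IH] /=; first by rewrite hnorm0.
  apply: le_trans (hnormD _ _) _.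
  apply: (@le_trans _ _ (q * c + hnorm y)).
    by rewrite lerD2r (le_trans (Tq _))// ler_wpM2l.
  rewrite -[hnorm y](divfK (lt0r_neq0 q1')) -/c mulrBr mulr1 [q * c]mulrC.
  by rewrite addrC subrK.
have un k n : hnorm (u (n + k)%N - u n) <= q ^+ n * c.
  elim: n => [|n IH]; first by rewrite subr0 expr0 mul1r.
  rewrite addSn /= opprD addrACA subrr addr0 -linB//.
  by rewrite (le_trans (Tq _))// exprS -mulrA ler_wpM2l.
have qc : (fun n => q ^+ n * c) @ \oo --> (0 : R).
  rewrite -(mul0r c); apply: cvgMl; apply: cvg_expr.
  by rewrite ger0_norm.
have [x ux] : exists x : V, u @ \oo --> x.
  apply: (cauchy_hnorm_bound qc) => m n nm.
  by rewrite -(subnKC nm) un.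
exists x.
have bT : bop T by split => //; exists q.
have e1 : (fun n => T (u n)) @ \oo --> T x by exact: bop_cvg.
have e2 : (fun n => u n.+1) @ \oo --> x by rewrite (cvg_shiftS u).
have e3 : (fun n => u n.+1 - T (u n)) @ \oo --> x - T x.
  by apply: cvgB.
have e4 : (fun n => u n.+1 - T (u n)) = cst y.
  by apply/funext => n /=; rewrite addrAC subrr add0r.
rewrite e4 in e3.
by apply: (cvg_uniq e3); exact: cvg_cst.
Qed.

End Inverses.

(** * Real inner products and coercive operators *)

Section Hilbert.
Variables (R : realType) (H : hilbertType R).
Implicit Types x y z : H.

Definition rdot x y : R := complex.Re (hdot x y).

Lemma ReD (a b : R[i]) : complex.Re (a + b) = complex.Re a + complex.Re b.
Proof. by case: a b => [? ?] [? ?]. Qed.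

Lemma ReZ (a : R) (b : R[i]) : complex.Re (a%:C * b) = a * complex.Re b.
Proof. by case: b => ? ? /=; rewrite mul0r subr0. Qed.

Lemma rdotC x y : rdot x y = rdot y x.
Proof.
apply: complexI; rewrite /rdot hermC expr0 mul1r !complexRe.
exact: Re_conj.
Qed.

Lemma rdotDl x y z : rdot (x + y) z = rdot x z + rdot y z.
Proof. by rewrite /rdot linearDl -ReD. Qed.

Lemma rdotZl (a : R) x y : rdot (a%:C *: x) y = a * rdot x y.
Proof. by rewrite /rdot linearZl_LR /= -ReZ. Qed.

Lemma rdotDr x y z : rdot z (x + y) = rdot z x + rdot z y.
Proof. by rewrite rdotC rdotDl rdotC [rdot y z]rdotC. Qed.

Lemma rdotZr (a : R) x y : rdot y (a%:C *: x) = a * rdot y x.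
Proof. by rewrite rdotC rdotZl rdotC. Qed.

Lemma rdotNl x y : rdot (- x) y = - rdot x y.
Proof.
have -> : - x = (-1)%:C *: x by rewrite rmorphN1 scaleN1r.
by rewrite rdotZl mulN1r.
Qed.

Lemma rdotNr x y : rdot y (- x) = - rdot y x.
Proof. by rewrite rdotC rdotNl rdotC. Qed.

Lemma rdotBl x y z : rdot (x - y) z = rdot x z - rdot y z.
Proof. by rewrite rdotDl rdotNl. Qed.

Lemma rdotBr x y z : rdot z (x - y) = rdot z x - rdot z y.
Proof. by rewrite rdotDr rdotNr. Qed.

Lemma rdot0l x : rdot 0 x = 0.
Proof. by rewrite -(subrr x) rdotBl subrr. Qed.

Lemma rdot0r x : rdot x 0 = 0.
Proof. by rewrite rdotC rdot0l. Qed.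

Lemma rdot_hnorm x : rdot x x = hnorm x ^+ 2.
Proof. by rewrite /rdot -hdot_norm hnormE -rmorphXn. Qed.

Lemma rdot_scale (s : R[i]) x : rdot (s *: x) x = complex.Re s * hnorm x ^+ 2.
Proof.
rewrite /rdot linearZl_LR /= -hdot_norm hnormE -rmorphXn.
by case: s => a b /=; rewrite mulr0 subr0.
Qed.

Lemma hnormDsq x y :
  hnorm (x + y) ^+ 2 = hnorm x ^+ 2 + 2 * rdot x y + hnorm y ^+ 2.
Proof.
rewrite -!rdot_hnorm rdotDl !rdotDr [rdot y x]rdotC; ring.
Qed.

Lemma hnormBsq x y :
  hnorm (x - y) ^+ 2 = hnorm x ^+ 2 - 2 * rdot x y + hnorm y ^+ 2.
Proof. by rewrite hnormDsq rdotNr hnormN mulrN. Qed.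

Lemma cauchy_schwarz x y : rdot x y <= hnorm x * hnorm y.
Proof.
have : hnorm (x + y) ^+ 2 <= (hnorm x + hnorm y) ^+ 2.
  by rewrite lerXn2r ?nnegrE ?addr_ge0// hnormD.
rewrite hnormDsq; nra.
Qed.

Lemma cauchy_schwarz_abs x y : `|rdot x y| <= hnorm x * hnorm y.
Proof.
rewrite ler_norml cauchy_schwarz andbT lerNl -rdotNl -[hnorm x]hnormN.
exact: cauchy_schwarz.
Qed.

(** Lax-Milgram by a Neumann series: |x - k f(x)|^2 <= (1 - 2kd + k^2 M^2) |x|^2, so I - k f is a
    strict contraction for small k > 0 and k f is onto. *)
Lemma coercive_inverse (f : H -> H) (d : R) : bop f -> 0 < d ->
  (forall x, d * hnorm x ^+ 2 <= rdot (f x) x) -> exists g, bounded_inverse f g.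
Proof.
move=> [lf [M M0 fM]] d0 fd.
apply: (@bounded_inverse_surj _ _ _ _ d) => //.
  move=> x; have [->|x0] := eqVneq x 0; first by rewrite hnorm0 mulr0.
  have nx : 0 < hnorm x.
    by rewrite lt_def hnorm_ge0 andbT; apply: contra_neq x0; exact: hnorm_eq0.
  rewrite -(ler_pM2r nx) -mulrA -expr2 (le_trans (fd _))//.
  exact: cauchy_schwarz.
(* This [k] gives k M^2 <= d, so the contraction factor squared is at most 1 - k d; the term d^2
   ensures k d <= 1 and a positive denominator. *)
pose k := d / (M ^+ 2 + d ^+ 2).
have den : 0 < M ^+ 2 + d ^+ 2 by rewrite ltr_wpDl ?exprn_ge0// exprn_gt0.
have k0 : 0 < k by rewrite divr_gt0.
have kd : k * (M ^+ 2 + d ^+ 2) = d by rewrite /k divfK ?gt_eqF.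
have kd1 : k * d < 1 + k * d by rewrite ltrDr.
have kd0 : 0 < k * d by rewrite mulr_gt0.
have kdle : k * d <= 1.
  rewrite /k mulrAC -expr2 ler_pdivrMr// mul1r lerDr; exact: exprn_ge0.
have kM : k ^+ 2 * M ^+ 2 <= k * d.
  rewrite -[in leRHS]kd expr2 -mulrA ler_pM2l// ler_pM2l// lerDl.
  by rewrite exprn_ge0// ltW.
pose q := Num.sqrt (1 - k * d).
have lT : linear (fun x => k%:C *: f x).
  by move=> a x z; rewrite lf scalerDr !scalerA [k%:C * a]mulrC.
have q01 : 0 <= q < 1.
  by rewrite sqrtr_ge0/= -sqrtr1 ltr_sqrt ?ltr01// gtrBl.
move=> y; have [||x hx] := neumann (T := fun x => x - k%:C *: f x) _ q01 _ (k%:C *: y).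
- by move=> a x z; rewrite lT scalerBr opprD addrACA.
- move=> x; rewrite -(@ler_pXn2r _ 2)// ?nnegrE ?mulr_ge0// ?hnorm_ge0 ?sqrtr_ge0//.
  rewrite exprMn sqr_sqrtr ?subr_ge0// hnormBsq rdotZr hnormZr rdotC.
  rewrite exprMn real_normK ?num_real//.
  have h1 := ler_wpM2l (ltW k0) (fd x).
  have h2 : k ^+ 2 * hnorm (f x) ^+ 2 <= k * d * hnorm x ^+ 2.
    apply: le_trans _ (ler_wpM2r (exprn_ge0 2 (hnorm_ge0 x)) kM).
    rewrite -[_ * M ^+ 2 * _]mulrA -[M ^+ 2 * _]exprMn ler_wpM2l ?exprn_ge0 ?(ltW k0)//.
    by rewrite lerXn2r ?nnegrE ?mulr_ge0.
  move: h1 h2; lra.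
exists x; move: hx; rewrite opprB addrCA subrr addr0 => hx.
have k0' : k%:C != 0 :> R[i] by rewrite gt_eqF// ltcR.
exact: (scalerI k0').
Qed.

End Hilbert.

(** * Uniform boundedness *)

Section UniformBoundedness.
Variables (R : realType) (V : completeNormedModType R[i]) (W : normedModType R[i]).

(* Either x + v or x - v has an image of norm at least |f v|. *)
Lemma gliding_step (f : V -> W) (x v : V) : linear f ->
  exists x', hnorm (f v) <= hnorm (f x') /\ hnorm (x' - x) = hnorm v.
Proof.
move=> lf; case: (leP (hnorm (f v)) (hnorm (f (x + v)))) => h.
  by exists (x + v); split => //; rewrite addrAC subrr add0r.
exists (x - v); split; last by rewrite addrAC subrr add0r hnormN.
have e : (2 : R)%:C *: f v = f (x + v) - f (x - v).
  rewrite linD// linB// opprB addrC addrA subrK -[in RHS](scale1r (f v)) -scalerDl.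
  by congr (_ *: _); rewrite rmorphD.
have := hnormDB (f (x + v)) (f (x - v)).
rewrite -e hnormZr ger0_norm//; lra.
Qed.

Lemma almost_norming (f : V -> W) : bop f -> forall M : R,
  ~ (forall x, hnorm (f x) <= M * hnorm x) ->
  exists (v : V) (N : R), [/\ hnorm v <= 1, M <= N,
    forall x, hnorm (f x) <= N * hnorm x & 3 * N <= 4 * hnorm (f v)].
Proof.
move=> [lf [B B0 fB]] M nM.
pose A := [set hnorm (f x) | x in [set x : V | hnorm x <= 1]].
have hA : has_sup A.
  split; first by exists (hnorm (f 0)); exists 0 => //=; rewrite hnorm0.
  exists B => _ [x /= x1 <-]; apply: le_trans (fB x) _.
  by rewrite ler_piMr.
have supP x : hnorm (f x) <= sup A * hnorm x.
  have [->|x0] := eqVneq x 0; first by rewrite lin0// !hnorm0 mulr0.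
  have nx : 0 < hnorm x.
    by rewrite lt_def hnorm_ge0 andbT; apply: contra_neq x0; exact: hnorm_eq0.
  rewrite -ler_pdivrMr//; apply: ub_le_sup; first by case: hA.
  exists ((hnorm x)^-1%:C *: x).
    by rewrite /= hnormZr gtr0_norm ?invr_gt0// mulVf ?gt_eqF.
  by rewrite linZ// hnormZr gtr0_norm ?invr_gt0// mulrC.
have MA : M <= sup A.
  rewrite leNgt; apply/negP => AM; apply: nM => x.
  by apply: le_trans (supP x) _; rewrite ler_wpM2r// ltW.
(* A zero norm leaves no room for the slack [sup A / 4] taken below; there v = 0 and N = 0 serve. *)
have [A0|A0] := eqVneq (sup A) 0.
  exists 0, 0; rewrite hnorm0 ler01 -A0; split => //.
  by rewrite A0 mulr0 mulr_ge0.
have Agt0 : 0 < sup A.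
  rewrite lt_def A0/= ; apply: le_trans (hnorm_ge0 (f 0)) _.
  by apply: ub_le_sup; [case: hA|exists 0 => //=; rewrite hnorm0].
have ltr0Sn' : 0 < 4 :> R by [].
have [_ [v /= v1 <-] hv] := @sup_adherent _ A (sup A / 4) (divr_gt0 Agt0 ltr0Sn') hA.
by exists v, (sup A); split => //; move: hv; lra.
Qed.

(* Sokal's gliding-hump proof; Banach_Steinhauss is restricted to real scalars. *)
Theorem uniform_boundedness (f : nat -> V -> W) : (forall n, bop (f n)) ->
  (forall x, exists B : R, forall n, hnorm (f n x) <= B) ->
  exists M : R, forall n x, hnorm (f n x) <= M * hnorm x.
Proof.
move=> bf pf; apply: contrapT => nM.
have nM' k : exists n, ~ (forall x, hnorm (f n x) <= (4 ^+ k) * hnorm x).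
  apply: contrapT => h; apply: nM; exists (4 ^+ k) => n x.
  have /contrapT := (forallNP _).2 h n; exact.
have {nM'} /choice[p hp] : forall k, exists q : nat * (V * R),
    [/\ hnorm q.2.1 <= 1, 4 ^+ k <= q.2.2,
    forall x, hnorm (f q.1 x) <= q.2.2 * hnorm x
     & 3 * q.2.2 <= 4 * hnorm (f q.1 q.2.1)].
  move=> k; have [n hn] := nM' k.
  by have [v [N h]] := almost_norming (bf n) hn; exists (n, (v, N)).
(* Step k gains 3/4 N r(k) in the norm of the k-th image, N >= 4^k being the norm of that operator.
   All later steps move the point by at most 3/2 r(k+1) = r(k)/2 and lose at most N r(k)/2. What
   remains is at least (4/3)^k / 4, which is unbounded. *)
pose r k : R := (3 ^+ k)^-1.
have r0 k : 0 < r k by rewrite invr_gt0 exprn_gt0.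
have step k x : exists x',
   hnorm (f (p k).1 ((r k)%:C *: (p k).2.1)) <= hnorm (f (p k).1 x') /\
   hnorm (x' - x) = hnorm ((r k)%:C *: (p k).2.1).
  by apply: gliding_step; case: (bf (p k).1).
have /choice[s hs] : forall kx : nat * V, exists x',
   hnorm (f (p kx.1).1 ((r kx.1)%:C *: (p kx.1).2.1)) <= hnorm (f (p kx.1).1 x') /\
   hnorm (x' - kx.2) = hnorm ((r kx.1)%:C *: (p kx.1).2.1).
  by move=> [k x]; exact: step.
pose u := fix u k := if k is k'.+1 then s (k', u k') else 0.
have us k : hnorm (u k.+1 - u k) <= r k.
  have [_ /= ->] := hs (k, u k).
  have [h _ _ _] := hp k.
  by rewrite hnormZr gtr0_norm// ler_piMr// ltW.
have uf k : r k * hnorm (f (p k).1 (p k).2.1) <= hnorm (f (p k).1 (u k.+1)).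
  have [/= h _] := hs (k, u k); apply: le_trans h.
  by rewrite linZ; [rewrite hnormZr gtr0_norm|case: (bf (p k).1)].
have rS k : r k.+1 = r k / 3 by rewrite /r exprS invfM mulrC.
have um k m : hnorm (u (k + m)%N - u k) <= 3 / 2 * r k - 3 / 2 * r (k + m)%N.
  elim: m => [|m IH]; first by rewrite addn0 !subrr hnorm0.
  rewrite addnS; have := us (k + m)%N; have := hnorm_tri (u (k + m)%N) (u (k + m).+1) (u k).
  rewrite rS; move: IH; lra.
have um' k m : (k <= m)%N -> hnorm (u m - u k) <= 3 / 2 * r k.
  move=> km; have := um k (m - k)%N; rewrite subnKC// => h.
  by apply: le_trans h _; rewrite gerBl mulr_ge0 ?divr_ge0// ltW.
have rc : (fun k => 3 / 2 * r k) @ \oo --> (0 : R).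
  rewrite -(mulr0 (3 / 2)); apply: cvgMr.
  have -> : r = (fun k => (3^-1) ^+ k) by apply/funext => k; rewrite /r exprVn.
  by apply: cvg_expr; rewrite ger0_norm ?invr_ge0// invf_lt1// ltr1n.
have [x ux] : exists x : V, u @ \oo --> x
  by apply: (cauchy_hnorm_bound rc) => m n; exact: um'.
have xk k : hnorm (x - u k) <= 3 / 2 * r k.
  have : (fun m => u m - u k) @ \oo --> x - u k by apply: cvgB => //; exact: cvg_cst.
  by move/hnorm_cvg_le; apply; exists k => // m /= km; exact: um'.
have [B hB] := pf x.
have key k : (4 / 3) ^+ k <= 4 * B.
  have [_ N4 fN fv] := hp k.
  have lf : linear (f (p k).1) by case: (bf (p k).1).
  have h1 := uf k.
  have h2 := xk k.+1; rewrite rS in h2.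
  have h3 := fN (u k.+1 - x); rewrite hnormB in h2.
  have h4 := hB (p k).1.
  have h5 : hnorm (f (p k).1 (u k.+1)) <= hnorm (f (p k).1 (u k.+1 - x)) + hnorm (f (p k).1 x).
    by rewrite -[X in hnorm (f _ X) <= _](subrK x) linD// hnormD.
  have N0 : 0 <= (p k).2.2 by rewrite (le_trans _ N4)// exprn_ge0.
  have h6 : hnorm (f (p k).1 (u k.+1 - x)) <= (p k).2.2 * (r k / 2).
    apply: le_trans h3 _; rewrite ler_wpM2l//; apply: le_trans h2 _; lra.
  have h7 : r k * (3 * (p k).2.2) <= r k * (4 * hnorm (f (p k).1 (p k).2.1)).
    by rewrite ler_pM2l.
  have h8 : (4 / 3) ^+ k <= r k * (p k).2.2.
    by rewrite expr_div_n mulrC ler_pM2l.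
  lra.
have e : (4 / 3 : R) = 1 + 1 / 3 by field.
have [k hk] : exists k : nat, 4 * B < 1 + k%:R * (1 / 3).
  exists (Num.truncn (12 * B)).+1.
  have := truncnS_gt (12 * B); lra.
have := key k; rewrite e leNgt => /negP; apply.
apply: lt_le_trans hk _.
elim: k => [|k IH]; first by rewrite mul0r addr0 expr0.
rewrite exprS -natr1.
apply: (@le_trans _ _ ((1 + 1 / 3) * (1 + k%:R * (1 / 3)))).
  have : 0 <= k%:R :> R by [].
  nra.
by rewrite ler_wpM2l.
Qed.

End UniformBoundedness.

(** * Derivatives and limits on the half-line *)

Section EpsilonDelta.
Variable R : realType.
Implicit Types V : normedModType R[i].

Lemma quotient_le V (a b : V) (h e : R) : h != 0 ->
  (hnorm ((h^-1)%:C *: a - b) <= e) = (hnorm (a - h%:C *: b) <= e * `|h|).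
Proof.
move=> h0; have -> : a - h%:C *: b = h%:C *: ((h^-1)%:C *: a - b).
  by rewrite scalerBr scalerA -rmorphM/= divff// scale1r.
by rewrite hnormZr mulrC ler_pM2r// normr_gt0.
Qed.

Lemma right_diffP V (f : R -> V) (y : V) :
  ((h^-1)%:C *: f h) @[h --> 0^'+] --> y <->
  (forall e : R, 0 < e -> exists2 d : R, 0 < d &
     forall h, 0 < h < d -> hnorm (f h - h%:C *: y) <= e * h).
Proof.
rewrite cvg_hnormP; split.
  move=> H e e0; have := H e e0.
  rewrite near_withinE => /nbhs_ballP[d /= d0 hd].
  exists d => // h /andP[h0 hd'].
  rewrite -[X in _ * X](gtr0_norm h0) -quotient_le ?gt_eqF//.
  apply/ltW/hd => //; by rewrite -ball_normE /ball_/= sub0r normrN gtr0_norm.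
move=> H e e0; have [|d d0 hd] := H (e / 2); first by rewrite divr_gt0.
rewrite near_withinE; apply/nbhs_ballP; exists d => //= h.
rewrite -ball_normE /ball_/= sub0r normrN => hd' h0.
apply: (@le_lt_trans _ _ (e / 2)).
  rewrite quotient_le ?gt_eqF// gtr0_norm//; apply: hd.
  by rewrite h0/= -(gtr0_norm h0).
by rewrite ltr_pdivrMr// ltr_pMr// ltr1n.
Qed.

Lemma right_cvgP V (f : R -> V) (y : V) :
  f h @[h --> 0^'+] --> y <->
  (forall e : R, 0 < e -> exists2 d : R, 0 < d &
     forall h, 0 < h < d -> hnorm (f h - y) < e).
Proof.
rewrite cvg_hnormP; split.
  move=> H e e0; have := H e e0.
  rewrite near_withinE => /nbhs_ballP[d /= d0 hd].
  exists d => // h /andP[h0 hd'].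
  apply/hd => //; by rewrite -ball_normE /ball_/= sub0r normrN gtr0_norm.
move=> H e e0; have [d d0 hd] := H e e0.
rewrite near_withinE; apply/nbhs_ballP; exists d => //= h.
rewrite -ball_normE /ball_/= sub0r normrN => hd' h0.
by apply: hd; rewrite h0/= -(gtr0_norm h0).
Qed.

(** The o(h) form also makes sense at h = 0, which the punctured filter excludes, and involves no
    division. *)
Lemma derivative_onP V (f g : R -> V) : derivative_on f g <->
  (forall t : R, 0 <= t -> forall e : R, 0 < e -> exists2 d : R, 0 < d &
     forall h, `|h| < d -> 0 <= t + h ->
       hnorm (f (t + h) - f t - h%:C *: g t) <= e * `|h|).
Proof.
split => H t t0.
  move=> e e0; have /cvg_hnormP/(_ e e0) := H t t0.
  rewrite near_withinE => /nbhs_ballP[d /= d0 hd].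
  exists d => // h hd' th.
  have [->|h0] := eqVneq h 0.
    by rewrite addr0 subrr scale0r subrr hnorm0 normr0 mulr0.
  rewrite -quotient_le//; apply/ltW/hd => //.
  by rewrite -ball_normE /ball_/= sub0r normrN.
apply/cvg_hnormP => e e0.
have [|d d0 hd] := H t t0 (e / 2); first by rewrite divr_gt0.
rewrite near_withinE; apply/nbhs_ballP; exists d => //= h.
rewrite -ball_normE /ball_/= sub0r normrN => hd' h0 th.
apply: (@le_lt_trans _ _ (e / 2)); first by rewrite quotient_le//; exact: hd.
by rewrite ltr_pdivrMr// ltr_pMr// ltr1n.
Qed.

Lemma within_contP V (g : R -> V) : {within `[0, +oo[, continuous g} <->
  (forall t : R, 0 <= t -> forall e : R, 0 < e -> exists2 d : R, 0 < d &
     forall s, 0 <= s -> `|s - t| < d -> hnorm (g s - g t) < e).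
Proof.
have inE0 (t : R) : t \in [set` `[0 : R, +oo[] = (0 <= t).
  by apply/idP/idP; rewrite inE /= in_itv/= andbT.
split => [/subspace_continuousP H t t0 e e0|H].
  have /cvg_hnormP/(_ e e0) := H t (set_mem (etrans (inE0 t) t0)).
  rewrite near_withinE => /nbhs_ballP[d /= d0 hd].
  exists d => // s s0 st; apply: hd; last by rewrite /= in_itv /= andbT.
  by rewrite -ball_normE /ball_/= distrC.
apply/subspace_continuousP => t /mem_set; rewrite inE0 => t0.
apply/cvg_hnormP => e e0; have [d d0 hd] := H t t0 e e0.
rewrite near_withinE; apply/nbhs_ballP; exists d => //= s.
rewrite -ball_normE /ball_/= distrC => st; rewrite /= in_itv /= andbT => s0.
exact: hd.
Qed.

End EpsilonDelta.

(** * Strongly continuous semigroups *)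

Lemma mulrn_scale (R : realType) (V : lmodType R[i]) (v : V) (n : nat) :
  v *+ n = (n%:R : R)%:C *: v.
Proof. by rewrite rmorph_nat scaler_nat. Qed.

Section SemigroupBasics.
Variables (R : realType) (X : hilbertType R) (T : R -> X -> X).
Hypothesis C0T : C0_semigroup T.

Lemma C0_bop t : 0 <= t -> bop (T t).
Proof. by case: C0T => h _ _ _ /h /bounded_opP. Qed.

Lemma C0_0 x : T 0 x = x. Proof. by case: C0T. Qed.

Lemma C0_add s t x : 0 <= s -> 0 <= t -> T (s + t) x = T s (T t x).
Proof. by case: C0T => _ _ + _; apply. Qed.

Lemma C0_small x e : 0 < e -> exists2 d : R, 0 < d &
  forall r, 0 <= r < d -> hnorm (T r x - x) < e.
Proof.
case: C0T => _ T0 _ /(_ x) /right_cvgP H e0; have [d d0 hd] := H e e0.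
exists d => // r /andP[]; rewrite le_eqVlt => /predU1P[<- _|r0 rd].
  by rewrite T0 subrr hnorm0.
by apply: hd; rewrite r0.
Qed.

(** Otherwise there are times t(n) <= 1/(n+1) at which T exceeds the bound n, while T(t(n)) x tends
    to x and is bounded for each x, against uniform boundedness. *)
Lemma C0_bound_small : exists (d M : R), [/\ 0 < d, 0 <= M &
  forall t x, 0 <= t <= d -> hnorm (T t x) <= M * hnorm x].
Proof.
apply: contrapT => nH.
have /choice[t ht] : forall n : nat, exists t, 0 <= t <= n.+1%:R^-1 /\
    ~ (forall x, hnorm (T t x) <= n%:R * hnorm x).
  move=> n; apply: contrapT => /forallNP h; apply: nH.
  exists n.+1%:R^-1, n%:R; split => [|//|t x td]; first by rewrite invr_gt0.
  have := h t; rewrite not_andE => -[//|/contrapT]; exact.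
have t0 n : 0 <= t n by have [/andP[]] := ht n.
have [x|M HM] := @uniform_boundedness _ _ _ (fun n => T (t n)) (fun n => C0_bop (t0 n)).
  have : (fun n => T (t n) x) @ \oo --> x.
    apply/cvg_hnormP => e e0; have [d d0 hd] := C0_small x e0.
    have /cvgrPdist_lt/(_ d d0) := @cvg_harmonic R.
    apply: filterS => n; rewrite sub0r normrN => nd; apply: hd.
    rewrite t0/=; have [/andP[_ tn] _] := ht n.
    apply: le_lt_trans tn _; apply: le_lt_trans nd; exact: ler_norm.
  move=> /cvg_hnorm_cst h.
  have /cvg_seq_bounded[B [_ /(_ (B + 1)) HB]] :
     cvg ((fun n => hnorm (T (t n) x)) @ \oo).
    by apply/cvg_ex; exists (hnorm x); exact: h.
  exists (B + 1) => n; apply: le_trans (ler_norm _) _.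
  by apply: HB; rewrite ?ltrDl.
have [_ hn] := ht (Num.truncn M).+1; apply: hn => x.
by apply: le_trans (HM _ x) _; rewrite ler_wpM2r// ltW// truncnS_gt.
Qed.

Lemma C0_bound c : exists2 M : R, 0 <= M &
  forall t x, 0 <= t <= c -> hnorm (T t x) <= M * hnorm x.
Proof.
have [d [M [d0 M0 HM]]] := C0_bound_small.
have H n : exists2 M : R, 0 <= M &
    forall t x, 0 <= t <= n.+1%:R * d -> hnorm (T t x) <= M * hnorm x.
  elim: n => [|n [N N0 HN]].
    by exists M => // t x; rewrite mul1r; exact: HM.
  exists (Num.max M (N * M)); first by rewrite le_max M0.
  move=> t x /andP[t0 td]; case: (leP t d) => [t1|/ltW t1].
    apply: (@le_trans _ _ (M * hnorm x)); first by apply: HM; rewrite t0.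
    by rewrite ler_wpM2r// le_max lexx.
  have td0 : 0 <= t - d by rewrite subr_ge0.
  rewrite -[t](subrK d) C0_add// ?(ltW d0)//.
  apply: (@le_trans _ _ (N * (M * hnorm x))).
    apply: le_trans (HN _ _ _) _.
      by rewrite td0/= lerBlDr; move: td; rewrite -[n.+2%:R]natr1 mulrDl mul1r.
    by rewrite ler_wpM2l// HM// lexx ltW.
  by rewrite mulrA ler_wpM2r// le_max lexx orbT.
have [N N0 HN] := H (Num.truncn (c / d)).
exists N => // t x /andP[t0 tc]; apply: HN; rewrite t0/=.
apply: le_trans tc _; rewrite -ler_pdivrMr//; exact/ltW/truncnS_gt.
Qed.

Lemma C0_unif c (M : R) : (forall t x, 0 <= t <= c -> hnorm (T t x) <= M * hnorm x) ->
  forall s t x, 0 <= s <= t -> t <= c ->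
  hnorm (T t x - T s x) <= M * hnorm (T (t - s) x - x).
Proof.
move=> HM s t x /andP[s0 st] tc.
have -> : T t x = T s (T (t - s) x).
  by rewrite -C0_add ?subr_ge0// addrC subrK.
have [lT _] := C0_bop s0; rewrite -(linB lT); apply: HM.
by rewrite s0 (le_trans st).
Qed.

(** The semigroup axioms only give right continuity at 0. Factoring out the operator at the smaller
    of the two times, which is bounded on [0, t + 1], gives both one-sided limits. *)
Lemma C0_cont t x : 0 <= t -> forall e : R, 0 < e -> exists2 d : R, 0 < d &
  forall s, 0 <= s -> `|s - t| < d -> hnorm (T s x - T t x) < e.
Proof.
move=> t0 e e0; have [M M0 HM] := C0_bound (t + 1).
have M1 : 0 < M + 1 by rewrite ltr_wpDl.
have [|d d0 hd] := @C0_small x (e / (M + 1)); first by rewrite divr_gt0.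
exists (Num.min d 1) => [|s s0]; first by rewrite lt_min d0 ltr01.
rewrite lt_min => /andP[sd s1].
have key a b : 0 <= a <= b -> b <= t + 1 -> `|b - a| < d ->
    hnorm (T b x - T a x) < e.
  move=> ab bt bad; apply: le_lt_trans (C0_unif HM x ab bt) _.
  have ba0 : 0 <= b - a by rewrite subr_ge0; case/andP: ab.
  have : hnorm (T (b - a) x - x) < e / (M + 1).
    by apply: hd; rewrite ba0/= -(ger0_norm ba0).
  rewrite ltr_pdivlMr// mulrC => h; apply: le_lt_trans h.
  by rewrite ler_wpM2r// lerDl.
case: (leP s t) => [st|/ltW ts].
  by rewrite hnormB; apply: key; rewrite ?s0 ?lerDl// distrC.
apply: key; rewrite ?t0//.
by move: s1; rewrite ger0_norm ?subr_ge0// ltrBlDl => /ltW.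
Qed.

Lemma C0_orbit_cont x : {within `[0, +oo[, continuous (fun t => T t x)}.
Proof. by apply/within_contP => t t0 e e0; exact: C0_cont. Qed.

(** Left-endpoint sum, on n equal cells, for the integral of the orbit of x over [0, d]; the
    vector-valued integral is obtained as a limit of these sums. *)
Definition riemann_sum (d : R) (n : nat) (x : X) : X :=
  (d / n%:R)%:C *: \sum_(k < n) T (d * k%:R / n%:R) x.

Section Riemann.
Variables (d M : R).
Hypotheses (d0 : 0 < d) (M0 : 0 <= M).
Hypothesis HM : forall t x, 0 <= t <= d -> hnorm (T t x) <= M * hnorm x.

Let pt0 (k n : nat) : 0 <= d * k%:R / n%:R.
Proof. by rewrite divr_ge0// mulr_ge0// ltW. Qed.

Let ptd (k n : nat) : (k <= n)%N -> d * k%:R / n%:R <= d.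
Proof.
case: n => [|n] kn; first by rewrite invr0 mulr0 ltW.
by rewrite ler_pdivrMr// ler_pM2l// ler_nat.
Qed.

Let ptk (k n : nat) (x : X) : (k < n)%N ->
  hnorm (T (d * k%:R / n%:R) x) <= M * hnorm x.
Proof. by move=> kn; apply: HM; rewrite pt0 ptd// ltnW. Qed.

Lemma riemann_sum_lin n : linear (riemann_sum d n).
Proof.
move=> a x y; rewrite /riemann_sum [in RHS]scalerA [a * _]mulrC -[in RHS]scalerA.
rewrite -scalerDr; congr (_ *: _).
rewrite scaler_sumr -big_split /=; apply: eq_bigr => k _.
by case: (C0_bop (pt0 k n)) => ->.
Qed.

Lemma riemann_avg n (f : 'I_n -> X) (B : R) : 0 <= B ->
  (forall k, hnorm (f k) <= B) ->
  hnorm ((d / n%:R)%:C *: \sum_(k < n) f k) <= d * B.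
Proof.
move=> B0 fB; rewrite hnormZr ger0_norm ?divr_ge0 ?(ltW d0)//.
case: n f fB => [|n] f fB; first by rewrite invr0 mulr0 mul0r mulr_ge0// ltW.
have h : hnorm (\sum_k f k) <= n.+1%:R * B.
  apply: le_trans (hnorm_sum _ _ _) _.
  apply: (@le_trans _ _ (\sum_(k < n.+1) B)); first by apply: ler_sum.
  by rewrite sumr_const card_ord mulr_natl.
apply: (@le_trans _ _ (d / n.+1%:R * (n.+1%:R * B))).
  by rewrite ler_wpM2l// divr_ge0// ltW.
by rewrite mulrA divfK.
Qed.

Lemma riemann_sum_bound n x : hnorm (riemann_sum d n x) <= d * M * hnorm x.
Proof.
by rewrite -mulrA; apply: riemann_avg => [|k]; [rewrite mulr_ge0|exact: ptk].
Qed.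

(** The fine node k lies in the coarse cell k / q, at distance less than d / n from its left end;
    factoring out T at that end leaves an increment of size at most w. *)
Lemma riemann_refine n q x (w : R) : (0 < n)%N -> (0 < q)%N -> 0 <= w ->
  (forall r, 0 <= r <= d / n%:R -> hnorm (T r x - x) <= w) ->
  hnorm (riemann_sum d (n * q) x - riemann_sum d n x) <= d * (M * w).
Proof.
move=> n0 q0 w0 hw.
have nr : n%:R != 0 :> R by rewrite pnatr_eq0 -lt0n.
have qr : q%:R != 0 :> R by rewrite pnatr_eq0 -lt0n.
pose g k := T (d * k%:R / (n * q)%:R) x - T (d * (k %/ q)%:R / n%:R) x.
have -> : riemann_sum d (n * q) x - riemann_sum d n x =
    (d / (n * q)%:R)%:C *: \sum_(k < n * q) g k.
  rewrite sumrB scalerBr; congr (_ - _).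
  rewrite -(big_mkord xpredT (fun k => T (d * (k %/ q)%:R / n%:R) x)).
  rewrite big_nat_mul mulnC.
  have -> : \sum_(0 <= i < n) \sum_(i * q <= j < i.+1 * q) T (d * (j %/ q)%:R / n%:R) x
     = (q%:R)%:C *: \sum_(k < n) T (d * k%:R / n%:R) x.
    rewrite big_mkord scaler_sumr; apply: eq_bigr => i _.
    rewrite (eq_big_nat _ _ (F2 := fun=> T (d * i%:R / n%:R) x)).
      rewrite sumr_const_nat mulSn addnK rmorph_nat scaler_nat//.
    move=> j; rewrite mulSn addnC => /andP[h1 h2].
    have -> : (j %/ q = i)%N; last by [].
    by rewrite -[j](subnKC h1) divnMDl// divn_small ?addn0// ltn_subLR.
  rewrite scalerA -rmorphM; congr (_%:C *: _).
  by rewrite natrM; field; rewrite nr qr.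
apply: riemann_avg => [|k]; first by rewrite mulr_ge0.
pose a := d * (k %/ q)%:R / n%:R; pose r := d * (k %% q)%:R / (n * q)%:R.
have kq : (k %/ q < n)%N by rewrite ltn_divLR.
have e : d * k%:R / (n * q)%:R = a + r.
  rewrite /a /r [in LHS](divn_eq k q) natrD !natrM; field.
  by rewrite qr nr.
have r0 : 0 <= r by exact: pt0.
rewrite /g e -/a C0_add//; last exact: pt0.
have [lT _] := C0_bop (pt0 (k %/ q) n).
rewrite -(linB lT); apply: le_trans (ptk _ kq) _; rewrite ler_wpM2l// hw// r0/=.
have -> : r = d / n%:R * ((k %% q)%:R / q%:R).
  by rewrite /r natrM; field; rewrite nr qr.
rewrite ler_piMr ?divr_ge0 ?(ltW d0)//.
by rewrite ler_pdivrMr ?mul1r ?ltr0n// ler_nat ltnW// ltn_pmod.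
Qed.

(** Discrete form of (T(h) - I) int_0^d T = int_0^h T (T(d) - I): shifting n consecutive terms by j
    drops the first j and adds the j terms that follow, which are their images under T(d). *)
Lemma riemann_shift n j x : (0 < n)%N ->
  T (d * j%:R / n%:R) (riemann_sum d n x) - riemann_sum d n x =
  (d / n%:R)%:C *: \sum_(k < j) T (d * k%:R / n%:R) (T d x - x).
Proof.
move=> n0; have nr : n%:R != 0 :> R by rewrite pnatr_eq0 -lt0n.
have [lT _] := C0_bop (pt0 j n).
rewrite /riemann_sum linZ// -scalerBr; congr (_ *: _); rewrite lin_sum//.
pose g k := T (d * k%:R / n%:R) x.
have gA k i : T (d * k%:R / n%:R) (T (d * i%:R / n%:R) x) = g (k + i)%N.
  by rewrite -C0_add// -mulrDl -mulrDr -natrD.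
have eTd : T d x = T (d * n%:R / n%:R) x by rewrite mulfK.
under eq_bigr do rewrite gA.
under [RHS]eq_bigr => k _.
  have [lk _] := C0_bop (pt0 k n); rewrite linB//.
  rewrite eTd gA -/(g k); over.
rewrite sumrB.
rewrite -(big_mkord xpredT (fun i => g (j + i)%N)) -(big_mkord xpredT (fun i => g i)).
rewrite -(big_mkord xpredT (fun i => g (i + n)%N)) -(big_mkord xpredT (fun i => g i) (n := j)).
have e1 : \sum_(0 <= i < n) g (j + i)%N = \sum_(j <= i < j + n) g i.
  rewrite -[X in _ = \sum_(X <= _ < _) _]add0n big_addn [(j + n)%N]addnC addnK.
    by apply: eq_bigr => i _; rewrite addnC.
have e2 : \sum_(0 <= i < j) g (i + n)%N = \sum_(n <= i < n + j) g i.
  by rewrite -[X in _ = \sum_(X <= _ < _) _]add0n big_addn [(n + j)%N]addnC addnK.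
have t1 := @big_cat_nat _ 0 +%R j 0 (j + n) xpredT g (leq0n _) (leq_addr _ _).
have t2 := @big_cat_nat _ 0 +%R n 0 (n + j) xpredT g (leq0n _) (leq_addr _ _).
rewrite e1 e2; apply/eqP; rewrite subr_eq addrAC eq_sym subr_eq.
by rewrite addrC -t2 addnC t1 addrC.
Qed.

End Riemann.

Lemma riemann_cvg (d : R) (x : X) : 0 < d ->
  exists l : X, (fun n => riemann_sum d (2 ^ n) x) @ \oo --> l.
Proof.
move=> d0; have [M M0 HM] := C0_bound d.
apply: cauchy_hnorm => e e0.
have D0 : 0 < 2 * (d * M + 1).
  by rewrite mulr_gt0// ltr_wpDl// mulr_ge0// ltW.
have [|dl dl0 hd] := @C0_small x (e / (2 * (d * M + 1))).
  by rewrite divr_gt0.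
set w := e / _ in hd; have w0 : 0 < w by rewrite divr_gt0.
have [N hN] : exists N : nat, forall n, (N <= n)%N -> d / (2 ^ n)%:R < dl.
  have : (fun n => d * (2^-1) ^+ n) @ \oo --> (0 : R).
    rewrite -(mulr0 d); apply: cvgMr; apply: cvg_expr.
    by rewrite ger0_norm ?invr_ge0// invf_lt1// ltr1n.
  move=> /cvgrPdist_lt/(_ dl dl0)[N _ hN]; exists N => n Nn.
  have := hN n Nn; rewrite /= sub0r normrN natrX -exprVn.
  by apply: le_lt_trans; exact: ler_norm.
have key n m : (N <= n)%N -> (n <= m)%N ->
    hnorm (riemann_sum d (2 ^ m) x - riemann_sum d (2 ^ n) x) <= d * (M * w).
  move=> Nn nm; rewrite -(subnKC nm) expnD.
  apply: riemann_refine => //; rewrite ?expn_gt0//; first exact: ltW.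
  move=> r /andP[r0 rd]; apply/ltW/hd; rewrite r0/=.
  by apply: le_lt_trans rd _; exact: hN.
have we : d * (M * w) < e.
  rewrite mulrA /w mulrA ltr_pdivrMr// mulrC ltr_pM2l//.
  have : 0 <= d * M by rewrite mulr_ge0// ltW.
  lra.
exists N => m n Nm Nn; apply: le_lt_trans we.
case: (leqP n m) => [nm|/ltnW mn]; first exact: key.
by rewrite hnormB; exact: key.
Qed.

(* [F] is the operator x |-> \int_0^d T(t) x dt. *)
Lemma semigroup_integral (d : R) : 0 < d -> exists F : X -> X,
  [/\ bop F,
      forall x, ((h^-1)%:C *: (T h (F x) - F x)) @[h --> 0^'+] --> T d x - x,
      forall (S : X -> X), bop S -> (forall t x, 0 <= t -> S (T t x) = T t (S x)) ->
        forall x, S (F x) = F (S x)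
    & forall x e, (forall r, 0 <= r <= d -> hnorm (T r x - x) <= e) ->
        hnorm ((d^-1)%:C *: F x - x) <= e].
Proof.
move=> d0.
have /choice[F hF] := fun x => riemann_cvg x d0.
have [M M0 HM] := C0_bound d.
have pt0 (k n : nat) : 0 <= d * k%:R / n%:R.
  by rewrite divr_ge0// mulr_ge0// ltW.
have bF : bop F.
  split.
    move=> a x y; apply: (cvg_uniq (hF _)).
    have -> : (fun n => riemann_sum d (2 ^ n) (a *: x + y)) =
       (fun n => a *: riemann_sum d (2 ^ n) x + riemann_sum d (2 ^ n) y).
      by apply/funext => n; rewrite riemann_sum_lin.
    by apply: cvgD => //; apply: cvgZr.
  exists (d * M); first by rewrite mulr_ge0// ltW.
  move=> x; apply: (hnorm_cvg_le (hF x)).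
  by apply: nearW => n; exact: riemann_sum_bound.
exists F; split => //.
- move=> x; apply/right_diffP => e e0.
  set y := T d x - x.
  have [h0 h00 hh] := @C0_small y e e0.
  exists h0 => // h /andP[hp hlt].
  have [M' M'0 HM'] := C0_bound h.
  (* [j n] counts the whole cells contained in [0, h], and [a n] is the last grid point up to h; the
     identity for sums holds at grid points only. *)
  pose j n := Num.truncn (h * (2 ^ n)%:R / d).
  pose a n := d * (j n)%:R / (2 ^ n)%:R.
  have p2 n : 0 < (2 ^ n)%:R :> R by rewrite ltr0n expn_gt0.
  have a0 n : 0 <= a n by exact: pt0.
  have ah n : a n <= h.
    rewrite /a ler_pdivrMr// mulrC -ler_pdivlMr//.
    by rewrite truncn_le divr_ge0 ?mulr_ge0 ?ltW.
  have ah' n : h - d * (2^-1) ^+ n <= a n.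
    set c := d / (2 ^ n)%:R; have c0 : 0 < c by rewrite divr_gt0.
    have -> : h = c * (h * (2 ^ n)%:R / d).
      by rewrite /c; field; rewrite !gt_eqF.
    have -> : d * 2^-1 ^+ n = c by rewrite /c natrX exprVn.
    have -> : a n = c * (j n)%:R by rewrite /a /c mulrAC.
    have := truncnS_gt (h * (2 ^ n)%:R / d); rewrite -/(j n) -natr1 => H.
    have := ltW H; rewrite -(ler_pM2l c0) mulrDr mulr1; lra.
  have an0 : (fun n => d * (2^-1) ^+ n) @ \oo --> (0 : R).
    rewrite -(mulr0 d); apply: cvgMr; apply: cvg_expr.
    by rewrite ger0_norm ?invr_ge0// invf_lt1// ltr1n.
  (* The j(n) shifted copies of y are each within e of y, and their total weight is a(n) <= h; the
     bound e h then survives the limit in n. *)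
  have step n : hnorm (T (a n) (riemann_sum d (2 ^ n) x) -
      riemann_sum d (2 ^ n) x - (a n)%:C *: y) <= e * h.
    rewrite (riemann_shift d0) ?expn_gt0//.
    have -> : (a n)%:C *: y = (d / (2 ^ n)%:R)%:C *: \sum_(k < j n) y.
      rewrite sumr_const card_ord mulrn_scale scalerA -rmorphM.
      by congr (_%:C *: _); rewrite /a mulrAC.
    rewrite -scalerBr -sumrB hnormZr ger0_norm ?divr_ge0 ?(ltW d0)//.
    have hs : hnorm (\sum_(k < j n) (T (d * k%:R / (2 ^ n)%:R) y - y)) <= (j n)%:R * e.
      apply: le_trans (hnorm_sum _ _ _) _.
      apply: (@le_trans _ _ (\sum_(k < j n) e)); last first.
        by rewrite sumr_const card_ord mulr_natl.
      apply: ler_sum => k _; apply/ltW/hh; rewrite pt0/=.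
      apply: le_lt_trans hlt; apply: le_trans (ah n).
      by rewrite ler_pM2r ?invr_gt0// ler_pM2l// ler_nat ltnW.
    have h1 : d / (2 ^ n)%:R * hnorm (\sum_(k < j n) (T (d * k%:R / (2 ^ n)%:R) y - y)) <=
        d / (2 ^ n)%:R * ((j n)%:R * e).
      by rewrite ler_wpM2l// divr_ge0// ltW.
    apply: le_trans h1 _; rewrite mulrA [e * h]mulrC ler_wpM2r ?(ltW e0)//.
    by rewrite mulrAC; exact: ah.
  have c1 : (fun n => T (a n) (riemann_sum d (2 ^ n) x)) @ \oo --> T h (F x).
    apply/cvg_hnormP => e1 e10.
    have [|r r0 hr] := @C0_cont h (F x) (ltW hp) (e1 / 2); first by rewrite divr_gt0.
    have M1 : 0 < M' + 1 by rewrite ltr_wpDl.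
    have /cvg_hnormP/(_ (e1 / (2 * (M' + 1)))) H1 := hF x.
    near=> n.
    have n1 : hnorm (riemann_sum d (2 ^ n) x - F x) < e1 / (2 * (M' + 1)).
      by near: n; apply: H1; rewrite divr_gt0// mulr_gt0.
    have n2 : d * (2^-1) ^+ n < r.
      near: n; move/cvgrPdist_lt : an0 => /(_ r r0); apply: filterS => n.
      by rewrite sub0r normrN; apply: le_lt_trans; exact: ler_norm.
    apply: le_lt_trans (hnorm_tri (T (a n) (F x)) _ _) _.
    have [la _] := C0_bop (a0 n).
    have k1 : hnorm (T (a n) (riemann_sum d (2 ^ n) x) - T (a n) (F x)) <=
        M' * hnorm (riemann_sum d (2 ^ n) x - F x).
      by rewrite -(linB la); apply: HM'; rewrite a0 ah.
    have k2 : hnorm (T (a n) (F x) - T h (F x)) < e1 / 2.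
      apply: hr => //; rewrite distrC ger0_norm ?subr_ge0//.
      by have := ah' n; lra.
    move: n1; rewrite ltr_pdivlMr ?mulr_gt0// => n1.
    have := hnorm_ge0 (riemann_sum d (2 ^ n) x - F x); lra.
  have c2 : (fun n => (a n)%:C *: y) @ \oo --> h%:C *: y.
    apply: (@cvg_hnorm_le _ _ _ _ _ _ _ (fun n => (d * (2^-1) ^+ n) * hnorm y)).
      apply: nearW => n; rewrite -scalerBl -rmorphB/= hnormZr ler_wpM2r//.
      by rewrite distrC ger0_norm ?subr_ge0//; have := ah' n; lra.
    by rewrite -(mul0r (hnorm y)); apply: cvgMl.
  have c3 : (fun n => T (a n) (riemann_sum d (2 ^ n) x) -
      riemann_sum d (2 ^ n) x - (a n)%:C *: y) @ \oo --> T h (F x) - F x - h%:C *: y.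
    by apply: cvgB => //; apply: cvgB.
  by apply: (hnorm_cvg_le c3); exact: nearW.
- move=> S bS ST x; apply: (cvg_uniq (bop_cvg bS (hF x))).
  have -> : (fun n => S (riemann_sum d (2 ^ n) x)) = (fun n => riemann_sum d (2 ^ n) (S x)).
    apply/funext => n; rewrite /riemann_sum; case: bS => lS _.
    by rewrite linZ// lin_sum//; congr (_ *: _); apply: eq_bigr => k _; rewrite ST.
  exact: hF.
- move=> x e he.
  have e0 : 0 <= e.
    have h0 : 0 <= (0:R) <= d by rewrite lexx ltW.
    by apply: le_trans (he 0 h0); exact: hnorm_ge0.
  have c : (fun n => (d^-1)%:C *: riemann_sum d (2 ^ n) x - x) @ \oo -->
      (d^-1)%:C *: F x - x.
    by apply: cvgB; [apply: cvgZr; exact: hF|exact: cvg_cst].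
  apply: (hnorm_cvg_le c); apply: nearW => n.
  have -> : (d^-1)%:C *: riemann_sum d (2 ^ n) x - x =
     (d^-1)%:C *: ((d / (2 ^ n)%:R)%:C *: \sum_(k < 2 ^ n) (T (d * k%:R / (2 ^ n)%:R) x - x)).
    rewrite sumrB scalerBr scalerBr; congr (_ - _).
    rewrite sumr_const card_ord mulrn_scale !scalerA -!rmorphM.
    rewrite (_ : _ * _ * _ = 1) ?rmorph1 ?scale1r//.
    by field; rewrite !gt_eqF// ltr0n expn_gt0.
  rewrite hnormZr ger0_norm ?invr_ge0 ?(ltW d0)// ler_pdivrMl//.
  apply: riemann_avg => // k; apply: he; rewrite pt0/=.
  rewrite ler_pdivrMr ?ltr0n ?expn_gt0// ler_pM2l// ler_nat ltnW//.
Unshelve. all: by end_near. Qed.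

End SemigroupBasics.

(** * The complex exponential of a real time *)

Section ComplexExponential.
Variable R : realType.
Implicit Types z w : R[i].

Definition cexp z : R[i] :=
  (expR (complex.Re z))%:C * Complex (cos (complex.Im z)) (sin (complex.Im z)).

Lemma cexp0 : cexp 0 = 1.
Proof. by rewrite /cexp /= expR0 cos0 sin0 mul1r. Qed.

Lemma cexpD z w : cexp (z + w) = cexp z * cexp w.
Proof.
case: z w => [a b] [c d]; rewrite /cexp /= expRD cosD sinD.
apply/eqP; rewrite eq_complex /=; apply/andP; split; apply/eqP; ring.
Qed.

Lemma cabsM z w : cabs (z * w) = cabs z * cabs w.
Proof.
by apply: complexI; rewrite -!cabsE normrM rmorphM /= !cabsE.
Qed.

Lemma cabsN z : cabs (- z) = cabs z.
Proof. by rewrite /cabs normrN. Qed.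

Lemma cabsD z w : cabs (z + w) <= cabs z + cabs w.
Proof. by rewrite -lecR rmorphD /= -!cabsE ler_normD. Qed.

Lemma cabs_le z : cabs z <= `|complex.Re z| + `|complex.Im z|.
Proof.
case: z => a b; rewrite /cabs normc_def /=.
rewrite -[leRHS]ger0_norm ?addr_ge0// -sqrtr_sqr ler_sqrt ?sqr_ge0//.
rewrite sqrrD !real_normK ?num_real// lerD2r lerDl.
by rewrite mulrn_wge0// mulr_ge0.
Qed.

Lemma cabs_exp z : cabs (cexp z) = expR (complex.Re z).
Proof.
rewrite /cexp cabsM cabsC ger0_norm ?expR_ge0// /cabs normc_def /=.
by rewrite cos2Dsin2 sqrtr1 mulr1.
Qed.

Lemma is_derive_eps (f : R -> R) (x df : R) : is_derive x 1 f df ->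
  forall e : R, 0 < e -> exists2 d : R, 0 < d & forall h, `|h| < d ->
    `|f (x + h) - f x - h * df| <= e * `|h|.
Proof.
case=> dvf <- e e0.
have /cvgrPdist_lt/(_ e e0) := dvf.
rewrite near_withinE => /nbhs_ballP[d /= d0 hd].
exists d => // h hd'; have [->|h0] := eqVneq h 0.
  by rewrite addr0 subrr mul0r subrr normr0 mulr0.
have := hd h; rewrite -ball_normE /ball_/= sub0r normrN => /(_ hd' h0) /ltW.
rewrite distrC -[h^-1 *: _]/(h^-1 * _) -[h *: 1]/(h * 1) mulr1 [h + x]addrC => H.
have -> : f (x + h) - f x - h * 'D_1 f x = h * (h^-1 * (f (x + h) - f x) - 'D_1 f x).
  by rewrite mulrBr mulrA divff// mul1r.
by rewrite normrM mulrC ler_wpM2r.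
Qed.

Lemma cexp_diff z (e : R) : 0 < e -> exists2 d : R, 0 < d &
  forall h : R, `|h| < d -> cabs (cexp (z * h%:C) - 1 - z * h%:C) <= e * `|h|.
Proof.
case: z => a b e0.
pose f (h : R) := expR (h * a) * cos (h * b).
pose g (h : R) := expR (h * a) * sin (h * b).
have df : is_derive (0 : R) 1 f a.
  apply: is_derive_eq.
  by rewrite !mul0r /= expR0 cos0 sin0 /GRing.scale /=; ring.
have dg : is_derive (0 : R) 1 g b.
  apply: is_derive_eq.
  by rewrite !mul0r /= expR0 cos0 sin0 /GRing.scale /=; ring.
have e20 : 0 < e / 2 by rewrite divr_gt0.
have [d1 d10 h1] := is_derive_eps df e20.
have [d2 d20 h2] := is_derive_eps dg e20.
exists (Num.min d1 d2) => [|h]; first by rewrite lt_min d10.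
rewrite lt_min => /andP[hd1 hd2].
apply: le_trans (cabs_le _) _.
have k1 := h1 h hd1; have k2 := h2 h hd2.
rewrite /f /g !add0r !mul0r expR0 cos0 sin0 mulr0 mulr1 subr0 in k1 k2.
have eR : a * h - b * 0 = h * a by ring.
have eI : a * 0 + b * h = h * b by ring.
have -> : cexp (Complex a b * h%:C) - 1 - Complex a b * h%:C =
   Complex (expR (h * a) * cos (h * b) - 1 - h * a) (expR (h * a) * sin (h * b) - h * b).
  rewrite /cexp /= eR eI; apply/eqP; rewrite eq_complex /= mul0r subr0 oppr0 !addr0.
  by apply/andP; split; apply/eqP; ring.
have -> : e * `|h| = e / 2 * `|h| + e / 2 * `|h| by field.
exact: lerD.
Qed.

End ComplexExponential.

(** * Generators, their domains and orbits *)

Section Generator.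
Variables (R : realType) (X : hilbertType R) (T : R -> X -> X)
  (D : set X) (A : X -> X).
Hypothesis gen : generates D A T.

Let C0T : C0_semigroup T := proj1 gen.

Lemma genP x y : (D x /\ A x = y) <->
  ((h^-1)%:C *: (T h x - x)) @[h --> 0^'+] --> y.
Proof. by case: gen => _; apply. Qed.

Lemma gen_eps x : D x -> forall e : R, 0 < e -> exists2 d : R, 0 < d &
     forall h, 0 < h < d -> hnorm (T h x - x - h%:C *: A x) <= e * h.
Proof.
by move=> Dx; have /right_diffP := (genP x (A x)).1 (conj Dx erefl).
Qed.

Lemma gen_comb (a : R[i]) x y : D x -> D y -> D (a *: x + y) /\ A (a *: x + y) = a *: A x + A y.
Proof.
move=> Dx Dy; apply/genP.
have hx := (genP x (A x)).1 (conj Dx erefl).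
have hy := (genP y (A y)).1 (conj Dy erefl).
have c : (a *: ((h^-1)%:C *: (T h x - x)) + (h^-1)%:C *: (T h y - y))
   @[h --> 0^'+] --> a *: A x + A y.
  by apply: cvgD => //; exact: cvgZr.
apply: cvg_trans c; apply: near_eq_cvg.
near=> h; have h0 : 0 <= h by apply: ltW; near: h; exact: nbhs_right_gt.
have [lT _] := C0_bop C0T h0.
by rewrite lT scalerA mulrC -scalerA -scalerDr scalerBr opprD addrACA.
Unshelve. all: by end_near. Qed.

Lemma gen_dom0 : D 0.
Proof.
suff : D 0 /\ A 0 = 0 by case.
apply/genP; apply: (@cvg_hnorm_le _ _ _ _ _ _ _ (fun=> 0)); last exact: cvg_cst.
near=> h; have h0 : 0 <= h by apply: ltW; near: h; exact: nbhs_right_gt.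
have [lT _] := C0_bop C0T h0.
by rewrite lin0// subrr scaler0 subrr hnorm0.
Unshelve. all: by end_near. Qed.

Lemma gen_orbit t x : 0 <= t -> D x -> D (T t x) /\ A (T t x) = T t (A x).
Proof.
move=> t0 Dx; apply/genP.
have hx := (genP x (A x)).1 (conj Dx erefl).
have c : T t ((h^-1)%:C *: (T h x - x)) @[h --> 0^'+] --> T t (A x).
  exact: bop_cvg (C0_bop C0T t0) hx.
apply: cvg_trans c; apply: near_eq_cvg.
near=> h; have h0 : 0 <= h by apply: ltW; near: h; exact: nbhs_right_gt.
have [lT _] := C0_bop C0T t0.
rewrite linZ// linB//; congr (_ *: (_ - _)).
by rewrite -(C0_add C0T)// addrC (C0_add C0T).
Unshelve. all: by end_near. Qed.

(** The generator only provides right increments. For a left increment T(t - k) is factored out, and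
    the continuity of the orbit of A x replaces T(t - k) A x by T(t) A x. *)
Lemma gen_orbit_derivative x : D x -> C1_on (fun t => T t x) (fun t => T t (A x)).
Proof.
move=> Dx; split; last exact: C0_orbit_cont.
apply/derivative_onP => t t0 e e0.
have [M M0 HM] := C0_bound C0T (t + 1).
have M1 : 0 < 2 * (M + 1) by rewrite mulr_gt0// ltr_wpDl.
have e1 : 0 < e / (2 * (M + 1)) by rewrite divr_gt0.
have [d1 d10 h1] := gen_eps Dx e1.
have e2 : 0 < e / 2 by rewrite divr_gt0.
have [d2 d20 h2] := C0_cont C0T (A x) t0 e2.
exists (Num.min 1 (Num.min d1 d2)) => [|h]; first by rewrite !lt_min ltr01 d10.
rewrite !lt_min => /and3P[hh1 hd1 hd2] th.
have M2 k : 0 <= k -> M * (e / (2 * (M + 1)) * k) <= e / 2 * k.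
  move=> k0; rewrite mulrA ler_wpM2r// mulrA ler_pdivrMr//; nra.
have [->|h0] := eqVneq h 0.
  by rewrite addr0 subrr scale0r subrr hnorm0 normr0 mulr0.
case: (ltP 0 h) => [hp|hn].
  have [lT _] := C0_bop C0T t0.
  rewrite (C0_add C0T) ?(ltW hp)// -linB// -linZ// -linB//.
  apply: le_trans (HM _ _ _) _; first by rewrite t0 /= lerDl ler01.
  rewrite gtr0_norm//; apply: le_trans (ler_wpM2l M0 (h1 h _)) _.
    by rewrite hp/= -(gtr0_norm hp).
  apply: le_trans (M2 _ (ltW hp)) _; rewrite ler_wpM2r ?(ltW hp)//.
  by rewrite ler_pdivrMr// ler_peMr// ?ler1n// ltW.
pose k := - h; have k0 : 0 < k by rewrite oppr_gt0 lt_neqAle h0.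
have hk : h = - k by rewrite opprK.
rewrite hk normrN (gtr0_norm k0).
have tk0 : 0 <= t - k by rewrite -hk.
have [lT _] := C0_bop C0T tk0.
have -> : T t x = T (t - k) (T k x) by rewrite -(C0_add C0T) ?subrK// ltW.
have -> : T (t - k) x - T (t - k) (T k x) - (- k)%:C *: T t (A x) =
   - (T (t - k) (T k x - x - k%:C *: A x) + k%:C *: (T (t - k) (A x) - T t (A x))).
  have -> : (- k)%:C = - k%:C by exact: rmorphN.
  by rewrite (linB lT (_ - _)) (linB lT) (linZ lT) scalerBr scaleNr;abel.
rewrite hnormN; apply: le_trans (hnormD _ _) _.
have k1 : hnorm (T (t - k) (T k x - x - k%:C *: A x)) <= e / 2 * k.
  apply: le_trans (HM _ _ _) _; first by rewrite tk0/= lerBlDr -addrA lerDl addr_ge0// ltW.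
  apply: le_trans (ler_wpM2l M0 (h1 k _)) _; last by apply: M2; exact: ltW.
  by rewrite k0/= -(gtr0_norm k0) -normrN -hk.
have k2 : hnorm (k%:C *: (T (t - k) (A x) - T t (A x))) <= e / 2 * k.
  rewrite hnormZr gtr0_norm// mulrC ler_wpM2r ?(ltW k0)//.
  by apply/ltW/h2 => //; rewrite addrAC subrr add0r -hk.
lra.
Qed.

(** The means of the orbit of x over [0, d] lie in the domain and tend to x as d tends to 0. *)
Lemma gen_dense : dense D.
Proof.
apply/denseP => x e e0.
have e2 : 0 < e / 2 by rewrite divr_gt0.
have [d d0 hd] := C0_small C0T x e2.
have d20 : 0 < d / 2 by rewrite divr_gt0.
have [F [bF HF _ HS]] := semigroup_integral C0T d20.
exists (((d / 2)^-1)%:C *: F x).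
  have [DF _] := (genP (F x) _).2 (HF x).
  by have [+ _] := gen_comb ((d / 2)^-1)%:C DF gen_dom0; rewrite addr0.
apply: (@le_lt_trans _ _ (e / 2)).
  apply: HS => r /andP[r0 rd]; apply/ltW/hd; rewrite r0/=.
  by apply: le_lt_trans rd _; rewrite ltr_pdivrMr// ltr_pMr// ltr1n.
by rewrite ltr_pdivrMr// ltr_pMr// ltr1n.
Qed.

End Generator.

(** * Rescaled semigroups and the resolvent set *)

Section ShiftedSemigroup.
Variables (R : realType) (X : hilbertType R) (T : R -> X -> X)
  (D : set X) (A : X -> X) (l : R[i]).
Hypothesis gen : generates D A T.

Let S (t : R) (x : X) : X := cexp (- l * t%:C) *: T t x.

(** Product rule at 0 for an arbitrary curve f, so that it applies both to T with m = -l and, to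
    undo the rescaling, to the rescaled semigroup with m = l. *)
Lemma shift_diff (m : R[i]) (f : R -> X) x y :
  ((h^-1)%:C *: (f h - x)) @[h --> 0^'+] --> y ->
  ((h^-1)%:C *: (cexp (m * h%:C) *: f h - x)) @[h --> 0^'+] --> y + m *: x.
Proof.
move=> /right_diffP H; apply/right_diffP => e e0.
have e3 : 0 < e / 3 by rewrite divr_gt0.
have [d1 d10 h1] := H _ e3.
have [d2 d20 h2] := H 1 ltr01.
have x1 : 0 < hnorm x + 1 by rewrite ltr_wpDl.
have ex : 0 < e / 3 / (hnorm x + 1) by rewrite divr_gt0.
have [d3 d30 h3] := cexp_diff m ex.
have [d4 d40 h4] := cexp_diff m ltr01.
(* The product of the two increments is at most K h^2; the last constraint on h makes K h smaller
   than e / 3. *)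
pose K := (1 + cabs m) * (hnorm y + 1).
have cp : 0 < 1 + cabs m by rewrite ltr_pwDl ?cabs_ge0.
have K1 : 0 < K by rewrite mulr_gt0// ltr_wpDl.
exists (Num.min (Num.min d1 d2) (Num.min d3 (Num.min d4 (e / 3 / K)))).
  by rewrite !lt_min d10 d20 d30 d40 divr_gt0.
move=> h /andP[h0]; rewrite !lt_min => /and3P[/andP[hd1 hd2] hd3 /andP[hd4 hd5]].
have nh : `|h| = h by rewrite gtr0_norm.
have k1 := h1 h; rewrite h0 hd1 in k1; have {}k1 := k1 isT.
have k2 := h2 h; rewrite h0 hd2 in k2; have {}k2 := k2 isT.
have k3 := h3 h; rewrite nh in k3; have {}k3 := k3 hd3.
have k4 := h4 h; rewrite nh in k4; have {}k4 := k4 hd4.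
set c := cexp (m * h%:C) in k3 k4 *.
have -> : c *: f h - x - h%:C *: (y + m *: x) =
   (f h - x - h%:C *: y) + (c - 1) *: (f h - x) + (c - 1 - m * h%:C) *: x.
  by rewrite !scalerBl !scale1r !scalerBr scalerDr scalerA [h%:C * m]mulrC; abel.
apply: le_trans (hnormD _ _) _; apply: (@le_trans _ _ ((e / 3 * h + e / 3 * h) + e / 3 * h)); last first.
  by rewrite -!mulrDl ler_wpM2r ?(ltW h0)//; lra.
apply: lerD; last first.
  rewrite hnormZ; apply: le_trans (ler_wpM2r (hnorm_ge0 _) k3) _.
  rewrite mulrAC ler_wpM2r ?(ltW h0)// mulrAC ler_pdivrMr//.
  by rewrite ler_pM2l// lerDl.
apply: le_trans (hnormD _ _) _; apply: lerD => //.
rewrite hnormZ.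
have c1 : cabs (c - 1) <= (1 + cabs m) * h.
  rewrite -(subrK (m * h%:C) (c - 1)); apply: le_trans (cabsD _ _) _.
  by rewrite mulrDl lerD// cabsM cabsC nh.
have f1 : hnorm (f h - x) <= (hnorm y + 1) * h.
  rewrite -(subrK (h%:C *: y) (f h - x)); apply: le_trans (hnormD _ _) _.
  by rewrite mulrDl addrC lerD// hnormZr nh mulrC.
apply: (@le_trans _ _ ((1 + cabs m) * h * ((hnorm y + 1) * h))).
  by rewrite ler_pM ?cabs_ge0.
rewrite mulrACA mulrA ler_wpM2r ?(ltW h0)//.
by rewrite -/K mulrC -ler_pdivlMr// ltW.
Qed.

Lemma shifted_gen : generates D (fun x => A x - l *: x) S.
Proof.
case: (gen) => C0T _.
have C0S : C0_semigroup S.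
  split.
  - by move=> t t0; apply/bounded_opP/bopZ; exact: C0_bop.
  - by move=> x; rewrite /S mulr0 cexp0 scale1r C0_0.
  - move=> s t x s0 t0; have [lT _] := C0_bop C0T s0.
    by rewrite /S rmorphD mulrDr cexpD (C0_add C0T)// linZ// scalerA.
  - move=> x; apply/right_cvgP => e e0.
    have [M M0 HM] := C0_bound C0T 1.
    have e2 : 0 < e / 2 by rewrite divr_gt0.
    have [d1 d10 h1] := C0_small C0T x e2.
    have [d2 d20 h2] := cexp_diff (- l) (@ltr01 R).
    pose K := (1 + cabs l) * (M * hnorm x + 1).
    have K1 : 0 < K.
      have cp : 0 < 1 + cabs l by rewrite ltr_pwDl ?cabs_ge0.
      by rewrite mulr_gt0// ltr_wpDl ?mulr_ge0.
    exists (Num.min (Num.min 1 d1) (Num.min d2 (e / 2 / K))).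
      by rewrite !lt_min ltr01 d10 d20 divr_gt0.
    move=> h /andP[h0]; rewrite !lt_min => /andP[/andP[hd0 hd1] /andP[hd2 hd3]].
    have nh : `|h| = h by rewrite gtr0_norm.
    have k1 := h1 h; rewrite (ltW h0) hd1 in k1; have {}k1 := k1 isT.
    have k2 := h2 h; rewrite nh in k2; have {}k2 := k2 hd2.
    rewrite /S; set c := cexp _ in k2 *.
    have -> : c *: T h x - x = (T h x - x) + (c - 1) *: T h x.
      by rewrite scalerBl scale1r; abel.
    have c1 : cabs (c - 1) <= (1 + cabs l) * h.
      rewrite -(subrK (- l * h%:C) (c - 1)); apply: le_trans (cabsD _ _) _.
      by rewrite mulrDl lerD// cabsM cabsN cabsC nh.
    apply: le_lt_trans (hnormD _ _) _; rewrite hnormZ.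
    have k3 : cabs (c - 1) * hnorm (T h x) <= (1 + cabs l) * h * (M * hnorm x + 1).
      rewrite ler_pM ?cabs_ge0//; apply: le_trans (HM _ _ _) _; last by rewrite lerDl.
      by rewrite !ltW.
    have k4 : h * K < e / 2 by rewrite -ltr_pdivlMr.
    move: k3; rewrite mulrAC -/K [K * h]mulrC => k3; lra.
split => // x y; split.
  move=> [Dx <-]; rewrite -scaleNr; apply: shift_diff.
  exact: (genP gen x (A x)).1 (conj Dx erefl).
move=> H; have := @shift_diff l _ _ _ H.
have -> : (fun h => (h^-1)%:C *: (cexp (l * h%:C) *: S h x - x)) =
    (fun h => (h^-1)%:C *: (T h x - x)).
  apply/funext => h; rewrite /S scalerA -cexpD mulNr subrr cexp0 scale1r//.
by move=> /(genP gen) [Dx ->]; rewrite addrK.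
Qed.

(** A finite integral replaces the Laplace transform: -(A - l) int_0^1 S = I - S(1), and S(1) is a
    strict contraction when Re l > w, so the integral times (I - S(1))^-1 is the resolvent. *)
Lemma shifted_resolvent (w : R) :
  (forall x, hnorm (T 1 x) <= expR w * hnorm x) -> w < complex.Re l ->
  resolvent_set D A l.
Proof.
move=> Tw wl.
have gS := shifted_gen; have C0S := proj1 gS.
have [F [bF HF comm _]] := semigroup_integral C0S ltr01.
pose q := expR (w - complex.Re l).
have q01 : 0 <= q < 1 by rewrite expR_ge0/= expR_lt1// subr_lt0.
have bS1 := C0_bop C0S ler01.
have Sq x : hnorm (S 1 x) <= q * hnorm x.
  rewrite /S hnormZ cabs_exp /q expRD mulrC.
  have -> : complex.Re (- l * 1%:C) = - complex.Re l.
    by case: l => a b /=; rewrite mulr1 mulr0 subr0.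
  rewrite [_ * hnorm x]mulrAC; apply: ler_wpM2r; first exact: expR_ge0.
  exact: Tw.
have [lS1 _] := bS1.
have [||||P [/bounded_opP bP P1 P2]] := @bounded_inverse_surj _ _ _ (fun x => x - S 1 x) (1 - q).
- by move=> a x y; rewrite lS1 scalerBr opprD addrACA.
- by rewrite subr_gt0; case/andP: q01.
- move=> x; rewrite mulrBl mul1r lerBlDr.
  have := hnormD (x - S 1 x) (S 1 x); rewrite subrK => h.
  by apply: le_trans h _; rewrite lerD2l.
- by move=> y; apply: neumann q01 Sq y.
have commP t x : 0 <= t -> P (S t x) = S t (P x).
  move=> t0; have [lSt _] := C0_bop C0S t0.
  rewrite -[in LHS](P2 x) linB//.
  have -> : S t (S 1 (P x)) = S 1 (S t (P x)).
    by rewrite -!(C0_add C0S)// addrC.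
  by rewrite P1.
pose Q x := F (P x).
have bQ : bop Q by exact: bop_comp.
have DQ x : D (Q x) /\ A (Q x) - l *: Q x = - x.
  apply/(genP gS); have := HF (P x).
  by have -> : S 1 (P x) - P x = - x by rewrite -opprB P2.
have commQ t x : 0 <= t -> Q (S t x) = S t (Q x).
  move=> t0; rewrite /Q commP//.
  rewrite (comm (S t)) //; first exact: C0_bop.
  by move=> r z r0; rewrite -!(C0_add C0S)// addrC.
exists Q; split; first exact/bounded_opP.
  move=> x; have [Dx e] := DQ x; split => //.
  by rewrite -opprB e opprK.
move=> x Dx.
(* Q commutes with S, hence with its difference quotients; computing their limit in two ways shows
   that Q is also a left inverse. *)
have h1 : Q ((h^-1)%:C *: (S h x - x)) @[h --> 0^'+] --> Q (A x - l *: x).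
  apply: (bop_cvg bQ); exact: (genP gS x _).1 (conj Dx erefl).
have h2 : ((h^-1)%:C *: (S h (Q x) - Q x)) @[h --> 0^'+] --> - x.
  exact/(genP gS).
have e : Q (A x - l *: x) = - x.
  apply: (cvg_uniq h1); apply: cvg_trans h2; apply: near_eq_cvg.
  near=> h; have h0 : 0 <= h by apply: ltW; near: h; exact: nbhs_right_gt.
  have [lQ _] := bQ.
  by rewrite (linZ lQ) (linB lQ) commQ.
by rewrite -opprB linN ?e ?opprK//; case: bQ.
Unshelve. all: by end_near. Qed.

End ShiftedSemigroup.

(** * The energy inequality *)

Section Energy.
Variables (R : realType) (X : hilbertType R).
Local Notation mu := (@lebesgue_measure R).

Lemma ler_cvg (T : Type) (F : set_system T) {FF : ProperFilter F} (f g : T -> R) a b :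
  f @ F --> a -> g @ F --> b -> (\forall t \near F, f t <= g t) -> a <= b.
Proof.
move=> fa gb fg; rewrite -subr_ge0.
have c : (fun t => g t - f t) @ F --> b - a by exact: cvgB.
by apply: (cvgr_to_ge c); apply: filterS fg => t; rewrite subr_ge0.
Qed.

(** Polarization reduces the convergence to that of norms. *)
Lemma rdot_cvg (T : Type) (F : set_system T) {FF : Filter F} (f g : T -> X) a b :
  f @ F --> a -> g @ F --> b ->
  (fun t => rdot (f t) (g t)) @ F --> rdot a b.
Proof.
move=> fa gb.
have polar (x y : X) : rdot x y = 2^-1 * (hnorm (x + y) ^+ 2 - hnorm x ^+ 2 - hnorm y ^+ 2).
  by rewrite hnormDsq; field.
under eq_fun do rewrite polar; rewrite polar.
have c2 (u : T -> X) l : u @ F --> l -> (fun t => hnorm (u t) ^+ 2) @ F --> hnorm l ^+ 2.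
  by move=> /cvg_hnorm_cst ul; rewrite expr2; under eq_fun do rewrite expr2; exact: cvgM.
apply: cvgMr; apply: cvgB; last exact: c2.
by apply: cvgB; [apply: c2; exact: cvgD|exact: c2].
Qed.

Lemma within_rdot (f g : R -> X) : {within `[0, +oo[, continuous f} ->
  {within `[0, +oo[, continuous g} ->
  {within `[0, +oo[, continuous (fun t => rdot (f t) (g t))}.
Proof.
move=> /subspace_continuousP cf /subspace_continuousP cg.
by apply/subspace_continuousP => t t0; apply: rdot_cvg; [exact: cf|exact: cg].
Qed.

Lemma derivative_on_cont (V : normedModType R[i]) (f g : R -> V) :
  derivative_on f g -> {within `[0, +oo[, continuous f}.
Proof.
move=> /derivative_onP H; apply/within_contP => t t0 e e0.
have [d d0 hd] := H t t0 1 ltr01.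
have k0 : 0 < hnorm (g t) + 1 by rewrite ltr_wpDl.
exists (Num.min d (e / (hnorm (g t) + 1))).
  by rewrite lt_min d0 divr_gt0.
move=> s s0; rewrite lt_min => /andP[sd]; rewrite ltr_pdivlMr// => se.
have := hd (s - t) sd; rewrite subrKC => /(_ s0); rewrite mul1r => h1.
apply: le_lt_trans se; rewrite mulrC mulrDl mul1r.
rewrite -(subrK ((s - t)%:C *: g t) (f s - f t)).
by apply: le_trans (hnormD _ _) _; rewrite addrC lerD// hnormZr mulrC.
Qed.

Lemma itv0yE (t : R) : [set` `[(0:R), +oo[] t = (0 <= t) :> Prop.
Proof. by rewrite /= in_itv/= andbT. Qed.

Lemma within_at (V : topologicalType) (f : R -> V) (t : R) :
  {within `[0, +oo[, continuous f} -> 0 < t -> f @ t --> f t.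
Proof.
move=> /subspace_continuousP H t0.
have c : f @ within [set` `[0, +oo[] (nbhs t) --> f t.
  by apply: H; rewrite itv0yE ltW.
apply: cvg_trans c; apply: cvg_app => A; rewrite !nbhs_simpl /within /= => HA.
apply: filterS2 HA (lt_nbhsr t0) => s + s0; apply.
by rewrite /= in_itv/= andbT ltW.
Qed.

Lemma within_at_right (V : topologicalType) (f : R -> V) :
  {within `[0, +oo[, continuous f} -> f @ 0^'+ --> f 0.
Proof.
move=> /subspace_continuousP H.
have c : f @ within [set` `[0, +oo[] (nbhs (0 : R)) --> f 0.
  by apply: H; rewrite itv0yE.
apply: cvg_trans c; apply: cvg_app => A; rewrite !nbhs_simpl /within /= => HA.
apply: filterS HA => s + s0; apply.
by rewrite /= in_itv/= andbT ltW.
Qed.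

Lemma within_sub (V : topologicalType) (f : R -> V) (a b : R) : 0 <= a ->
  {within `[0, +oo[, continuous f} -> {within `[a, b], continuous f}.
Proof.
move=> a0; apply: continuous_subspaceW => t /=.
by rewrite !in_itv/= andbT => /andP[/(le_trans a0)].
Qed.

Lemma within_integrable (f : R -> R) (t : R) : {within `[0, +oo[, continuous f} ->
  mu.-integrable `[0, t] (EFin \o f).
Proof.
move=> cf; apply: continuous_compact_integrable; first exact: segment_compact.
exact: within_sub.
Qed.

Lemma hnormsq_derive (z dz : R -> X) (t : R) : derivative_on z dz -> 0 < t ->
  is_derive t 1 (fun s => hnorm (z s) ^+ 2) (2 * rdot (dz t) (z t)).
Proof.
move=> H t0.
have cz := within_at (derivative_on_cont H) t0.
have c1 : ((h^-1)%:C *: (z (t + h) - z t)) @[h --> 0^'] --> dz t.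
  have := H t (ltW t0); apply: cvg_trans; apply: cvg_app => A.
  rewrite !nbhs_simpl /within /= => HA; have H1 := @dnbhs0_lt _ R _ t0.
  apply: (filterS2 (F := (0 : R)^')) HA H1 => h + ht; apply.
  by move: ht; rewrite ltr_norml => /andP[h1 _]; rewrite /= addrC -lerBlDr sub0r ltW.
have c2 : z (t + h) @[h --> 0^'] --> z t.
  have c2' : z (t + h) @[h --> (0:R)] --> z t.
    have : (fun h : R => t + h) @ (0 : R) --> t + 0.
      by apply: cvgD; [exact: cvg_cst|exact: cvg_id].
    by rewrite addr0 => /cvg_comp; apply.
  apply: cvg_trans c2'; apply: cvg_app; exact: cvg_within.
have c3 : rdot ((h^-1)%:C *: (z (t + h) - z t)) (z (t + h) + z t) @[h --> 0^'] -->
   rdot (dz t) (z t + z t).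
  by apply: rdot_cvg => //; apply: cvgD => //; exact: cvg_cst.
(* By symmetry of the real inner product, |p|^2 - |q|^2 = Re <p - q, p + q>. *)
have e1 : (fun h => h^-1 *: (((fun s => hnorm (z s) ^+ 2) \o shift t) (h *: 1) -
    hnorm (z t) ^+ 2)) = (fun h => rdot ((h^-1)%:C *: (z (t + h) - z t)) (z (t + h) + z t)).
  apply/funext => h /=; rewrite -[h *: 1]/(h * 1) mulr1 [h + t]addrC rdotZl.
  rewrite -[_ *: _]/(_ * _); congr (_ * _).
  by rewrite rdotBl !rdotDr !rdot_hnorm [rdot (z t) _]rdotC; ring.
have c4 : h^-1 *: (((fun s => hnorm (z s) ^+ 2) \o shift t) (h *: 1) -
    hnorm (z t) ^+ 2) @[h --> 0^'] --> 2 * rdot (dz t) (z t).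
  by rewrite e1 (_ : 2 * _ = rdot (dz t) (z t + z t))// rdotDr; ring.
apply: DeriveDef; first by apply/cvg_ex; exists (2 * rdot (dz t) (z t)).
exact: (cvg_lim (@Rhausdorff R) c4).
Qed.

Lemma energy_inequality (z dz : R -> X) (p q : R -> R) (t : R) : 0 < t ->
  C1_on z dz ->
  {within `[0, +oo[, continuous p} -> {within `[0, +oo[, continuous q} ->
  (forall s, 0 <= s -> 0 <= p s) -> (forall s, 0 <= s -> 0 <= q s) ->
  (forall s, 0 <= s -> 2 * rdot (dz s) (z s) + p s <= q s) ->
  ((hnorm (z t) ^+ 2)%:E + \int[mu]_(s in `[0%R, t]) (p s)%:E <=
   (hnorm (z 0%R) ^+ 2)%:E + \int[mu]_(s in `[0%R, t]) (q s)%:E)%E.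
Proof.
move=> t0 [dz1 cdz] cp cq p0 q0 pq.
have cz := derivative_on_cont dz1.
pose phi s := hnorm (z s) ^+ 2.
pose psi s := 2 * rdot (dz s) (z s).
have cphi : {within `[0, +oo[, continuous phi}.
  have -> : phi = (fun s => rdot (z s) (z s)).
    by apply/funext => s; rewrite rdot_hnorm.
  exact: within_rdot.
have cpsi : {within `[0, +oo[, continuous psi}.
  have /subspace_continuousP c := within_rdot cdz cz.
  by apply/subspace_continuousP => s s0; apply: cvgMr; exact: c.
(* The fundamental theorem asks for differentiability inside the interval only; at 0 and t one-sided
   continuity suffices. *)
have ftc : (\int[mu]_(s in `[0%R, t]) (psi s)%:E = (phi t)%:E - (phi 0%R)%:E)%E.
  apply: continuous_FTC2 => //.
  - exact: within_sub.
  - split.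
    + move=> s; rewrite in_itv/= => /andP[s0 _].
      by case: (hnormsq_derive dz1 s0).
    + exact: within_at_right.
    + apply: cvg_at_left_filter; exact: within_at.
  - move=> s; rewrite in_itv/= => /andP[s0 _].
    by rewrite derive1E; case: (hnormsq_derive dz1 s0).
have ip := within_integrable t cp; have iq := within_integrable t cq.
have ipsi := within_integrable t cpsi.
have le1 : (\int[mu]_(s in `[0%R, t]) (psi s + p s)%:E <= \int[mu]_(s in `[0%R, t]) (q s)%:E)%E.
  apply: le_integral => //.
  - have -> : (fun s => (psi s + p s)%:E) = (EFin \o psi) \+ (EFin \o p) by [].
    exact: integrableD.
  - move=> s; rewrite inE /= in_itv/= => /andP[s0 _]; rewrite lee_fin; exact: pq.
move: le1.
have -> : (\int[mu]_(s in `[0%R, t]) (psi s + p s)%:E =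
   \int[mu]_(s in `[0%R, t]) (psi s)%:E + \int[mu]_(s in `[0%R, t]) (p s)%:E)%E.
  by rewrite -(integralD _ ipsi ip).
rewrite ftc addeAC leeBlDr//.
by rewrite [X in (_ <= X)%E]addeC.
Qed.

End Energy.

(** The energy inequality with p = q = 0 applies to orbits starting in the domain; density and
    boundedness of T(t) give the rest. *)
Lemma dissipative_contraction (R : realType) (X : hilbertType R) (T : R -> X -> X)
  (D : set X) (A : X -> X) : generates D A T ->
  (forall x, D x -> rdot (A x) x <= 0) ->
  forall t x, 0 <= t -> hnorm (T t x) <= hnorm x.
Proof.
move=> gen diss t x; rewrite le_eqVlt => /predU1P[<-|t0].
  by rewrite (C0_0 (proj1 gen)).
suff H y : D y -> hnorm (T t y) <= hnorm y.
  have [u [Du ux]] := dense_seq (gen_dense gen) x.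
  have bT := C0_bop (proj1 gen) (ltW t0).
  apply: (ler_cvg (cvg_hnorm_cst (bop_cvg bT ux)) (cvg_hnorm_cst ux)).
  by apply: nearW => n; exact: H.
move=> Dy.
have c0 : {within `[(0:R), +oo[, continuous (fun=> 0 : R)}.
  by apply: continuous_subspaceT => s; exact: cvg_cst.
have := @energy_inequality R X (fun s => T s y) (fun s => T s (A y))
  (fun=> 0) (fun=> 0) t t0 (gen_orbit_derivative gen Dy) c0 c0.
rewrite integral0 !adde0 lee_fin (C0_0 (proj1 gen)) => H.
rewrite -(@ler_pXn2r _ 2)// ?nnegrE//; apply: H => // s s0.
rewrite addr0 pmulr_rle0//.
have [Ds <-] := gen_orbit gen s0 Dy; exact: diss.
Qed.

(** * The Lumer-Phillips theorem *)

Section LumerPhillips.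
Variables (R : realType) (X : hilbertType R) (D : set X) (A : X -> X).
Hypothesis Alin : forall (a : R[i]) x y, D x -> D y ->
  D (a *: x + y) /\ A (a *: x + y) = a *: A x + A y.
Hypothesis Ddense : dense D.
Hypothesis diss : forall x, D x -> rdot (A x) x <= 0.
Hypothesis range : forall h : R, 0 < h -> forall y, exists x, D x /\ x - h%:C *: A x = y.

Lemma dissipative_expand (h : R) x : 0 <= h -> D x -> hnorm x <= hnorm (x - h%:C *: A x).
Proof.
move=> h0 Dx; have [->|x0] := eqVneq x 0; first by rewrite hnorm0.
have nx : 0 < hnorm x.
  by rewrite lt_def hnorm_ge0 andbT; apply: contra_neq x0; exact: hnorm_eq0.
rewrite -(ler_pM2r nx); apply: le_trans (cauchy_schwarz _ _).
rewrite rdotBl rdot_hnorm rdotZl -expr2 lerBrDl gerDr.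
exact: mulr_ge0_le0 h0 (diss Dx).
Qed.

Lemma D_B x y : D x -> D y -> D (x - y) /\ A (x - y) = A x - A y.
Proof.
by move=> Dx Dy; have := Alin (-1) Dy Dx; rewrite !scaleN1r ![- _ + _]addrC.
Qed.

Lemma D_Z (a : R[i]) x : D x -> D (a *: x) /\ A (a *: x) = a *: A x.
Proof.
move=> Dx; have [D0 A0] := D_B Dx Dx; rewrite !subrr in D0 A0.
by have := Alin a Dx D0; rewrite A0 !addr0.
Qed.

(** J(h) is the implicit Euler step (I - hA)^-1. Step 0 is set to the identity, so that the
    estimates below cover h = 0. *)
Lemma euler_step_ex : exists J : R -> X -> X,
  (forall x, J 0 x = x) /\
  (forall h x, 0 < h -> D (J h x) /\ J h x - h%:C *: A (J h x) = x).
Proof.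
have /choice[J HJ] : forall hx : R * X, exists y, (hx.1 = 0 -> y = hx.2) /\
    (0 < hx.1 -> D y /\ y - hx.1%:C *: A y = hx.2).
  move=> [h x] /=; case: (ltP 0 h) => h0.
    have [y Hy] := range h0 x; exists y; split => // h00.
    by move: h0; rewrite h00 ltxx.
  by exists x.
exists (fun h x => J (h, x)); split => [x|h x h0].
  by have [/= + _] := HJ (0, x); apply.
by have [_ /=] := HJ (h, x); apply.
Qed.

Variable J : R -> X -> X.
Hypothesis J0 : forall x, J 0 x = x.
Hypothesis JP : forall h x, 0 < h -> D (J h x) /\ J h x - h%:C *: A (J h x) = x.

Lemma J_uniq h x y : 0 < h -> D y -> y - h%:C *: A y = x -> J h x = y.
Proof.
move=> h0 Dy e; have [DJ eJ] := JP x h0.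
have [DB AB] := D_B DJ Dy.
apply/subr0_eq/hnorm_eq0/le_anti; rewrite hnorm_ge0 andbT.
apply: le_trans (dissipative_expand (ltW h0) DB) _.
have -> : J h x - y - h%:C *: A (J h x - y) = 0; last by rewrite hnorm0.
rewrite AB scalerBr.
transitivity ((J h x - h%:C *: A (J h x)) - (y - h%:C *: A y)); first abel.
by rewrite eJ e subrr.
Qed.

Lemma J_lin h : 0 <= h -> linear (J h).
Proof.
rewrite le_eqVlt => /predU1P[<- a x y|h0 a x y]; first by rewrite !J0.
have [Dx ex] := JP x h0; have [Dy ey] := JP y h0.
have [Dxy exy] := Alin a Dx Dy.
apply: J_uniq => //; rewrite exy -[in RHS]ex -[in RHS]ey.
rewrite scalerDr !scalerBr !scalerA [h%:C * a]mulrC; abel.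
Qed.

Lemma J_contr h x : 0 <= h -> hnorm (J h x) <= hnorm x.
Proof.
rewrite le_eqVlt => /predU1P[<-|h0]; first by rewrite J0.
have [Dx ex] := JP x h0; rewrite -[in leRHS]ex.
exact: dissipative_expand (ltW h0) Dx.
Qed.

Lemma J_D h x : 0 <= h -> D x -> D (J h x) /\ A (J h x) = J h (A x).
Proof.
rewrite le_eqVlt => /predU1P[<-|h0]; first by rewrite !J0.
move=> Dx; have [Dw ew] := JP x h0; split => //.
have hz : h%:C != 0 by rewrite gt_eqF// ltcR.
have eA : A (J h x) = (h^-1)%:C *: (J h x - x).
  have -> : J h x - x = h%:C *: A (J h x).
    by rewrite -[X in _ - X = _]ew; abel.
  by rewrite scalerA -rmorphM mulVf ?gt_eqF// scale1r.
have [DB AB] := D_B Dw Dx.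
have [DA AA] := D_Z (h^-1)%:C DB.
symmetry; apply: J_uniq => //; first by rewrite eA.
rewrite {2}eA AA AB scalerA -rmorphM mulfV ?gt_eqF// scale1r; abel.
Qed.

(** The domain of A^2, on which one Euler step has a local error of second order. *)
Definition D2 x := D x /\ D (A x).

Lemma J_D2 h x : 0 <= h -> D2 x -> D2 (J h x) /\ A (A (J h x)) = J h (A (A x)).
Proof.
move=> h0 [Dx DAx]; have [DJ AJ] := J_D h0 Dx.
by have [DJ' AJ'] := J_D h0 DAx; split; [split; rewrite ?AJ|rewrite AJ].
Qed.

Lemma J_comm a b x : 0 <= a -> 0 <= b -> J a (J b x) = J b (J a x).
Proof.
rewrite le_eqVlt => /predU1P[<- _|a0]; first by rewrite !J0.
move=> b0; have [Da ea] := JP x a0; have [DJ AJ] := J_D b0 Da.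
apply: J_uniq => //; rewrite AJ.
have lJ := J_lin b0.
by rewrite -(linZ lJ) -(linB lJ) ea.
Qed.

(** (I - aA)(I - bA) exceeds I - (a+b)A by ab A^2; the resolvents are contractions and commute with
    A, so the error is controlled by A^2 x. *)
Lemma J_add a b x : 0 <= a -> 0 <= b -> D2 x ->
  hnorm (J (a + b) x - J a (J b x)) <= a * b * hnorm (A (A x)).
Proof.
rewrite le_eqVlt => /predU1P[<- _ _|a0].
  by rewrite add0r J0 subrr hnorm0 !mul0r.
rewrite le_eqVlt => /predU1P[<- _|b0 Dx].
  by rewrite addr0 J0 subrr hnorm0 mulr0 mul0r.
have ab0 : 0 < a + b by rewrite addr_gt0.
have [Db _] := JP x b0.
have [Dbx ebx] := J_D2 (ltW b0) Dx.
have [[Dw DAw] ew] := J_D2 (ltW a0) Dbx.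
set w := J a (J b x) in Dw DAw ew *.
have [_ e1] := JP (J b x) a0; rewrite -/w in e1.
have [_ e2] := JP x b0.
have [DZ AZ] := D_Z a%:C DAw.
have [DB AB] := D_B Dw DZ.
have e3 : w - (a + b)%:C *: A w = x - (a * b)%:C *: A (A w).
  rewrite -[in RHS]e2 -e1 AB AZ rmorphD scalerDl scalerBr scalerA -rmorphM mulrC.
  abel.
have -> : w = J (a + b) (x - (a * b)%:C *: A (A w)) by rewrite (J_uniq ab0 Dw e3).
have lJ := J_lin (ltW ab0).
rewrite (linB lJ) subKr (linZ lJ) hnormZr gtr0_norm ?mulr_gt0//.
rewrite ler_pM2l ?mulr_gt0// ew ebx.
apply: le_trans (J_contr _ (ltW ab0)) _; apply: le_trans (J_contr _ (ltW a0)) _.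
exact: J_contr (ltW b0).
Qed.

Lemma iter_J_contr h n x y : 0 <= h -> hnorm (iter n (J h) x - iter n (J h) y) <= hnorm (x - y).
Proof.
move=> h0; elim: n => //= n IH; rewrite -(linB (J_lin h0)).
exact: le_trans (J_contr _ h0) IH.
Qed.

(** The n local errors of [J_add] add up without growth: the steps are commuting contractions that
    do not increase |A^2 x|. *)
Lemma iter_split a b n x : 0 <= a -> 0 <= b -> D2 x ->
  hnorm (iter n (J (a + b)) x - iter n (J a) (iter n (J b) x)) <=
    n%:R * (a * b * hnorm (A (A x))).
Proof.
move=> a0 b0 Dx.
have ab0 : 0 <= a + b by rewrite addr_ge0.
pose W n := iter n (fun x => J a (J b x)) x.
have Jbn k y : J b (iter k (J a) y) = iter k (J a) (J b y).
  by elim: k => //= k IH; rewrite J_comm// IH.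
have WE k : iter k (J a) (iter k (J b) x) = W k.
  by rewrite /W; elim: k => //= k <-; rewrite Jbn.
have WD k : D2 (W k) /\ hnorm (A (A (W k))) <= hnorm (A (A x)).
  elim: k => [//|k [IH1 IH2]].
  have [Db eb] := J_D2 b0 IH1; have [Da ea] := J_D2 a0 Db; split => //=.
  rewrite ea eb; apply: le_trans (J_contr _ a0) _.
  exact: le_trans (J_contr _ b0) IH2.
rewrite WE; elim: n => [|n IH]; first by rewrite subrr hnorm0 mul0r.
apply: le_trans (hnorm_tri (J (a + b) (W n)) _ _) _.
rewrite -natr1 mulrDl mul1r; apply: lerD.
  by rewrite /= -(linB (J_lin ab0)); apply: le_trans (J_contr _ ab0) _.
have [D2n le2] := WD n; apply: le_trans (J_add a0 b0 D2n) _.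
by rewrite ler_wpM2l// mulr_ge0.
Qed.

(** Step numbers are powers of 2, so each mesh halves the previous one and [iter_split] with a = b
    compares consecutive schemes. *)
Definition euler (n : nat) (t : R) (x : X) := iter (2 ^ n) (J (t / (2 ^ n)%:R)) x.

Let pow0 (n : nat) : 0 < (2 ^ n)%:R :> R.
Proof. by rewrite ltr0n expn_gt0. Qed.

Let tn0 (n : nat) (t : R) : 0 <= t -> 0 <= t / (2 ^ n)%:R.
Proof. by move=> t0; rewrite divr_ge0// ltW. Qed.

(** 2^n local errors (t / 2^(n+1))^2 |A^2 x| add up to t^2/4 2^-n |A^2 x|, written as a difference
    in order to telescope. *)
Lemma euler_step n t x : 0 <= t -> D2 x ->
  hnorm (euler n.+1 t x - euler n t x) <=
    t ^+ 2 * hnorm (A (A x)) / 2 * ((2 ^ n)%:R^-1 - (2 ^ n.+1)%:R^-1).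
Proof.
move=> t0 Dx; pose a := t / (2 ^ n.+1)%:R.
have e1 : euler n t x = iter (2 ^ n) (J (a + a)) x.
  rewrite /euler /a; congr (iter _ (J _) _).
  by rewrite expnS natrM; field; rewrite gt_eqF.
have e2 : euler n.+1 t x = iter (2 ^ n) (J a) (iter (2 ^ n) (J a) x).
  by rewrite /euler -/a expnS mul2n -addnn iterD.
rewrite e1 e2 hnormB; apply: le_trans (iter_split _ (tn0 _ t0) (tn0 _ t0) Dx) _.
rewrite le_eqVlt; apply/orP; left; apply/eqP.
by rewrite expnS natrM; field; rewrite gt_eqF.
Qed.

Lemma euler_cauchy n m t x : 0 <= t -> D2 x -> (n <= m)%N ->
  hnorm (euler m t x - euler n t x) <= t ^+ 2 * hnorm (A (A x)) / 2 * (2 ^ n)%:R^-1.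
Proof.
move=> t0 Dx nm; set c := _ / 2.
have c0 : 0 <= c by rewrite divr_ge0// mulr_ge0// exprn_ge0.
have H k : hnorm (euler (n + k) t x - euler n t x) <= c * ((2 ^ n)%:R^-1 - (2 ^ (n + k))%:R^-1).
  elim: k => [|k IH]; first by rewrite addn0 !subrr mulr0 hnorm0.
  rewrite addnS; apply: le_trans (hnorm_tri (euler (n + k) t x) _ _) _.
  have := euler_step (n + k) t0 Dx; rewrite -/c; lra.
have := H (m - n)%N; rewrite subnKC// => h; apply: le_trans h _.
by rewrite ler_wpM2l// gerBl invr_ge0 ltW.
Qed.

(** For y in D, J(h) y lies in the domain of A^2 and differs from y by h J(h) A y, of norm at most h
    |A y|. *)
Lemma D2_dense x (e : R) : 0 < e -> exists2 y, D2 y & hnorm (y - x) < e.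
Proof.
move=> e0; have [y Dy xy] := (denseP D).1 Ddense x (e / 2) (divr_gt0 e0 (ltr0Sn _ _)).
pose h := e / 2 / (hnorm (A y) + 1).
have k0 : 0 < hnorm (A y) + 1 by rewrite ltr_wpDl.
have h0 : 0 < h by rewrite !divr_gt0.
have [DJ AJ] := J_D (ltW h0) Dy; exists (J h y).
  split => //; rewrite AJ; exact: (JP _ h0).1.
apply: le_lt_trans (hnorm_tri y _ _) _.
have -> : J h y - y = h%:C *: A (J h y).
  by have [_ e1] := JP y h0; rewrite -[X in _ - X = _]e1; abel.
rewrite hnormZr gtr0_norm// AJ.
have : h * hnorm (J h (A y)) <= e / 2.
  apply: (@le_trans _ _ (h * (hnorm (A y) + 1))); last by rewrite divfK ?gt_eqF.
  rewrite ler_wpM2l ?(ltW h0)// (le_trans (J_contr _ (ltW h0)))// lerDl.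
    exact: ler01.
move: xy; lra.
Qed.

Lemma euler_contr n t x y : 0 <= t -> hnorm (euler n t x - euler n t y) <= hnorm (x - y).
Proof. by move=> t0; apply: iter_J_contr; exact: tn0. Qed.

Lemma euler_lin n t : 0 <= t -> linear (euler n t).
Proof.
move=> t0 a x y; rewrite /euler; have := tn0 n t0; move: (_ / _) => h h0.
by elim: (2 ^ n)%N => //= k ->; rewrite (J_lin h0).
Qed.

Lemma euler_cvg t x : 0 <= t -> exists l : X, (fun n => euler n t x) @ \oo --> l.
Proof.
move=> t0; apply: cauchy_hnorm => e e0.
have [y Dy yx] := D2_dense x (divr_gt0 e0 (ltr0Sn R 3)).
set c := t ^+ 2 * hnorm (A (A y)) / 2.
have c0 : 0 <= c by rewrite divr_ge0// mulr_ge0// exprn_ge0.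
have : (fun n => c * (2^-1) ^+ n) @ \oo --> (0 : R).
  rewrite -(mulr0 c); apply: cvgMr; apply: cvg_expr.
  by rewrite ger0_norm ?invr_ge0// invf_lt1// ltr1n.
move=> /cvgrPdist_lt/(_ (e / 4) (divr_gt0 e0 (ltr0Sn _ _)))[N _ hN].
have key n m : (N <= n)%N -> (n <= m)%N -> hnorm (euler m t x - euler n t x) < e.
  move=> Nn nm; have := hN n Nn.
  rewrite /= sub0r normrN ger0_norm ?mulr_ge0 ?exprn_ge0 ?invr_ge0//.
  rewrite exprVn -natrX => k1.
  have k2 := euler_cauchy t0 Dy nm; rewrite -/c in k2.
  have k3 := euler_contr m x y t0; have k4 := euler_contr n x y t0.
  have k5 := hnorm_tri (euler m t y) (euler m t x) (euler n t x).
  have k6 := hnorm_tri (euler n t y) (euler m t y) (euler n t x).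
  rewrite hnormB in yx; rewrite [hnorm (euler n t x - _)]hnormB in k4.
  lra.
exists N => m n Nm Nn; case: (leqP n m) => [nm|/ltnW mn]; first exact: key.
by rewrite hnormB; exact: key.
Qed.

Lemma euler_semigroup : exists T : R -> X -> X, C0_semigroup T /\
  (forall t x, 0 <= t -> hnorm (T t x) <= hnorm x) /\
  (forall x, D2 x -> ((h^-1)%:C *: (T h x - x)) @[h --> 0^'+] --> A x).
Proof.
have /choice[T0 HT0] : forall tx : R * X, exists l : X, 0 <= tx.1 ->
    (fun n => euler n tx.1 tx.2) @ \oo --> l.
  move=> [t x] /=; case: (leP 0 t) => t0; last by exists 0.
  by have [l hl] := euler_cvg x t0; exists l.
pose T t x := T0 (t, x).
have HT t x : 0 <= t -> (fun n => euler n t x) @ \oo --> T t x by exact: (HT0 (t, x)).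
have euler_le n t x : 0 <= t -> hnorm (euler n t x) <= hnorm x.
  move=> t0; have := euler_contr n x 0 t0.
  by rewrite (lin0 (euler_lin n t0)) !subr0.
have Tc t x : 0 <= t -> hnorm (T t x) <= hnorm x.
  move=> t0; apply: (hnorm_cvg_le (HT t x t0)); apply: nearW => n; exact: euler_le.
have Tlin t : 0 <= t -> linear (T t).
  move=> t0 a x y; apply: (cvg_uniq (HT t _ t0)).
  have -> : (fun n => euler n t (a *: x + y)) = (fun n => a *: euler n t x + euler n t y).
    by apply/funext => n; exact: euler_lin.
  by apply: cvgD; [apply: cvgZr|]; exact: HT.
have Tbop t : 0 <= t -> bop (T t).
  by move=> t0; split; [exact: Tlin|exists 1 => // x; rewrite mul1r Tc].
(* T(t) is compared with the single step J(t), which is the scheme of index 0, and J(t) x with x + t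
   A x; both errors are of order t^2. *)
have Tclose t x : 0 <= t -> D2 x ->
    hnorm (T t x - x - t%:C *: A x) <= 2 * t ^+ 2 * hnorm (A (A x)).
  rewrite le_eqVlt => /predU1P[<- Dx|t0 Dx].
    have -> : T 0 x = x.
      apply: (cvg_uniq (HT 0 x (lexx _))).
      have -> : (fun n => euler n 0 x) = cst x.
        apply/funext => n; rewrite /euler mul0r /=; elim: (2 ^ n)%N => //= k ->.
        by rewrite J0.
      exact: cvg_cst.
    by rewrite subrr scale0r subrr hnorm0 expr0n mulr0 mul0r.
  have e0 : euler 0 t x = J t x by rewrite /euler expn0 divr1.
  have h1 : hnorm (T t x - J t x) <= t ^+ 2 * hnorm (A (A x)) / 2.
    have c : (fun n => euler n t x - J t x) @ \oo --> T t x - J t x.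
      by apply: cvgB; [apply: HT; exact: ltW|exact: cvg_cst].
    apply: (hnorm_cvg_le c); apply: nearW => n; rewrite -e0.
    have := euler_cauchy (ltW t0) Dx (leq0n n).
    by rewrite expn0 invr1 mulr1.
  have stepJ y : D y -> J t y - y = t%:C *: J t (A y).
    move=> Dy; have [_ <-] := J_D (ltW t0) Dy.
    by have [_ e1] := JP y t0; rewrite -[X in _ - X = _]e1; abel.
  have [Dx1 DAx] := Dx.
  have h2 : hnorm (J t x - x - t%:C *: A x) <= t ^+ 2 * hnorm (A (A x)).
    rewrite stepJ// -scalerBr stepJ// scalerA -rmorphM hnormZr -expr2.
    rewrite ger0_norm ?exprn_ge0 ?(ltW t0)// ler_wpM2l ?exprn_ge0 ?(ltW t0)//.
    exact: J_contr (ltW t0).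
  have := hnormD (T t x - J t x) (J t x - x - t%:C *: A x).
  have -> : T t x - J t x + (J t x - x - t%:C *: A x) = T t x - x - t%:C *: A x by abel.
  have : 0 <= t ^+ 2 * hnorm (A (A x)) by rewrite mulr_ge0// exprn_ge0// ltW.
  rewrite -mulrA; lra.
have Tdiff x : D2 x -> ((h^-1)%:C *: (T h x - x)) @[h --> 0^'+] --> A x.
  move=> Dx; apply/right_diffP => e e0.
  have k0 : 0 < 2 * hnorm (A (A x)) + 1 by rewrite ltr_wpDl// mulr_ge0.
  exists (e / (2 * hnorm (A (A x)) + 1)); first by rewrite divr_gt0.
  move=> h /andP[h0]; rewrite ltr_pdivlMr// => he.
  apply: le_trans (Tclose h x (ltW h0) Dx) _.
  have -> : 2 * h ^+ 2 * hnorm (A (A x)) = (h * (2 * hnorm (A (A x)))) * h by ring.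
  rewrite ler_wpM2r ?(ltW h0)//; apply: le_trans (ltW he).
  by rewrite ler_wpM2l ?(ltW h0)// lerDl.
have T00 x : T 0 x = x.
  apply: (cvg_uniq (HT 0 x (lexx _))).
  have -> : (fun n => euler n 0 x) = cst x.
    apply/funext => n; rewrite /euler mul0r /=; elim: (2 ^ n)%N => //= k ->.
    by rewrite J0.
  exact: cvg_cst.
exists T; split => //; split => //.
- by move=> t t0; apply/bounded_opP/Tbop.
(* On the domain of A^2, 2^n steps of size (s+t)/2^n differ from 2^n steps of size t/2^n followed by
   2^n of size s/2^n by at most s t |A^2 x| / 2^n; density does the rest. *)
- move=> s t x s0 t0.
  have st0 : 0 <= s + t by rewrite addr_ge0.
  have b1 := Tbop _ st0.
  have b2 := bop_comp (Tbop _ t0) (Tbop _ s0).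
  apply: (bop_ext_dense b1 b2 (A := D2)) => [|{}x Dx /=].
    by apply/denseP => y e; exact: D2_dense.
  have c1 : (fun n => euler n s (euler n t x)) @ \oo --> T s (T t x).
    apply: (@cvg_hnorm_le _ _ _ _ _ _ _
        (fun n => hnorm (euler n t x - T t x) + hnorm (euler n s (T t x) - T s (T t x)))).
      apply: nearW => n; apply: le_trans (hnorm_tri (euler n s (T t x)) _ _) _.
      by rewrite lerD2r; exact: euler_contr.
    have z1 : (fun n => hnorm (euler n t x - T t x)) @ \oo --> (0 : R).
      exact/cvg_hnorm/HT.
    have z2 : (fun n => hnorm (euler n s (T t x) - T s (T t x))) @ \oo --> (0 : R).
      exact/cvg_hnorm/HT.
    by have := cvgD z1 z2; rewrite addr0; apply.
  have c2 : (fun n => euler n (s + t) x) @ \oo --> T s (T t x).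
    have z : (fun n => s * t * hnorm (A (A x)) * (2^-1) ^+ n +
         hnorm (euler n s (euler n t x) - T s (T t x))) @ \oo --> (0 : R).
      have z1 : (fun n => s * t * hnorm (A (A x)) * (2^-1) ^+ n) @ \oo --> (0 : R).
        rewrite -(mulr0 (s * t * hnorm (A (A x)))); apply: cvgMr; apply: cvg_expr.
        by rewrite ger0_norm ?invr_ge0// invf_lt1// ltr1n.
      have z2 : (fun n => hnorm (euler n s (euler n t x) - T s (T t x))) @ \oo --> (0 : R).
        exact/cvg_hnorm.
      by have := cvgD z1 z2; rewrite addr0; apply.
    apply: cvg_hnorm_le z; apply: nearW => n.
    apply: le_trans (hnorm_tri (euler n s (euler n t x)) _ _) _.
    rewrite lerD2r /euler mulrDl.
    apply: le_trans (iter_split _ (tn0 n s0) (tn0 n t0) Dx) _.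
    rewrite le_eqVlt; apply/orP; left; apply/eqP.
    by rewrite exprVn -natrX; field; rewrite gt_eqF.
  exact: (cvg_uniq (HT _ _ st0)).
- move=> x; apply/right_cvgP => e e0.
  have [y Dy yx] := D2_dense x (divr_gt0 e0 (ltr0Sn R 3)).
  have /right_diffP/(_ 1 ltr01)[d d0 hd] := Tdiff y Dy.
  have k0 : 0 < hnorm (A y) + 1 by rewrite ltr_wpDl.
  exists (Num.min d (e / 4 / (hnorm (A y) + 1))).
    by rewrite lt_min d0 !divr_gt0.
  move=> h /andP[h0]; rewrite lt_min => /andP[h1]; rewrite ltr_pdivlMr// => h2.
  have k1 := hd h; rewrite h0 h1 mul1r in k1; have {}k1 := k1 isT.
  have k2 : hnorm (T h y - y) <= h * (hnorm (A y) + 1).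
    have := hnormD (T h y - y - h%:C *: A y) (h%:C *: A y).
    rewrite subrK hnormZr gtr0_norm//; lra.
  have k3 := Tc h (x - y) (ltW h0); rewrite (linB (Tlin _ (ltW h0))) in k3.
  have k4 := hnorm_tri (T h y) (T h x) x.
  have k5 := hnorm_tri y (T h y) x.
  rewrite [hnorm (x - y)]hnormB in k3; lra.
Qed.

(** The generator of the limit semigroup is known to equal A on the domain of A^2 only. This makes
    the two resolvents at 1 agree on a dense set, hence everywhere, and a resolvent determines its
    operator and domain. *)
Lemma euler_generates : exists T : R -> X -> X, generates D A T.
Proof.
have [T [C0T [Tc TA]]] := euler_semigroup.
pose lim (x y : X) : Prop := ((h^-1)%:C *: (T h x - x)) @[h --> 0^'+] --> y.
pose D' x := exists y : X, lim x y.
pose A' x := xget 0 (lim x).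
have gen' : generates D' A' T.
  split => // x y; split.
    by move=> [[z hz] <-]; rewrite /A'; case: xgetP => [w _ //|/(_ z)].
  move=> h; split; first by exists y.
  rewrite /A'; case: xgetP => [w _ hw|/(_ y)//].
  exact: (cvg_uniq hw).
have D2D' x : D2 x -> D' x /\ A' x = A x.
  by move=> Dx; apply/(genP gen'); exact: TA.
have [||Q [/bounded_opP bQ Q1 Q2]] := @shifted_resolvent R X T D' A' 1 gen' 0.
- by move=> x; rewrite expR0 mul1r Tc.
- exact: ltr01.
have QD y : Q y = J 1 y.
  have bJ : bop (J 1).
    by split; [exact: J_lin|exists 1 => // z; rewrite mul1r J_contr].
  apply: (bop_ext_dense bQ bJ Ddense) => {}y Dy.
  have [DJ AJ] := J_D ler01 Dy.
  have [D1 e1] := JP y ltr01.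
  have [DJ' AJ'] : D' (J 1 y) /\ A' (J 1 y) = A (J 1 y).
    by apply: D2D'; split => //; rewrite AJ; exact: (JP _ ltr01).1.
  have e2 : 1 *: J 1 y - A' (J 1 y) = y by rewrite AJ' -[RHS]e1 !scale1r.
  by rewrite -[in LHS]e2 Q2.
have DE x : D x -> D' x /\ A' x = A x.
  move=> Dx; have e1 : J 1 (x - 1%:C *: A x) = x by exact: J_uniq.
  have [D1 e2] := Q1 (x - 1%:C *: A x).
  move: D1 e2; rewrite QD e1 !scale1r => D1 e2; split => //.
  by apply: oppr_inj; apply: (addrI x).
have DE' x : D' x -> D x.
  move=> Dx; rewrite -(Q2 x Dx) QD; exact: (JP _ ltr01).1.
exists T; split => // x y; split.
  by move=> [Dx <-]; apply: (genP gen' x (A x)).1; exact: DE.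
move=> /(genP gen')[D1 e1]; have D2 := DE' _ D1; split => //.
by have [_ <-] := DE _ D2.
Qed.

End LumerPhillips.

Theorem lumer_phillips (R : realType) (X : hilbertType R) (D : set X) (A : X -> X) :
  (forall (a : R[i]) x y, D x -> D y ->
    D (a *: x + y) /\ A (a *: x + y) = a *: A x + A y) ->
  dense D -> (forall x, D x -> rdot (A x) x <= 0) ->
  (forall h : R, 0 < h -> forall y, exists x, D x /\ x - h%:C *: A x = y) ->
  exists T : R -> X -> X, generates D A T.
Proof.
move=> Alin Dd diss range.
have [J [J0 JP]] := euler_step_ex range.
exact: (euler_generates Alin Dd diss J0 JP).
Qed.

(** * System nodes *)

Lemma isometric_extension (R : realType) (V W : normedModType R[i])
    (Z : completeNormedModType R[i]) (e : V -> W) (g : V -> Z) :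
  linear e -> linear g -> dense (range e) -> (forall x, hnorm (e x) = hnorm (g x)) ->
  exists L : W -> Z, [/\ linear L, forall w, hnorm (L w) = hnorm w & forall x, L (e x) = g x].
Proof.
move=> le lg de eg.
have /choice[s hs] : forall w, exists u : nat -> V, (fun n => e (u n)) @ \oo --> (w : W).
  move=> w; have [v [rv vw]] := dense_seq de w.
  have /choice[u hu] : forall n, exists x, e x = v n.
    by move=> n; have [x _ <-] := rv n; exists x.
  by exists u; under eq_fun do rewrite hu.
have cg (u : nat -> V) w : (fun n => e (u n)) @ \oo --> (w : W) ->
    exists z : Z, (fun n => g (u n)) @ \oo --> z.
  move=> /cvg_hnormP uw; apply: cauchy_hnorm => d d0.
  have [N _ hN] := uw (d / 2) (divr_gt0 d0 (ltr0Sn R 1)); exists N => m n Nm Nn.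
  rewrite -(linB lg) -eg (linB le).
  have := hnorm_tri w (e (u m)) (e (u n)); rewrite [hnorm (w - _)]hnormB.
  have := hN m Nm; have := hN n Nn => /=; lra.
have /choice[L hL] : forall w, exists z : Z, (fun n => g (s w n)) @ \oo --> z.
  by move=> w; exact: cg (hs w).
have LE (u : nat -> V) w : (fun n => e (u n)) @ \oo --> (w : W) ->
    (fun n => g (u n)) @ \oo --> L w.
  move=> uw; have c : (fun n => g (u n) - g (s w n)) @ \oo --> (0 : Z).
    have z : (fun n => e (u n) - e (s w n)) @ \oo --> (0 : W).
      by rewrite -(subrr w); apply: cvgB.
    apply/cvg_hnorm; under eq_fun do rewrite subr0 -(linB lg) -eg (linB le) -[X in hnorm X]subr0.
    exact/cvg_hnorm.
  have c' : (fun n => g (u n) - g (s w n) + g (s w n)) @ \oo --> 0 + L w by apply: cvgD.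
  rewrite add0r in c'.
  have -> : (fun n => g (u n)) = (fun n => g (u n) - g (s w n) + g (s w n)).
    by apply/funext => n; rewrite subrK.
  exact: c'.
exists L; split.
- move=> a x y.
  have c1 : (fun n => e (a *: s x n + s y n)) @ \oo --> a *: x + y.
    have -> : (fun n => e (a *: s x n + s y n)) = (fun n => a *: e (s x n) + e (s y n)).
      by apply/funext => n; rewrite le.
    by apply: cvgD; [apply: cvgZr|]; exact: hs.
  apply: (cvg_uniq (LE _ _ c1)).
  have -> : (fun n => g (a *: s x n + s y n)) = (fun n => a *: g (s x n) + g (s y n)).
    by apply/funext => n; rewrite lg.
  by apply: cvgD; [apply: cvgZr|]; exact: hL.
- move=> w; have c1 : (fun n => hnorm (e (s w n))) @ \oo --> hnorm w.
    exact: cvg_hnorm_cst (hs w).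
  have c2 : (fun n => hnorm (g (s w n))) @ \oo --> hnorm (L w).
    exact: cvg_hnorm_cst (hL w).
  have E : (fun n => hnorm (e (s w n))) = (fun n => hnorm (g (s w n))).
    by apply/funext => n; rewrite eg.
  rewrite E in c1; exact: (cvg_unique _ c2 c1).
- move=> x; apply: (cvg_uniq (LE (fun=> x) _ _)); exact: cvg_cst.
Qed.

Section Resolvents.
Variables (R : realType) (X : hilbertType R) (D : set X) (A : X -> X).

Lemma resolventP s : resolvent_set D A s -> is_resolvent_at D A s (resolvent D A s).
Proof. by move=> [Q HQ]; rewrite /resolvent; apply: xgetPex; exists Q. Qed.

Lemma resolvent_bop s : resolvent_set D A s -> bop (resolvent D A s).
Proof. by move=> /resolventP[/bounded_opP]. Qed.

Lemma resolvent_iff s x f : resolvent_set D A s ->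
  (D x /\ s *: x - A x = f) <-> x = resolvent D A s f.
Proof.
move=> /resolventP[_ R1 R2]; split; first by move=> [Dx <-]; rewrite R2.
by move=> ->; exact: R1.
Qed.

End Resolvents.

Section NodeTheory.
Variables (R : realType) (U X Y : hilbertType R) (S : node U X Y).
Hypothesis nS : is_system_node S.
Local Notation D := (ndom S).
Local Notation A := (nA S).
Local Notation alpha := (nalpha S).

Lemma node_rho_alpha : rho S alpha. Proof. by case: nS => _ []. Qed.

Lemma node_gen : exists T, generates D A T. Proof. by case: nS. Qed.

Lemma node_dense : dense D.
Proof. by have [T] := node_gen; exact: gen_dense. Qed.

Lemma node_comb (a : R[i]) x y : D x -> D y -> D (a *: x + y) /\ A (a *: x + y) = a *: A x + A y.
Proof. by have [T gT] := node_gen; exact: (gen_comb gT). Qed.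

Lemma res_bop s : rho S s -> bop (res S s).
Proof. exact: resolvent_bop. Qed.

Lemma res_iff s x f : rho S s -> (D x /\ s *: x - A x = f) <-> x = res S s f.
Proof. exact: resolvent_iff. Qed.

Lemma res_dom s f : rho S s -> D (res S s f).
Proof. by move=> rs; have [] := (res_iff (res S s f) f rs).2 erefl. Qed.

Lemma res_eq s f : rho S s -> A (res S s f) = s *: res S s f - f.
Proof.
move=> rs; have [_ e] := (res_iff (res S s f) f rs).2 erefl.
by rewrite -[X in _ - X]e; abel.
Qed.

(** [nemb] and the resolvent at alpha have dense ranges and give equal norms, so each extends along
    the other and the extensions are mutually inverse: X_{-1} is a copy of X. *)
Lemma embedding_isometry : exists (L : nXm1 S -> X) (Th : X -> nXm1 S),
  [/\ bop L, bop Th, cancel L Th, cancel Th L & forall x, L (nemb S x) = res S alpha x].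
Proof.
have ra := node_rho_alpha.
have [_ [_ [le ne de]] _ _ _] := nS.
have ne' x : hnorm (nemb S x) = hnorm (res S alpha x) by rewrite /hnorm ne.
have [lr _] := res_bop ra.
have dr : dense (range (res S alpha)).
  apply/denseP => x e e0; have [y Dy xy] := (denseP D).1 node_dense x e e0.
  by exists y => //; exists (alpha *: y - A y) => //; symmetry; apply/(res_iff _ _ ra).
have [L [lL nL LE]] := isometric_extension le lr de ne'.
have [Th [lTh nTh ThE]] := isometric_extension lr le dr (fun x => esym (ne' x)).
have bL : bop L by split => //; exists 1 => // x; rewrite nL mul1r.
have bTh : bop Th by split => //; exists 1 => // x; rewrite nTh mul1r.
exists L, Th; split => //.
- apply: (bop_ext_dense (bop_comp bL bTh) (@bop_id _ _) de) => _ [x _ <-] /=.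
  by rewrite LE ThE.
- apply: (bop_ext_dense (bop_comp bTh bL) (@bop_id _ _) dr) => _ [x _ <-] /=.
  by rewrite ThE LE.
Qed.

Lemma emb_bop : bop (nemb S).
Proof.
have [L [Th [_ bTh LK _ LE]]] := embedding_isometry.
have -> : nemb S = Th \o res S alpha.
  by apply/funext => x /=; rewrite -LE LK.
exact: bop_comp (res_bop node_rho_alpha) bTh.
Qed.

(** (alpha I - A)^-1 B, which represents B by an operator with values in X. *)
Definition inputmap (u : U) : X := Rext S alpha (nB S u).

(** [Aext] and [Rext] are selected by [xget]: a formula for them needs a candidate with the defining
    property, and density for its uniqueness. Seen through L, everything becomes an operator on
    X. *)
Lemma extensionsE : exists (L : nXm1 S -> X) (Th : X -> nXm1 S),
  [/\ bop L, cancel L Th, forall x, L (nemb S x) = res S alpha x,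
      forall x, L (Aext S x) = alpha *: res S alpha x - x
    & forall s, rho S s -> forall xi, Rext S s xi = L xi + (alpha - s) *: res S s (L xi)].
Proof.
have [L [Th [bL bTh LK ThK LE]]] := embedding_isometry.
exists L, Th; split => //.
- have -> : Aext S = (fun x => alpha *: nemb S x - Th x); last first.
    by move=> x; case: bL => lL _; rewrite (linB lL) (linZ lL) LE ThK.
  have P : bounded_op (fun x => alpha *: nemb S x - Th x) /\ forall x, D x ->
      alpha *: nemb S x - Th x = nemb S (A x).
    split; first by apply/bounded_opP; apply: bopB => //; apply: bopZ; exact: emb_bop.
    move=> x Dx; have lem := (emb_bop).1; have [lTh _] := bTh.
    have e : x = L (nemb S (alpha *: x - A x)).
      by rewrite LE; apply/(res_iff _ _ node_rho_alpha).
    rewrite [X in _ - Th X]e LK (linB lem) (linZ lem); abel.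
  rewrite /Aext; case: xgetP => [f _ [/bounded_opP bf fE]|/(_ _ P)//].
  apply/funext; apply: (bop_ext_dense bf _ node_dense).
    by case: P => /bounded_opP.
  by move=> x Dx; rewrite fE// P.2.
- move=> s rs xi.
  (* The resolvent identity R(s) = R(alpha) + (alpha - s) R(s) R(alpha), with L in the place of
     R(alpha). *)
  pose F xi := L xi + (alpha - s) *: res S s (L xi).
  have bF : bop F.
    by apply: bopD => //; apply: bopZ; exact: bop_comp bL (res_bop rs).
  have P : bounded_op F /\ forall x, F (nemb S x) = res S s x.
    split; first exact/bounded_opP.
    move=> x; rewrite /F LE; apply/(res_iff _ _ rs).
    have ra := node_rho_alpha.
    have [D1 e1] := (res_iff (res S alpha x) x ra).2 erefl.
    set r := res S alpha x in D1 e1 *.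
    have [D2 e2] := (res_iff (res S s r) r rs).2 erefl.
    set q := res S s r in D2 e2 *.
    have [D3 e3] := node_comb (alpha - s) D2 D1.
    rewrite addrC; split => //; rewrite e3.
    have -> : A r = alpha *: r - x by rewrite -[X in _ - X]e1; abel.
    have -> : A q = s *: q - r by rewrite -[X in _ - X]e2; abel.
    rewrite scalerDr scalerBr !scalerA [(alpha - s) * s]mulrC !scalerBl; abel.
  rewrite /Rext; case: xgetP => [f _ [/bounded_opP bf fE]|/(_ _ P)//].
  have [_ [_ [_ _ de]] _ _ _] := nS.
  apply: (bop_ext_dense bf bF de) => _ [x _ <-].
  by rewrite fE P.2.
Qed.

Lemma inputmap_bop : bop inputmap.
Proof.
have [L [Th [bL LK LE LA LR]]] := extensionsE.
have ra := node_rho_alpha.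
have bB : bop (nB S) by case: nS => _ _ [/bounded_opP].
have -> : inputmap = L \o nB S.
  by apply/funext => u; rewrite /inputmap LR// subrr scale0r addr0.
exact: bop_comp bB bL.
Qed.

Lemma Rext_input s u : rho S s ->
  Rext S s (nB S u) = inputmap u + (alpha - s) *: res S s (inputmap u).
Proof.
move=> rs; have [L [Th [bL LK LE LA LR]]] := extensionsE.
by rewrite /inputmap !LR// ?subrr ?scale0r ?addr0//; exact: node_rho_alpha.
Qed.

(* [nrel x u w y]: the node sends the state [x] and the input [u] to
   [w = Ax + Bu] in X and to the output [y]. *)
Definition nrel (x : X) (u : U) (w : X) (y : Y) :=
  [/\ D (x - inputmap u), w = A (x - inputmap u) + alpha *: inputmap u
    & y = nC S (x - inputmap u) + nG S alpha u].

(** Applying the injective L of [extensionsE] turns the equation in X_{-1} into one in X about the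
    resolvent at alpha. *)
Lemma state_eqP x u w : nemb S w = Aext S x + nB S u <->
  D (x - inputmap u) /\ w = A (x - inputmap u) + alpha *: inputmap u.
Proof.
have [L [Th [bL LK LE LA LR]]] := extensionsE.
have ra := node_rho_alpha.
have LB : L (nB S u) = inputmap u by rewrite /inputmap LR// subrr scale0r addr0.
have [lr _] := res_bop ra; have [lL _] := bL.
have e0 : L (nemb S w) = L (Aext S x + nB S u) <->
    x - inputmap u = res S alpha (alpha *: x - w).
  rewrite (linD lL) LE LA LB (linB lr) (linZ lr).
  split => [->|e]; first abel.
  transitivity (alpha *: res S alpha x - (x - inputmap u)); last abel.
  by rewrite e; abel.
have -> : (nemb S w = Aext S x + nB S u) = (L (nemb S w) = L (Aext S x + nB S u)).
  by apply/propext; split => [->//|/(can_inj LK)].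
rewrite e0 -(res_iff _ _ ra); split => -[Dx e]; split => //.
  have -> : w = alpha *: x - (alpha *: x - w) by rewrite subKr.
  by rewrite -e scalerBr; abel.
by rewrite e scalerBr; abel.
Qed.

Lemma nC_comb (a : R[i]) x y : D x -> D y -> nC S (a *: x + y) = a *: nC S x + nC S y.
Proof. by case: nS => _ _ [_ [+ _]] _ _; apply. Qed.

Lemma nCD x y : D x -> D y -> nC S (x + y) = nC S x + nC S y.
Proof. by move=> Dx Dy; have := nC_comb 1 Dx Dy; rewrite !scale1r. Qed.

Lemma nD0 : D 0. Proof. by have [T gT] := node_gen; exact: gen_dom0 gT. Qed.

Lemma nDZ (a : R[i]) x : D x -> D (a *: x).
Proof. by move=> Dx; have [+ _] := node_comb a Dx nD0; rewrite addr0. Qed.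

Lemma nA0 : A 0 = 0.
Proof.
have [_] := node_comb (-1) nD0 nD0.
by rewrite scaler0 addr0 scaleN1r addNr.
Qed.

Lemma nC0 : nC S 0 = 0.
Proof. by have := nC_comb (-1) nD0 nD0; rewrite scaler0 addr0 scaleN1r addNr. Qed.

Lemma nG_bop s : rho S s -> bop (nG S s).
Proof. by move=> rs; apply/bounded_opP; case: nS => _ _ _ + _; apply. Qed.

Lemma nG_eq s u : rho S s ->
  nG S s u = nG S alpha u + nC S (Rext S s (nB S u) - inputmap u).
Proof.
move=> rs; have [_ _ _ _ /(_ s alpha u rs node_rho_alpha) <-] := nS.
by rewrite addrC subrK.
Qed.

(** Moves the relation from alpha to any point s of the resolvent set: (sI - A)^-1 B u differs from
    [inputmap S u] by an element of the domain. Feedback equations are solved in this form. *)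
Lemma nrel_res s x u f y : rho S s -> nrel x u (s *: x - f) y <->
  x = res S s f + Rext S s (nB S u) /\ y = nC S (res S s f) + nG S s u.
Proof.
move=> rs; have Df := res_dom f rs; have [lr _] := res_bop rs.
set b := inputmap u; set q := (alpha - s) *: res S s b.
have Dq : D q by apply: nDZ; exact: res_dom.
have eR : Rext S s (nB S u) - b = q by rewrite Rext_input// addrAC subrr add0r.
have eR' : Rext S s (nB S u) = b + q by rewrite -eR addrC subrK.
have eG : nG S s u = nG S alpha u + nC S q by rewrite nG_eq// eR.
have key : (D (x - b) /\ s *: x - f = A (x - b) + alpha *: b) <->
    x = res S s f + Rext S s (nB S u).
  have -> : (x = res S s f + Rext S s (nB S u)) <->
      (x - b = res S s (f + (alpha - s) *: b)).
    rewrite eR' (linD lr) (linZ lr) -/q; split => [->|e]; first abel.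
    by rewrite -(subrK b x) e; abel.
  rewrite -(res_iff _ _ rs); split => -[Dx e]; split => //.
    rewrite scalerBr scalerBl.
    transitivity ((s *: x - f) - A (x - b) + f - s *: b); first abel.
    by rewrite e; abel.
  have -> : s *: x - f = s *: (x - b) - A (x - b) + A (x - b) + s *: b - f.
    by rewrite scalerBr; abel.
  by rewrite e scalerBl; abel.
split.
  move=> [D1 e1 ->]; have ex := key.1 (conj D1 e1); split => //.
  have -> : x - inputmap u = res S s f + q by rewrite ex eR' -/b; abel.
  by rewrite nCD// eG; abel.
move=> [ex ->]; have [D1 e1] := key.2 ex; split => //.
have -> : x - inputmap u = res S s f + q by rewrite ex eR' -/b; abel.
by rewrite nCD// eG; abel.
Qed.

Lemma nrel_output s x u w y : rho S s -> nrel x u w y ->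
  y = nC S (x - Rext S s (nB S u)) + nG S s u.
Proof.
move=> rs; rewrite -[w](subKr (s *: x)) => /(nrel_res _ _ _ _ rs)[ex ->].
by congr (nC S _ + _); rewrite [X in _ = X - _]ex addrK.
Qed.

Lemma nrel_comb (a : R[i]) x u w y x' u' w' y' :
  nrel x u w y -> nrel x' u' w' y' ->
  nrel (a *: x + x') (a *: u + u') (a *: w + w') (a *: y + y').
Proof.
move=> [D1 -> ->] [D2 -> ->].
have [lb _] := inputmap_bop; have [lG _] := nG_bop node_rho_alpha.
have e : a *: x + x' - inputmap (a *: u + u') =
    a *: (x - inputmap u) + (x' - inputmap u').
  by rewrite lb scalerBr; abel.
have [D3 e3] := node_comb a D1 D2.
rewrite /nrel e; split => //.
  by rewrite e3 lb !scalerDr !scalerA [alpha * a]mulrC; abel.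
by rewrite nC_comb// lG !scalerDr; abel.
Qed.

Lemma nrel_dom x : D x -> nrel x 0 (A x) (nC S x).
Proof.
move=> Dx; have [lb _] := inputmap_bop; have [lG _] := nG_bop node_rho_alpha.
by rewrite /nrel (lin0 lb) (lin0 lG) scaler0 subr0 !addr0.
Qed.

Lemma nrel_dom_inv x w y : nrel x 0 w y -> [/\ D x, w = A x & y = nC S x].
Proof.
have [lb _] := inputmap_bop; have [lG _] := nG_bop node_rho_alpha.
by rewrite /nrel (lin0 lb) (lin0 lG) scaler0 subr0 !addr0.
Qed.

Lemma trajectoryP z0 u z y : trajectory S z0 u z y <->
  [/\ C2 u, z 0 = z0 & exists dz, C1_on z dz /\
      forall t : R, 0 <= t -> nrel (z t) (u t) (dz t) (y t)].
Proof.
split.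
  move=> [[C2u _] z00 [dz [C1z H]] out]; split => //; exists dz; split => // t t0.
  have [D1 e1] := (state_eqP _ _ _).1 (H t t0).
  by split => //; exact: (out _ node_rho_alpha).
move=> [C2u z00 [dz [C1z H]]]; split => //.
- split => //; exists (dz 0); rewrite -z00.
  by have [D1 e1 _] := H 0 (lexx _); symmetry; apply/state_eqP.
- exists dz; split => // t t0; apply/state_eqP.
  by have [] := H t t0.
- by move=> s rs t t0; exact: nrel_output (H t t0).
Qed.

End NodeTheory.

(** * Trajectories and pointwise passivity *)

Section Curves.
Variable R : realType.

Lemma exp_derivative (V : normedModType R[i]) (s : R[i]) (v : V) :
  derivative_on (fun t => cexp (s * t%:C) *: v) (fun t => cexp (s * t%:C) *: (s *: v)).
Proof.
apply/derivative_onP => t t0 e e0.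
have k0 : 0 < cabs (cexp (s * t%:C)) * hnorm v + 1.
  by rewrite ltr_wpDl// mulr_ge0 ?cabs_ge0.
have [d d0 hd] := cexp_diff s (divr_gt0 e0 k0).
exists d => // h hh _.
have -> : cexp (s * (t + h)%:C) *: v - cexp (s * t%:C) *: v -
    h%:C *: (cexp (s * t%:C) *: (s *: v)) =
    (cexp (s * t%:C) * (cexp (s * h%:C) - 1 - s * h%:C)) *: v.
  rewrite rmorphD mulrDr cexpD !scalerA -!scalerBl; congr (_ *: _).
  by ring.
rewrite hnormZ cabsM.
have := hd h hh; rewrite mulrAC ler_pdivlMr// => h1.
apply: le_trans h1; rewrite mulrAC [leLHS]mulrC ler_wpM2l ?cabs_ge0//.
by rewrite lerDl.
Qed.

Lemma exp_C1 (V : normedModType R[i]) (s : R[i]) (v : V) :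
  C1_on (fun t => cexp (s * t%:C) *: v) (fun t => cexp (s * t%:C) *: (s *: v)).
Proof. by split; [|apply: derivative_on_cont]; exact: exp_derivative. Qed.

Lemma exp_C2 (V : normedModType R[i]) (s : R[i]) (v : V) :
  C2 (fun t : R => cexp (s * t%:C) *: v).
Proof.
exists (fun t => cexp (s * t%:C) *: (s *: v)), (fun t => cexp (s * t%:C) *: (s *: (s *: v))).
by split; [exact: exp_derivative|exact: exp_C1].
Qed.

Lemma within_comb (V : normedModType R[i]) (a : R[i]) (f g : R -> V) :
  {within `[0, +oo[, continuous f} -> {within `[0, +oo[, continuous g} ->
  {within `[0, +oo[, continuous (fun t => a *: f t + g t)}.
Proof.
move=> /subspace_continuousP cf /subspace_continuousP cg.
apply/subspace_continuousP => t t0; apply: cvgD; last exact: cg.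
by apply: cvgZr; exact: cf.
Qed.

Lemma within_bop (V W : normedModType R[i]) (h : V -> W) (f : R -> V) : bop h ->
  {within `[0, +oo[, continuous f} -> {within `[0, +oo[, continuous (fun t => h (f t))}.
Proof.
move=> bh /subspace_continuousP cf.
by apply/subspace_continuousP => t t0; apply: bop_cvg => //; exact: cf.
Qed.

Lemma derivative_comb (V : normedModType R[i]) (a : R[i]) (f g df dg : R -> V) :
  derivative_on f df -> derivative_on g dg ->
  derivative_on (fun t => a *: f t + g t) (fun t => a *: df t + dg t).
Proof.
move=> hf hg t t0.
have c : (a *: ((h^-1)%:C *: (f (t + h) - f t)) + (h^-1)%:C *: (g (t + h) - g t))
      @[h --> within [set h : R | 0 <= t + h] 0^'] --> a *: df t + dg t.
  by apply: cvgD; [apply: cvgZr; exact: hf|exact: hg].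
have E : (fun h : R => (h^-1)%:C *: (a *: f (t + h) + g (t + h) - (a *: f t + g t))) =
    (fun h => a *: ((h^-1)%:C *: (f (t + h) - f t)) + (h^-1)%:C *: (g (t + h) - g t)).
  apply/funext => h; rewrite scalerA mulrC -scalerA -scalerDr; congr (_ *: _).
  by rewrite scalerBr; abel.
by rewrite E.
Qed.

Lemma C1_comb (V : normedModType R[i]) (a : R[i]) (f g df dg : R -> V) :
  C1_on f df -> C1_on g dg ->
  C1_on (fun t => a *: f t + g t) (fun t => a *: df t + dg t).
Proof.
by move=> [f1 f2] [g1 g2]; split; [exact: derivative_comb|exact: within_comb].
Qed.

Lemma C2_comb (V : normedModType R[i]) (a : R[i]) (f g : R -> V) :
  C2 f -> C2 g -> C2 (fun t => a *: f t + g t).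
Proof.
move=> [f1 [f2 [hf hf']]] [g1 [g2 [hg hg']]].
exists (fun t => a *: f1 t + g1 t), (fun t => a *: f2 t + g2 t).
by split; [exact: derivative_comb|exact: C1_comb].
Qed.

End Curves.

(** The graph norms at b and s are comparable. Stated for a bare operator, since it also serves the
    closed loop before that is known to be a node. *)
Lemma graph_bounded_resolvent (R : realType) (X Y : hilbertType R) (D : set X)
    (A : X -> X) (C : X -> Y) (b s : R[i]) (M : R) : resolvent_set D A s ->
  (forall (a : R[i]) x y, D x -> D y -> C (a *: x + y) = a *: C x + C y) ->
  (forall x, D x -> hnorm (C x) <= M * hnorm (b *: x - A x)) ->
  bop (fun f => C (resolvent D A s f)).
Proof.
move=> rs Cc HM; have [lr [N N0 HN]] := resolvent_bop rs.
have RD f := (resolvent_iff (resolvent D A s f) f rs).2 erefl.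
split.
  by move=> a x y; rewrite lr Cc//; [case: (RD x)|case: (RD y)].
exists (`|M| * (1 + cabs (b - s) * N)).
  by rewrite mulr_ge0// addr_ge0// mulr_ge0 ?cabs_ge0.
move=> f; have [Df ef] := RD f; set r := resolvent D A s f in Df ef *.
apply: le_trans (HM _ Df) _; rewrite -mulrA.
apply: (@le_trans _ _ (`|M| * hnorm (b *: r - A r))).
  by rewrite ler_wpM2r// ler_norm.
rewrite ler_wpM2l//.
have -> : b *: r - A r = f + (b - s) *: r by rewrite -[in RHS]ef scalerBl; abel.
apply: le_trans (hnormD _ _) _; rewrite mulrDl mul1r lerD2l hnormZ -mulrA.
by rewrite ler_wpM2l ?cabs_ge0//; exact: HN.
Qed.

Section NodeTrajectories.
Variables (R : realType) (U X Y : hilbertType R) (S : node U X Y).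
Hypothesis nS : is_system_node S.

Lemma CRes_bop s : rho S s -> bop (fun f => nC S (res S s f)).
Proof.
move=> rs; have [_ _ [_ [_ [M HM]]] _ _] := nS.
exact: (graph_bounded_resolvent rs (nC_comb nS) HM).
Qed.

(** x - bu = (alpha I - A)^-1 (alpha z - dz) along a trajectory, so y is a bounded function of z,
    its derivative and u, although C alone is unbounded on X. *)
Lemma output_cont (z dz : R -> X) (u : R -> U) (y : R -> Y) :
  {within `[0, +oo[, continuous z} -> {within `[0, +oo[, continuous dz} ->
  {within `[0, +oo[, continuous u} ->
  (forall t, 0 <= t -> nrel S (z t) (u t) (dz t) (y t)) ->
  {within `[0, +oo[, continuous y}.
Proof.
move=> cz cdz cu H; have ra := node_rho_alpha nS.
pose y' t := 1 *: nC S (res S (nalpha S) (nalpha S *: z t - dz t)) + nG S (nalpha S) (u t).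
have cy' : {within `[0, +oo[, continuous y'}.
  apply: within_comb; last exact: within_bop (nG_bop nS ra) cu.
  apply: (within_bop (CRes_bop ra)).
  have -> : (fun t => nalpha S *: z t - dz t) = (fun t => nalpha S *: z t + ((-1) *: dz t + 0)).
    by apply/funext => t; rewrite addr0 scaleN1r.
  apply: within_comb => //; apply: within_comb => //.
  by apply: continuous_subspaceT => t; exact: cvg_cst.
apply: subspace_eq_continuous cy' => t; rewrite inE itv0yE => t0.
have [|_ e] := (nrel_res nS (z t) (u t) (nalpha S *: z t - dz t) (y t) ra).1.
  by rewrite subKr; exact: H.
have ey : y t = y' t by rewrite e /y' scale1r.
exact: esym ey.
Qed.

(** The particular solution e^{st} (sI - A)^-1 B u plus the orbit of the remaining initial state,
    which is differentiable because that state lies in the domain. *)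
Lemma exp_trajectory (T : R -> X -> X) s x u : generates (ndom S) (nA S) T ->
  rho S s -> ndom S (x - Rext S s (nB S u)) ->
  exists z y, [/\ trajectory S x (fun t => cexp (s * t%:C) *: u) z y & z 0 = x].
Proof.
move=> gT rs Dx; set q := Rext S s (nB S u) in Dx *.
pose z (t : R) := cexp (s * t%:C) *: q + T t (x - q).
pose y (t : R) := cexp (s * t%:C) *: nG S s u + nC S (T t (x - q)).
have z0 : z 0 = x by rewrite /z mulr0 cexp0 scale1r (C0_0 (proj1 gT)) addrC subrK.
exists z, y; split => //; apply/(trajectoryP nS); split => //; first exact: exp_C2.
exists (fun t => cexp (s * t%:C) *: (s *: q) + T t (nA S (x - q))); split.
  have := C1_comb 1 (exp_C1 s q) (gen_orbit_derivative gT Dx).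
  by under eq_fun do rewrite scale1r; under [X in C1_on _ X]eq_fun do rewrite scale1r.
move=> t t0.
have [Dt <-] := gen_orbit gT t0 Dx.
have h1 : nrel S q u (s *: q) (nG S s u).
  rewrite -[X in nrel S _ _ X _]subr0; apply/(nrel_res nS) => //.
  have [lr _] := res_bop rs.
  by rewrite (lin0 lr) (nC0 nS) !add0r.
have := nrel_comb nS (cexp (s * t%:C)) h1 (nrel_dom nS Dt).
by rewrite addr0.
Qed.

End NodeTrajectories.

Section Passivity.
Variables (R : realType) (U X : hilbertType R) (S : node U X U) (E : U -> U).
Hypothesis nS : is_system_node S.
Hypothesis bE : bounded_op E.
Hypothesis passive : impedance_passive (shift_node S E).

Lemma Rintegral_right_le (f : R -> R) (e : R) : {within `[0, +oo[, continuous f} ->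
  0 < e -> exists2 d : R, 0 < d & forall t, 0 < t < d ->
  \int[lebesgue_measure]_(s in `[0, t]) f s <= t * (f 0 + e).
Proof.
move=> cf e0; have /cvgrPdist_lt/(_ e e0) := within_at_right cf.
rewrite near_withinE => /nbhs_ballP[d /= d0 hd].
exists d => // t /andP[t0 td].
have -> : t * (f 0 + e) = \int[lebesgue_measure]_(s in `[0, t]) (f 0 + e).
  have mt : @lebesgue_measure R [set` `[0, t]] = t%:E.
    by rewrite lebesgue_measure_itv /= lte_fin t0 sube0.
  by rewrite Rintegral_cst// mulrC; congr (_ * _); exact: esym (congr1 fine mt).
apply: le_Rintegral => //; first exact: within_integrable.
  apply: (@within_integrable R (fun=> f 0 + e)); apply: continuous_subspaceT => s.
  exact: cvg_cst.
move=> s; rewrite /= in_itv/= => /andP[]; rewrite le_eqVlt => /predU1P[<- _|s0 st].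
  by rewrite lerDl ltW.
have : `|f 0 - f s| < e.
  by apply: hd => //; rewrite -ball_normE /ball_/= sub0r normrN gtr0_norm// (le_lt_trans st).
rewrite distrC => /ltW; rewrite ler_norml => /andP[_]; lra.
Qed.

Lemma passive_pointwise x u w y : nrel S x u w y -> rdot w x <= rdot u (y + E u).
Proof.
move=> H; have nSE := shift_node_is_system_node bE nS.
have [T gT] := node_gen nS.
have ra := node_rho_alpha nS.
have HE : nrel (shift_node S E) x u w (y + E u).
  by case: H => D1 e1 e2; split => //; rewrite e2 /= addrA.
have [z [v [tr z0]]] := exp_trajectory nSE gT (ra : rho (shift_node S E) (nalpha S))
  (let: And3 D1 _ _ := HE in D1).
have [_ _ [dz [C1z Hz]]] := (trajectoryP nSE _ _ _ _).1 tr.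
have H0 := Hz 0 (lexx _).
rewrite mulr0 cexp0 scale1r z0 in H0.
have edz : dz 0 = w by case: H0 => _ -> _; case: HE.
have ev : v 0 = y + E u by case: H0 => _ _ ->; case: HE.
pose phi t := rdot (cexp (nalpha S * t%:C) *: u) (v t).
have cphi : {within `[0, +oo[, continuous phi}.
  have cu := derivative_on_cont (@exp_derivative R U (nalpha S) u).
  apply: within_rdot => //.
  exact: (output_cont nSE (derivative_on_cont C1z.1) C1z.2 cu Hz).
have phi0 : phi 0 = rdot u (y + E u) by rewrite /phi mulr0 cexp0 scale1r ev.
apply/ler_addgt0Pr => e e0.
have k0 : 0 < 1 + hnorm x by rewrite ltr_pwDl.
(* Two errors must fit into e: e' from the integral of the supply rate, and e' |x| from the
   derivative of the state. The square |z(t) - x|^2 has the favourable sign and is dropped. *)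
have e1 := divr_gt0 e0 k0; set e' := e / _ in e1.
have [d1 d10 h1] := Rintegral_right_le cphi e1.
have [d2 d20 h2] := (derivative_onP _ _).1 C1z.1 0 (lexx _) e' e1.
pose t := Num.min d1 d2 / 2.
have m0 : 0 < Num.min d1 d2 by rewrite lt_min d10.
have t0 : 0 < t by rewrite divr_gt0.
have tm : t < Num.min d1 d2 by rewrite ltr_pdivrMr// ltr_pMr// ltr1n.
move: (tm); rewrite lt_min => /andP[td1 td2].
have k1 := h1 t; rewrite t0 td1 in k1; have {}k1 := k1 isT.
have k2 := h2 t; rewrite gtr0_norm// add0r z0 edz in k2.
have {}k2 := k2 td2 (ltW t0).
have k3 := passive tr t0; rewrite -/(phi _) in k3.
have k4 : hnorm (z t) ^+ 2 - hnorm x ^+ 2 = 2 * rdot (z t - x) x + hnorm (z t - x) ^+ 2.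
  by have := hnormDsq (z t - x) x; rewrite subrK => ->; ring.
have k5 : rdot (z t - x - t%:C *: w) x = rdot (z t - x) x - t * rdot w x.
  by rewrite rdotBl rdotZl.
have k6 := cauchy_schwarz_abs (z t - x - t%:C *: w) x.
have k7 : hnorm (z t - x - t%:C *: w) * hnorm x <= e' * t * hnorm x.
  by rewrite ler_wpM2r.
have {k6} [k6 _] := andP (etrans (esym (ler_norml _ _)) k6).
have k9 : 0 <= hnorm (z t - x) ^+ 2 by exact: exprn_ge0.
rewrite phi0 in k1.
have ee : e' * (1 + hnorm x) = e by rewrite divfK ?gt_eqF.
rewrite -(ler_pM2l t0) -ee.
lra.
Qed.

End Passivity.

(** * The closed loop *)

Section PositivePart.
Variables (R : realType) (U : hilbertType R) (E Ep : U -> U).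
Hypotheses (bE : bounded_op E) (saE : selfadjoint E) (pE : is_positive_part E Ep).

Lemma opnorm_ge0 : 0 <= opnorm Ep.
Proof.
(* A set without a supremum has [sup] equal to 0. *)
rewrite /opnorm; have [h|/sup_out->//] := pselect (has_sup [set hnorm (Ep x) | x in [set x | hnorm x <= 1]]).
apply: (@le_trans _ _ (hnorm (Ep 0))); first exact: hnorm_ge0.
by apply: ub_le_sup; [case: h|exists 0 => //=; rewrite hnorm0].
Qed.

(** Invariance and orthogonality remove the mixed terms. Orthogonality also gives |w| <= |v + w|,
    which bounds the set whose supremum is [opnorm Ep]. *)
Lemma positive_part_bound u : rdot (E u) u <= opnorm Ep * hnorm u ^+ 2.
Proof.
have [Um [Up [[[Um0 _] [Up0 UpZ]] [orth dec] [EUm EUp] [neg pos] Epdef]]] := pE.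
have [lE [M M0 HM]] := (bounded_opP E).1 bE.
have orthr v w : Um v -> Up w -> rdot v w = 0 by move=> hv hw; rewrite /rdot orth.
have pyth v w : Um v -> Up w -> hnorm w <= hnorm (v + w).
  move=> hv hw; rewrite -(@ler_pXn2r _ 2)// ?nnegrE// hnormDsq orthr// mulr0 addr0.
  by rewrite lerDr exprn_ge0.
have Epw w : Up w -> hnorm (E w) <= opnorm Ep * hnorm w.
  move=> hw; have [->|w0] := eqVneq w 0; first by rewrite (lin0 lE) !hnorm0 mulr0.
  have nw : 0 < hnorm w.
    by rewrite lt_def hnorm_ge0 andbT; apply: contra_neq w0; exact: hnorm_eq0.
  rewrite -ler_pdivrMr//; apply: ub_le_sup.
    exists M => _ [z /= z1 <-]; have [v [w' [hv hw' ez]]] := dec z.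
    rewrite ez Epdef//; apply: le_trans (HM _) _; rewrite -[leRHS]mulr1 ler_wpM2l//.
    by rewrite ez in z1; apply: le_trans z1; exact: pyth.
  exists ((hnorm w)^-1%:C *: w).
    by rewrite /= hnormZr gtr0_norm ?invr_gt0// mulVf ?gt_eqF.
  have hw' : Up ((hnorm w)^-1%:C *: w) by rewrite -[_ *: _]addr0; exact: UpZ.
  have -> : Ep ((hnorm w)^-1%:C *: w) = E ((hnorm w)^-1%:C *: w).
    by rewrite -[X in Ep X]add0r Epdef.
  by rewrite (linZ lE) hnormZr gtr0_norm ?invr_gt0// mulrC.
have [v [w [hv hw ->]]] := dec u.
rewrite (linD lE) rdotDl !rdotDr [rdot (E w) v]rdotC.
rewrite (orthr (E v) w (EUm _ hv) hw) (orthr v (E w) hv (EUp _ hw)) addr0 add0r.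
have h1 : rdot (E v) v <= 0.
  by have := neg v hv; rewrite lecE => /andP[_].
have h2 : rdot (E w) w <= opnorm Ep * hnorm w ^+ 2.
  apply: le_trans (cauchy_schwarz _ _) _; rewrite expr2 mulrA ler_wpM2r//.
  exact: Epw.
have h3 : opnorm Ep * hnorm w ^+ 2 <= opnorm Ep * hnorm (v + w) ^+ 2.
  by rewrite ler_wpM2l ?opnorm_ge0// lerXn2r ?nnegrE// pyth.
lra.
Qed.

End PositivePart.

Section ClosedLoop.
Variables (R : realType) (U X : hilbertType R) (S : node U X U) (E : U -> U).
Variables (c kappa : R).
Hypotheses (nS : is_system_node S) (bE : bounded_op E).
Hypothesis passive : impedance_passive (shift_node S E).
Hypothesis Ec : forall u, rdot (E u) u <= c * hnorm u ^+ 2.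
Hypotheses (k0 : 0 < kappa) (kc : kappa * c < 1).

(** The margin: the feedback contributes -|u|^2 / kappa to the supply rate, while E contributes at
    most c |u|^2. *)
Let delta := kappa^-1 - c.

Let delta0 : 0 < delta.
Proof. by rewrite subr_gt0 -[kappa^-1]mul1r ltr_pdivlMr// mulrC. Qed.

Definition nrelK x v w y := nrel S x (v - kappa%:C *: y) w y.

Lemma node_contraction : exists T, generates (ndom S) (nA S) T /\
  forall (t : R) x, 0 <= t -> hnorm (T t x) <= hnorm x.
Proof.
have [T gT] := node_gen nS; exists T; split => // t x t0.
apply: (dissipative_contraction gT) => // z Dz.
by have := passive_pointwise nS bE passive (nrel_dom nS Dz); rewrite rdot0l.
Qed.

Lemma right_half_plane (s : R[i]) : 0 < complex.Re s -> rho S s.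
Proof.
have [T [gT Tc]] := node_contraction.
by apply: (shifted_resolvent gT) => x; rewrite expR0 mul1r Tc.
Qed.

Lemma closed_loop_dissipation x v w y : nrelK x v w y ->
  rdot w x <= kappa^-1 * rdot (v - kappa%:C *: y) v - delta * hnorm (v - kappa%:C *: y) ^+ 2.
Proof.
move=> H; have := passive_pointwise nS bE passive H.
set u := v - kappa%:C *: y; rewrite rdotDr => h1.
have h2 : rdot u y = kappa^-1 * (rdot u v - hnorm u ^+ 2).
  have -> : y = (kappa^-1)%:C *: (v - u).
    by rewrite /u subKr scalerA -rmorphM mulVf ?gt_eqF// scale1r.
  by rewrite rdotZr rdotBr rdot_hnorm.
have h3 := Ec u; rewrite rdotC in h3.
rewrite h2 in h1; rewrite /delta; lra.
Qed.

(** Young's inequality spends half of delta |u|^2 on the cross term |u||v| / kappa, at the price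
    |v|^2 / (2 delta kappa^2). The other half pays for the output through kappa^2 |y|^2 <= 2|u|^2 +
    2|v|^2. *)
Definition gain_y := delta * kappa ^+ 2 / 4.
Definition gain_v := delta / 2 + (2 * delta * kappa ^+ 2)^-1.

Lemma gain_y_gt0 : 0 < gain_y.
Proof. by rewrite divr_gt0// mulr_gt0// exprn_gt0. Qed.

Lemma gain_v_gt0 : 0 < gain_v.
Proof. by rewrite addr_gt0 ?divr_gt0 ?invr_gt0// !mulr_gt0// exprn_gt0. Qed.

Lemma closed_loop_energy x v w y : nrelK x v w y ->
  rdot w x <= gain_v * hnorm v ^+ 2 - gain_y * hnorm y ^+ 2.
Proof.
move=> /closed_loop_dissipation; set u := v - _ => h1.
have h2 := cauchy_schwarz u v.
have h3 : kappa^-1 * (hnorm u * hnorm v) <=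
    delta / 2 * hnorm u ^+ 2 + (2 * delta * kappa ^+ 2)^-1 * hnorm v ^+ 2.
  rewrite -subr_ge0.
  have -> : delta / 2 * hnorm u ^+ 2 + (2 * delta * kappa ^+ 2)^-1 * hnorm v ^+ 2 -
     kappa^-1 * (hnorm u * hnorm v) =
     delta / 2 * (hnorm u - hnorm v / (delta * kappa)) ^+ 2.
    by field; rewrite !gt_eqF.
  by rewrite mulr_ge0 ?divr_ge0 ?(ltW delta0)// sqr_ge0.
have h4 : kappa ^+ 2 * hnorm y ^+ 2 <= 2 * hnorm u ^+ 2 + 2 * hnorm v ^+ 2.
  have e : kappa%:C *: y = v - u by rewrite /u subKr.
  have : hnorm (v - u) ^+ 2 + hnorm (v + u) ^+ 2 = 2 * hnorm v ^+ 2 + 2 * hnorm u ^+ 2.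
    by rewrite (hnormBsq v u) (hnormDsq v u); ring.
  rewrite -e hnormZr exprMn real_normK ?num_real//.
  have := exprn_ge0 2 (hnorm_ge0 (v + u)); lra.
have h5 : kappa^-1 * rdot u v <= kappa^-1 * (hnorm u * hnorm v).
  by rewrite ler_wpM2l// invr_ge0 ltW.
have h6 : delta / 4 * (kappa ^+ 2 * hnorm y ^+ 2) <= delta / 4 * (2 * hnorm u ^+ 2 + 2 * hnorm v ^+ 2).
  by rewrite ler_wpM2l// divr_ge0// ltW.
rewrite /gain_v /gain_y; lra.
Qed.

Lemma nrelK_comb (a : R[i]) x v w y x' v' w' y' : nrelK x v w y -> nrelK x' v' w' y' ->
  nrelK (a *: x + x') (a *: v + v') (a *: w + w') (a *: y + y').
Proof.
move=> H H'; have := nrel_comb nS a H H'; rewrite /nrelK.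
congr (nrel S _ _ _ _).
by rewrite scalerBr scalerDr !scalerA [a * _]mulrC; abel.
Qed.

Lemma nrelK_B x v w y x' v' w' y' : nrelK x v w y -> nrelK x' v' w' y' ->
  nrelK (x - x') (v - v') (w - w') (y - y').
Proof.
move=> H H'; have := nrelK_comb (-1) H' H.
by rewrite !scaleN1r ![- _ + _]addrC.
Qed.

Lemma nrelK_uniq0 (s : R[i]) x y : 0 <= complex.Re s -> nrelK x 0 (s *: x) y ->
  0 < complex.Re s \/ x = 0 -> x = 0 /\ y = 0.
Proof.
move=> s0 H or; have := closed_loop_energy H.
rewrite rdot_scale hnorm0 expr0n mulr0 sub0r => h1.
have a0 := gain_y_gt0.
have h2 : 0 <= complex.Re s * hnorm x ^+ 2 by rewrite mulr_ge0// exprn_ge0.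
have h3 : 0 <= gain_y * hnorm y ^+ 2 by rewrite mulr_ge0 ?exprn_ge0// ltW.
have y2 : gain_y * hnorm y ^+ 2 = 0 by lra.
have x2 : complex.Re s * hnorm x ^+ 2 = 0 by lra.
have y0 : y = 0.
  apply: hnorm_eq0; apply/eqP; rewrite -sqrf_eq0; apply/eqP.
  by move/eqP: y2; rewrite mulf_eq0 gt_eqF//= => /eqP.
split => //; case: or => [sp|//].
apply: hnorm_eq0; apply/eqP; rewrite -sqrf_eq0.
by move/eqP: x2; rewrite mulf_eq0 gt_eqF.
Qed.

Lemma nrelK_zero w y : nrelK 0 0 w y -> w = 0 /\ y = 0.
Proof.
move=> H; have := closed_loop_energy H.
rewrite rdot0r hnorm0 expr0n mulr0 sub0r oppr_ge0 => h1.
have y0 : y = 0.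
  apply: hnorm_eq0; apply/eqP; rewrite -sqrf_eq0 eq_le exprn_ge0// andbT.
  by rewrite -(pmulr_rle0 _ gain_y_gt0).
split => //; move: H; rewrite /nrelK y0 scaler0 subr0 => H.
by have [_ -> _] := nrel_dom_inv nS H; exact: nA0.
Qed.

(** At the state x = (sI - A)^-1 B u one has w = s x, so pointwise passivity yields Re <u, G(s)u> >=
    -c |u|^2; the coercivity constant is 1 - kappa c = kappa delta. *)
Lemma feedback_invertible (s : R[i]) : 0 < complex.Re s ->
  exists P, bounded_inverse (fun u => u + kappa%:C *: nG S s u) P.
Proof.
move=> s0; have rs := right_half_plane s0.
apply: (@coercive_inverse _ _ _ (kappa * delta)).
- by apply: bopD; [exact: bop_id|apply: bopZ; exact: nG_bop].
- by rewrite mulr_gt0.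
move=> u; have H : nrel S (Rext S s (nB S u)) u (s *: Rext S s (nB S u)) (nG S s u).
  rewrite -[X in nrel S _ _ X _]subr0; apply/(nrel_res nS) => //.
  have [lr _] := res_bop rs.
  by rewrite (lin0 lr) (nC0 nS) !add0r.
have := passive_pointwise nS bE passive H.
rewrite rdot_scale rdotDr rdotDl rdotZl rdot_hnorm => h1.
have h2 : 0 <= complex.Re s * hnorm (Rext S s (nB S u)) ^+ 2.
  by rewrite mulr_ge0 ?exprn_ge0// ltW.
have h3 := Ec u; rewrite rdotC in h3; rewrite [rdot (nG S s u) u]rdotC.
have h4 : - c * hnorm u ^+ 2 <= rdot u (nG S s u) by lra.
have h5 := ler_wpM2l (ltW k0) h4.
have -> : kappa * delta = 1 - kappa * c by rewrite /delta mulrBr mulfV ?gt_eqF.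
lra.
Qed.

Lemma nrelK_solve (s : R[i]) f v : 0 < complex.Re s ->
  exists x y, nrelK x v (s *: x - f) y.
Proof.
move=> s0; have rs := right_half_plane s0.
have [P [_ P1 P2]] := feedback_invertible s0.
(* Eliminating u = v - kappa y from y = C (sI - A)^-1 f + G(s) u leaves (I + kappa G(s)) y = C (sI -
   A)^-1 f + G(s) v. *)
pose y := P (nC S (res S s f) + nG S s v).
have ey : y + kappa%:C *: nG S s y = nC S (res S s f) + nG S s v by exact: P2.
exists (res S s f + Rext S s (nB S (v - kappa%:C *: y))), y.
apply/(nrel_res nS) => //; split => //.
have [lG _] := nG_bop nS rs.
by rewrite (linB lG) (linZ lG) addrA -ey addrK.
Qed.

Lemma sqr_small_le (a b : R) : 0 <= a -> 0 <= b -> a ^+ 2 <= b ^+ 2 -> a <= b.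
Proof. by move=> a0 b0; rewrite ler_pXn2r. Qed.

(* The state of the closed loop is close to the one of the open loop at high
   frequencies. *)
Lemma closed_loop_dense e x : 0 < e ->
  exists2 z, (exists w y, nrelK z 0 w y) & hnorm (z - x) < e.
Proof.
move=> e0; have [x0 Dx0 hx0] := (denseP _).1 (node_dense nS) x (e / 2) (divr_gt0 e0 (ltr0Sn R 1)).
suff [z Kz hz] : exists2 z, (exists w y, nrelK z 0 w y) & hnorm (z - x0) <= e / 2.
  exists z => //; apply: le_lt_trans (hnorm_tri x0 _ _) _; lra.
have [_ _ [_ [_ [M HM]]] _ _] := nS.
set al := nalpha S in HM.
pose N := `|M| * hnorm (al *: x0 - nA S x0).
have N0 : 0 <= N by rewrite mulr_ge0.
pose K := N ^+ 2 / (4 * delta).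
have K0 : 0 <= K by rewrite divr_ge0 ?exprn_ge0// mulr_ge0// ltW.
(* The second term gives l |d| <= e / 4, from l^3 |d|^2 <= K; the third gives |l r - x0| <= |A x0| /
   l <= e / 4; the first keeps l positive. *)
pose l := 1 + K * (4 / e) ^+ 2 + hnorm (nA S x0) * (4 / e).
have e4 : 0 <= 4 / e by rewrite divr_ge0// ltW.
have l1 : 1 <= l.
  by rewrite /l -addrA lerDl addr_ge0// mulr_ge0// exprn_ge0.
have l0 : 0 < l by exact: lt_le_trans l1.
have sl : 0 < complex.Re l%:C by [].
have rl := right_half_plane sl.
have [xl [y Hxl]] := nrelK_solve x0 0 sl.
exists (l%:C *: xl).
  have H0 : nrelK 0 0 0 0.
    have := nrel_dom nS (nD0 nS); rewrite (nA0 nS) (nC0 nS) /nrelK.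
    by rewrite scaler0 subr0.
  have := nrelK_comb l%:C Hxl H0; rewrite scaler0 !addr0 => H.
  by exists (l%:C *: (l%:C *: xl - x0)), (l%:C *: y).
set u := 0 - kappa%:C *: y; set r := res S l%:C x0.
have [ex ey] := (nrel_res nS _ _ _ _ rl).1 Hxl.
rewrite -/u -/r in ex ey.
(* The deviation of the closed-loop resolvent from the open-loop one is driven by the feedback input
   u alone, so passivity applies to it. *)
pose d := xl - r.
have Hd : nrel S d u (l%:C *: d) (nG S l%:C u).
  rewrite -[X in nrel S _ _ X _]subr0; apply/(nrel_res nS) => //.
  have [lr _] := res_bop rl.
  by rewrite (lin0 lr) (nC0 nS) !add0r /d ex addrC addKr.
have D1 := res_dom x0 rl; rewrite -/r in D1.
have A1 := res_eq x0 rl; rewrite -/r in A1.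
have rle f : l * hnorm (res S l%:C f) <= hnorm f.
  have Df := res_dom f rl; set q := res S l%:C f in Df *.
  have := passive_pointwise nS bE passive (nrel_dom nS Df); rewrite rdot0l.
  rewrite (res_eq f rl) -/q rdotBl rdotZl rdot_hnorm => h1.
  have h2 := cauchy_schwarz f q.
  have [q0|q0] := eqVneq (hnorm q) 0; first by rewrite q0 mulr0.
  have qp : 0 < hnorm q by rewrite lt_def q0 hnorm_ge0.
  by rewrite -(ler_pM2r qp) -mulrA -expr2; lra.
(* C r decays like 1/l because x0 lies in the domain: alpha - A commutes with the resolvent at l,
   whose norm is at most 1/l. *)
have Cr : l * hnorm (nC S r) <= N.
  have e1 : al *: r - nA S r = res S l%:C (al *: x0 - nA S x0).
    have [lr _] := res_bop rl.
    have e2 : res S l%:C (l%:C *: x0 - nA S x0) = x0 by symmetry; apply/(res_iff _ _ rl).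
    have -> : al *: x0 - nA S x0 = (al - l%:C) *: x0 + (l%:C *: x0 - nA S x0).
      by rewrite scalerBl; abel.
    by rewrite lr e2 -/r A1 scalerBl; abel.
  have h1 := HM r D1; rewrite e1 in h1.
  have h2 := rle (al *: x0 - nA S x0).
  have h3 : hnorm (nC S r) <= `|M| * hnorm (res S l%:C (al *: x0 - nA S x0)).
    by apply: le_trans h1 _; rewrite ler_wpM2r// ler_norm.
  apply: le_trans (ler_wpM2l (ltW l0) h3) _.
  by rewrite mulrCA ler_wpM2l.
(* Here G(l) u = -u / kappa - C r, so the supply rate is at most |u||C r| - delta |u|^2; completing
   the square bounds it independently of u. *)
have dle : l * hnorm d ^+ 2 <= hnorm (nC S r) ^+ 2 / (4 * delta).
  have := passive_pointwise nS bE passive Hd.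
  have e1 : rdot (l%:C *: d) d = l * hnorm d ^+ 2 by rewrite rdotZl rdot_hnorm.
  rewrite e1 rdotDr => h1; apply: le_trans h1 _.
  have eG : nG S l%:C u = - (kappa^-1)%:C *: u - nC S r.
    have -> : nG S l%:C u = y - nC S r by rewrite ey; abel.
    congr (_ - _); rewrite /u sub0r scalerN scaleNr opprK scalerA -rmorphM mulVf ?gt_eqF//.
    by rewrite scale1r.
  have e2 : rdot u (nG S l%:C u) = - kappa^-1 * hnorm u ^+ 2 - rdot u (nC S r).
    by rewrite eG rdotBr -rmorphN rdotZr rdot_hnorm.
  have h3 := Ec u; rewrite rdotC in h3.
  have h4 := cauchy_schwarz_abs u (nC S r).
  have {h4} [h4 _] := andP (etrans (esym (ler_norml _ _)) h4).
  have h5 : hnorm u * hnorm (nC S r) - delta * hnorm u ^+ 2 <= hnorm (nC S r) ^+ 2 / (4 * delta).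
    rewrite -subr_ge0.
    have -> : hnorm (nC S r) ^+ 2 / (4 * delta) - (hnorm u * hnorm (nC S r) - delta * hnorm u ^+ 2)
      = delta * (hnorm u - hnorm (nC S r) / (2 * delta)) ^+ 2.
      by field; rewrite gt_eqF.
    by rewrite mulr_ge0 ?(ltW delta0)// sqr_ge0.
  rewrite e2; rewrite /delta in h5 *; lra.
have ld : l * hnorm d <= e / 4.
  apply: sqr_small_le; rewrite ?mulr_ge0// ?(ltW l0)// ?divr_ge0// ?(ltW e0)//.
  have h1 : l ^+ 3 * hnorm d ^+ 2 <= K.
    have -> : l ^+ 3 * hnorm d ^+ 2 = l ^+ 2 * (l * hnorm d ^+ 2) by ring.
    apply: le_trans (ler_wpM2l (exprn_ge0 2 (ltW l0)) dle) _.
    rewrite mulrA -exprMn /K ler_wpM2r ?invr_ge0 ?mulr_ge0 ?(ltW delta0)//.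
    by rewrite lerXn2r// ?nnegrE// mulr_ge0// ltW.
  have h2 : K <= l * (e / 4) ^+ 2.
    apply: (@le_trans _ _ (K * (4 / e) ^+ 2 * (e / 4) ^+ 2)).
      by rewrite le_eqVlt; apply/orP; left; apply/eqP; field; rewrite gt_eqF.
    rewrite ler_wpM2r ?sqr_ge0// /l addrAC lerDr addr_ge0//.
    by rewrite mulr_ge0.
  rewrite exprMn -(ler_pM2l l0) mulrA -exprS.
  exact: le_trans h1 h2.
have lr : hnorm (l%:C *: r - x0) <= e / 4.
  have -> : l%:C *: r - x0 = res S l%:C (nA S x0).
    have [lr _] := res_bop rl.
    have e2 : res S l%:C (l%:C *: x0 - nA S x0) = x0 by symmetry; apply/(res_iff _ _ rl).
    by rewrite -[X in _ - X]e2 (linB lr) (linZ lr) -/r; abel.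
  rewrite -(ler_pM2l l0); apply: le_trans (rle _) _.
  apply: (@le_trans _ _ (hnorm (nA S x0) * (4 / e) * (e / 4))).
    by rewrite le_eqVlt; apply/orP; left; apply/eqP; field; rewrite gt_eqF.
  rewrite ler_wpM2r ?divr_ge0 ?(ltW e0)// /l lerDr addr_ge0//.
  by rewrite mulr_ge0// exprn_ge0.
have -> : l%:C *: xl - x0 = l%:C *: d + (l%:C *: r - x0).
  by rewrite /d scalerBr; abel.
apply: le_trans (hnormD _ _) _; rewrite hnormZr gtr0_norm//; lra.
Qed.

Lemma closed_loop_realization : exists SK : node U X U, is_system_node SK /\
  forall x v w y, nrel SK x v w y <-> nrelK x v w y.
Proof.
pose DK x := exists w y, nrelK x 0 w y.
have /choice[AC HAC] : forall x, exists wy : X * U, DK x -> nrelK x 0 wy.1 wy.2.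
  move=> x; have [[w [y h]]|n] := pselect (DK x); last by exists (0, 0).
  by exists (w, y).
pose AK x := (AC x).1; pose CK x := (AC x).2.
have AKP x : DK x -> nrelK x 0 (AK x) (CK x) by exact: HAC.
have uniqK x v w y w' y' : nrelK x v w y -> nrelK x v w' y' -> w = w' /\ y = y'.
  move=> h h'; have := nrelK_B h h'; rewrite !subrr => /nrelK_zero[/subr0_eq -> /subr0_eq ->].
  by [].
have KE x w y : nrelK x 0 w y -> [/\ DK x, AK x = w & CK x = y].
  move=> h; have Dx : DK x by exists w, y.
  by have [-> ->] := uniqK _ _ _ _ _ _ (AKP _ Dx) h.
have combK (a : R[i]) x y : DK x -> DK y -> [/\ DK (a *: x + y),
    AK (a *: x + y) = a *: AK x + AK y & CK (a *: x + y) = a *: CK x + CK y].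
  move=> /AKP hx /AKP hy; apply: KE.
  by have := nrelK_comb a hx hy; rewrite scaler0 addr0.
have dissK x : DK x -> rdot (AK x) x <= - (gain_y * hnorm (CK x) ^+ 2).
  move=> /AKP /closed_loop_energy; rewrite hnorm0 expr0n mulr0 sub0r; exact.
have a0 := gain_y_gt0.
have dissK0 x : DK x -> rdot (AK x) x <= 0.
  move=> /dissK h; apply: le_trans h _.
  by rewrite oppr_le0 mulr_ge0 ?exprn_ge0// ltW.
have denseK : dense DK by apply/denseP => x e e0; exact: closed_loop_dense.
have [T gT] : exists T, generates DK AK T.
  apply: lumer_phillips => //.
    by move=> a x y hx hy; case: (combK a x y hx hy).
  move=> h h0 y.
  have sp : 0 < complex.Re (h^-1)%:C by rewrite /= invr_gt0.
  have [x [z hx]] := nrelK_solve ((h^-1)%:C *: y) 0 sp.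
  have [Dx Ax _] := KE _ _ _ hx; exists x; split => //.
  by rewrite Ax scalerBr !scalerA -rmorphM mulfV ?gt_eqF// !scale1r subKr.
have Tc := dissipative_contraction gT dissK0.
have rK (s : R[i]) : 0 < complex.Re s -> resolvent_set DK AK s.
  by apply: (shifted_resolvent gT) => x; rewrite expR0 mul1r Tc.
have r1 : resolvent_set DK AK 1 by apply: rK; exact: ltr01.
(* The reference point is alpha = 1, and X embedded by this resolvent serves as extrapolation space;
   B is then represented by (I - A^K)^-1 B^K. *)
pose RK := resolvent DK AK 1.
have bRK : bop RK by exact: resolvent_bop.
(* The relation at s = 1 with f = 0: the state is (I - A^K)^-1 B^K v and the output is G^K(1) v. *)
have /choice[BG HBG] : forall v, exists q : X * U, nrelK q.1 v q.1 q.2.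
  move=> v; have sp : 0 < complex.Re (1 : R[i]) by exact: ltr01.
  have [x [y h]] := nrelK_solve 0 v sp.
  by exists (x, y); move: h; rewrite scale1r subr0.
pose BK v := (BG v).1; pose G1 v := (BG v).2.
have BGP v : nrelK (BK v) v (BK v) (G1 v) by exact: HBG.
have uniq1 x x' v y y' : nrelK x v x y -> nrelK x' v x' y' -> x = x' /\ y = y'.
  move=> h h'; have H : nrelK (x - x') 0 (1 *: (x - x')) (y - y').
    by have := nrelK_B h h'; rewrite subrr scale1r.
  have [] := nrelK_uniq0 _ H; rewrite ?ler01//; first by left; exact: ltr01.
  by move=> /subr0_eq -> /subr0_eq ->.
have BGlin (a : R[i]) v v' : BK (a *: v + v') = a *: BK v + BK v' /\
    G1 (a *: v + v') = a *: G1 v + G1 v'.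
  exact: uniq1 (BGP _) (nrelK_comb a (BGP v) (BGP v')).
have b0 := gain_v_gt0.
(* Since w = x here, the energy estimate bounds the state and the output at once. *)
have BGle v : hnorm (BK v) ^+ 2 + gain_y * hnorm (G1 v) ^+ 2 <= gain_v * hnorm v ^+ 2.
  by have := closed_loop_energy (BGP v); rewrite rdot_hnorm; lra.
have sqle (a b x y : R) : 0 < a -> 0 <= b -> 0 <= x -> 0 <= y ->
    a * x ^+ 2 <= b * y ^+ 2 -> x <= Num.sqrt (b / a) * y.
  move=> ap b00 x0 y0 h; apply: sqr_small_le => //; first by rewrite mulr_ge0 ?sqrtr_ge0.
  rewrite exprMn sqr_sqrtr ?divr_ge0 ?(ltW ap)//.
  by rewrite mulrAC ler_pdivlMr// mulrC.
have bBK : bop BK.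
  split; first by move=> a v v'; case: (BGlin a v v').
  exists (Num.sqrt (gain_v / 1)); first exact: sqrtr_ge0.
  move=> v; apply: sqle => //; first exact: ltW.
  have := BGle v; have : 0 <= gain_y * hnorm (G1 v) ^+ 2.
    by rewrite mulr_ge0 ?exprn_ge0// ltW.
  lra.
have bG1 : bop G1.
  split; first by move=> a v v'; case: (BGlin a v v').
  exists (Num.sqrt (gain_v / gain_y)); first exact: sqrtr_ge0.
  move=> v; apply: sqle => //; first exact: ltW.
  have := BGle v; have := exprn_ge0 2 (hnorm_ge0 (BK v)); lra.
(* With f = x - A^K x, dissipation gives a |C^K x|^2 <= Re <f, x> - |x|^2 <= |f|^2 / 4, where a is
   [gain_y]. *)
have CKle x : DK x -> hnorm (CK x) <= Num.sqrt ((4^-1) / gain_y) * hnorm (1 *: x - AK x).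
  move=> Dx; apply: sqle => //.
  have h1 := dissK _ Dx; set f := 1 *: x - AK x.
  have eA : AK x = x - f by rewrite /f scale1r subKr.
  rewrite eA rdotBl rdot_hnorm in h1.
  have h2 := cauchy_schwarz f x.
  have h3 := sqr_ge0 (hnorm f / 2 - hnorm x); lra.
have CKc (a : R[i]) x y : DK x -> DK y -> CK (a *: x + y) = a *: CK x + CK y.
  by move=> hx hy; case: (combK a x y hx hy).
(* Forced by its value at 1 and by the transfer function identity. *)
pose GK (s : R[i]) v := G1 v + CK (resolvent DK AK s ((1 - s) *: BK v)).
(* The formula for [Rext] is available for system nodes only, while it is needed to prove that [SK]
   is one. The node with the same state space and zero B, C, G has the same [Rext] and is a system
   node trivially. *)
pose SK0 := @Node R U X U DK AK 1 X RK (fun=> 0) (fun=> 0) (fun _ _ => 0).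
pose SK := @Node R U X U DK AK 1 X RK BK CK GK.
have compl : is_completion SK.
  split; [by case: bRK| by []|].
  apply/denseP => x e e0; have [y Dy xy] := (denseP DK).1 denseK x e e0.
  exists y => //; exists (1 *: y - AK y) => //.
  by symmetry; apply/(resolvent_iff _ _ r1).
have bop0 (V W : normedModType R[i]) : bop (fun _ : V => 0 : W).
  split; first by move=> a x y; rewrite scaler0 addr0.
  by exists 0 => // x; rewrite hnorm0 mul0r.
have nSK0 : is_system_node SK0.
  split => //.
  - by exists T.
  - split; first by apply/bounded_opP; exact: bop0.
    split; first by move=> a x y _ _ /=; rewrite scaler0 addr0.
    by exists 0 => x _; rewrite hnorm0 mul0r.
  - by move=> s _; apply/bounded_opP; exact: bop0.
  - by move=> s b u _ _ /=; rewrite subrr.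
have RextK (s : R[i]) xi : resolvent_set DK AK s ->
    Rext SK s xi = xi + resolvent DK AK s ((1 - s) *: xi).
  move=> rs; have [L [Th [bL LK LE LA LR]]] := extensionsE nSK0.
  have Lid : L =1 id.
    apply: (bop_ext_dense bL (@bop_id _ _) denseK) => x Dx.
    have ex : x = RK (1 *: x - AK x) by apply/(resolvent_iff _ _ r1).
    by rewrite [in LHS]ex (LE (1 *: x - AK x)) /res /= -/RK -ex.
  have := LR s rs xi; rewrite Lid => e; rewrite -[LHS]/(Rext SK0 s xi) e.
  by have [lr _] := resolvent_bop rs; rewrite (linZ lr).
have nSK : is_system_node SK.
  split => //.
  - by exists T.
  - split; first exact/bounded_opP.
    split => //; by exists (Num.sqrt ((4^-1) / gain_y)).
  - move=> s rs; apply/bounded_opP/bopD => //.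
    have bC : bop (fun f => CK (resolvent DK AK s f)).
      exact: (graph_bounded_resolvent rs CKc CKle).
    by apply: (bop_comp (bopZ (1 - s) bBK) bC).
  - move=> s b u rs rb; rewrite RextK// RextK//= /GK.
    have Ds := (proj1 ((resolvent_iff (resolvent DK AK s ((1 - s) *: BK u)) _ rs).2 erefl)).
    have Db := (proj1 ((resolvent_iff (resolvent DK AK b ((1 - b) *: BK u)) _ rb).2 erefl)).
    set p := resolvent DK AK s _ in Ds *; set q := resolvent DK AK b _ in Db *.
    have -> : BK u + p - (BK u + q) = (-1) *: q + p by rewrite scaleN1r; abel.
    by rewrite CKc// scaleN1r; abel.
exists SK; split => // x v w y.
have iE : inputmap SK v = BK v.
  rewrite /inputmap RextK// subrr scale0r; have [lr _] := resolvent_bop r1.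
  by rewrite (lin0 lr) addr0.
have D0K : DK 0 by exact: (gen_dom0 gT).
have C0K : CK 0 = 0.
  by have := CKc (-1) _ _ D0K D0K; rewrite scaler0 addr0 scaleN1r addNr.
have GE : nG SK (nalpha SK) v = G1 v.
  rewrite /= /GK subrr scale0r; have [lr _] := resolvent_bop r1.
  by rewrite (lin0 lr) C0K addr0.
rewrite /nrel iE GE /=; split.
  move=> [Dx -> ->]; have := nrelK_comb 1 (AKP _ Dx) (BGP v).
  by rewrite !scale1r subrK add0r.
move=> h; have := nrelK_B h (BGP v); rewrite subrr => h'.
have [Dx -> ->] := KE _ _ _ h'; split => //; last by rewrite subrK.
by rewrite scale1r subrK.
Qed.

End ClosedLoop.

(** * Closed-loop nodes versus the feedback relation *)

Section FeedbackRelation.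
Variables (R : realType) (U X : hilbertType R) (S SK : node U X U) (kappa : R).
Hypotheses (nS : is_system_node S) (nSK : is_system_node SK).
Let K := fun u : U => - (kappa%:C *: u).

Lemma feedback_relation_closed_loop :
  (forall x v w y, nrel SK x v w y <-> nrelK S kappa x v w y) ->
  is_closed_loop S K SK.
Proof.
move=> HK; split => // s rs rsK.
have [lG _] := nG_bop nS rs; have bGK := nG_bop nSK rsK; have [lGK _] := bGK.
have [lr _] := res_bop rs; have [lrK _] := res_bop rsK.
pose F u := u + kappa%:C *: nG S s u.
(* I - kappa G^K inverts I + kappa G. This covers all common resolvent points, also those outside
   the half-plane of coercivity; and since K is scalar, the same inverse serves KG and GK. *)
pose P u := u - kappa%:C *: nG SK s u.
have Ksol v f y x : nrel SK x v (s *: x - f) y ->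
    x = res S s f + Rext S s (nB S (v - kappa%:C *: y)) /\
    y = nC S (res S s f) + nG S s (v - kappa%:C *: y).
  by move=> /HK /(nrel_res nS _ _ _ _ rs).
have Kinput v : nrel SK (Rext SK s (nB SK v)) v (s *: Rext SK s (nB SK v) - 0) (nG SK s v).
  by apply/(nrel_res nSK) => //; rewrite (lin0 lrK) (nC0 nSK) !add0r.
have GP v : nG SK s v = nG S s (P v).
  by have [_] := Ksol _ _ _ _ (Kinput v); rewrite (lin0 lr) (nC0 nS) add0r.
have FP v : F (P v) = v by rewrite /F -GP subrK.
have Flin : linear F.
  by move=> a u v; rewrite /F lG scalerDr !scalerA [kappa%:C * a]mulrC scalerDr scalerA; abel.
have F0 u : F u = 0 -> u = 0.
  move=> Fu; pose y := nG S s u; pose x := Rext S s (nB S u).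
  have eu : u = 0 - kappa%:C *: y by rewrite -Fu /F; abel.
  have : nrel SK x 0 (s *: x - 0) y.
    apply/HK; rewrite /nrelK -eu; apply/(nrel_res nS) => //.
    by rewrite (lin0 lr) (nC0 nS) !add0r.
  move=> /(nrel_res nSK _ _ _ _ rsK)[_].
  rewrite (lin0 lrK) (nC0 nSK) (lin0 lGK) addr0 => y0.
  by rewrite eu y0 scaler0 subr0.
have FI u v : F u = F v -> u = v.
  by move=> e; apply/subr0_eq/F0; rewrite (linB Flin) e subrr.
have PF u : P (F u) = u by apply: FI; rewrite FP.
have bP : bop P by apply: bopB; [exact: bop_id|exact: bopZ].
have inv : bounded_inverse F P by split => //; exact/bounded_opP.
exists P, P; split.
- split; first by have -> : (fun u => u - K (nG S s u)) = F by apply/funext => u; rewrite /K opprK.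
  have -> : (fun y => y - nG S s (K y)) = F.
    by apply/funext => y; rewrite /K (linN lG) opprK (linZ lG).
  exact: inv.
- exact: GP.
- move=> x0; have Dx := res_dom x0 rsK.
  have H : nrel SK (res SK s x0) 0 (s *: res SK s x0 - x0) (nC SK (res SK s x0)).
    by rewrite -(res_eq x0 rsK); exact: nrel_dom.
  have [e1 e2] := Ksol _ _ _ _ H; rewrite sub0r in e1 e2.
  have <- : nC SK (res SK s x0) = P (nC S (res S s x0)); last exact: e1.
  apply: FI; rewrite FP /F [X in X + _]e2 (linN lG) (linZ lG); abel.
- move=> x0; have H : nrel SK (res SK s x0) 0 (s *: res SK s x0 - x0) (nC SK (res SK s x0)).
    by rewrite -(res_eq x0 rsK); apply: nrel_dom => //; exact: res_dom.
  have [_ e2] := Ksol _ _ _ _ H; rewrite sub0r in e2.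
  apply: FI; rewrite FP /F [X in X + _]e2 (linN lG) (linZ lG); abel.
- move=> u; have [+ _] := Ksol _ _ _ _ (Kinput u).
  by rewrite (lin0 lr) add0r.
Qed.

(** The resolvent identities at one point s determine the resolvent, input, output and transfer
    operators of [SK] there, and by [nrel_res] these describe its whole relation. *)
Lemma closed_loop_feedback_relation (s : R[i]) : is_closed_loop S K SK ->
  rho S s -> rho SK s ->
  forall x v w y, nrel SK x v w y -> nrelK S kappa x v w y.
Proof.
move=> [_ HK] rs rsK x v w y H.
have [P [Q [[invP invQ] GP RP CP BP]]] := HK s rs rsK.
have [lG _] := nG_bop nS rs.
pose f := s *: x - w.
have ew : w = s *: x - f by rewrite subKr.
rewrite ew in H *; have [ex ey] := (nrel_res nSK _ _ _ _ rsK).1 H.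
have FQ z : Q z + kappa%:C *: nG S s (Q z) = z.
  by have [_ _ /(_ z)] := invQ; rewrite /K (linN lG) opprK (linZ lG).
have FP z : P z + kappa%:C *: nG S s (P z) = z.
  by have [_ _ /(_ z)] := invP; rewrite /K opprK.
have lB : linear (fun u => Rext S s (nB S u)).
  have bi := inputmap_bop nS; have [lb _] := bi.
  have [lr _] := res_bop rs.
  move=> a u u'; rewrite !(Rext_input nS)// lb lr !scalerDr !scalerA.
  by rewrite [(nalpha S - s) * a]mulrC; abel.
have [lr _] := res_bop rs.
set q := Q (nC S (res S s f)).
have eu : v - kappa%:C *: y = P v - kappa%:C *: q.
  rewrite ey CP GP -/q -[X in X - _ = _](FP v) scalerDr; abel.
apply/(nrel_res nS) => //; rewrite -/f eu; split.
  rewrite ex RP BP -/q /K (linN lB) (linZ lB) (linB lB) (linZ lB); abel.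
rewrite ey CP GP -/q (linB lG) (linZ lG) -[X in _ = X + _](FQ (nC S (res S s f))) -/q; abel.
Qed.

End FeedbackRelation.

(** * Strongly measurable functions *)

Section LowerIntegral.
Context d (T : measurableType d) (R : realType).
Variable mu : {measure set T -> \bar R}.
Local Open Scope ereal_scope.
Import HBNNSimple.

(* The integral of a nonnegative function that is not measurable is a lower
   integral; the two next lemmas need no measurability. *)
Lemma ge0_le_lower_integral (D1 D2 : set T) (f g : T -> \bar R) :
  (forall x, D1 x -> 0 <= f x) -> (forall x, D2 x -> 0 <= g x) ->
  (forall x, D1 x -> D2 x /\ f x <= g x) ->
  \int[mu]_(x in D1) f x <= \int[mu]_(x in D2) g x.
Proof.
move=> f0 g0 fg; rewrite !ge0_integralE//.
apply: le_ereal_sup => _ [h /= hf <-]; exists h => // x.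
apply: le_trans (hf x) _; rewrite !patchE.
case: ifPn => [/set_mem D1x|nD1].
  have [D2x fgx] := fg x D1x; by rewrite mem_set.
by case: ifPn => // /set_mem; exact: g0.
Qed.

Lemma ge0_lower_integral_negligible (D N : set T) (f : T -> \bar R) :
  (forall x, D x -> 0 <= f x) -> measurable N -> mu N = 0 ->
  \int[mu]_(x in D) f x = \int[mu]_(x in D `\` N) f x.
Proof.
move=> f0 mN N0; apply/eqP; rewrite eq_le; apply/andP; split; last first.
  by apply: ge0_le_lower_integral => // x [Dx _]; [exact: f0|split].
rewrite [leLHS]ge0_integralE//; apply/ge_ereal_sup => _ [h /= hf <-].
have -> : sintegral mu h = \int[mu]_x (h x)%:E.
  by rewrite integral_nnsfun// patch_setT.
rewrite (ge0_negligible_integral mN) //=; last 2 first.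
- by apply/measurable_EFinP.
- by move=> x _; rewrite lee_fin.
rewrite integral_mkcond [leRHS]integral_mkcond.
apply: ge0_le_lower_integral => [x _|x _|x _].
- by rewrite patchE; case: ifP => // _; rewrite lee_fin.
- by rewrite patchE; case: ifP => // /set_mem[Dx _]; exact: f0.
split => //; rewrite !patchE; case: ifPn => [/set_mem[_ nN]|_]; last first.
  by case: ifP => // /set_mem[Dx _]; exact: f0.
have := hf x; rewrite patchE; case: ifPn => [/set_mem Dx|nD hx].
  by rewrite mem_set.
case: ifPn => [/set_mem[Dx _]|_] //.
by move: nD; rewrite mem_set.
Qed.

End LowerIntegral.

Section StronglyMeasurable.
Variables (R : realType) (U : normedModType R[i]).
Local Notation mu := (@lebesgue_measure R).
Implicit Types (f g s : R -> U) (D E : set R).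

Definition simple s := finite_set (range s) /\ forall v, measurable (s @^-1` [set v]).

(** The set is a finite union of intersections of fibres, whatever h and B are. *)
Lemma simple_pair s s' (W : Type) (h : U -> U -> W) (B : set W) :
  simple s -> simple s' -> measurable [set t | B (h (s t) (s' t))].
Proof.
move=> [fs ms] [fs' ms'].
have -> : [set t | B (h (s t) (s' t))] =
   \bigcup_(p in [set p : U * U | (range s `*` range s') p /\ B (h p.1 p.2)])
     (s @^-1` [set p.1] `&` s' @^-1` [set p.2]).
  apply/seteqP; split => t /=.
    move=> Bt; exists (s t, s' t) => //=; split => //; split => /=; by exists t.
  by move=> [[p1 p2] /= [_ Bp] [-> ->]].
apply: fin_bigcup_measurable.
  apply: sub_finite_set (finite_setX fs fs') => p []//.
by move=> p _; exact: measurableI.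
Qed.

Lemma simple_comp2 s s' (h : U -> U -> U) : simple s -> simple s' ->
  simple (fun t => h (s t) (s' t)).
Proof.
move=> ss ss'; split; last by move=> v; exact: (simple_pair h [set v] ss ss').
apply: (@sub_finite_set _ _ ((fun p => h p.1 p.2) @` (range s `*` range s'))).
  by move=> _ [t _ <-]; exists (s t, s' t) => //; split; exists t.
by apply: finite_image; apply: finite_setX; [case: ss|case: ss'].
Qed.

Lemma simple_cst v : simple (fun=> v).
Proof.
split; first by apply: (@sub_finite_set _ _ [set v]) => // _ [t _ <-].
move=> w; have [->|nvw] := pselect (v = w).
  by rewrite (_ : _ @^-1` _ = setT)//; apply/seteqP; split.
by rewrite (_ : _ @^-1` _ = set0)//; apply/seteqP; split.
Qed.

Lemma simple_restrict s B : measurable B -> simple s ->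
  simple (fun t => if t \in B then s t else 0).
Proof.
move=> mB [fs ms]; split.
  apply: (@sub_finite_set _ _ (range s `|` [set 0])).
    by move=> _ [t _ <-]; case: ifP => _; [left; exists t|right].
  by rewrite finite_setU; split.
move=> v.
have -> : (fun t => if t \in B then s t else 0) @^-1` [set v] =
    (B `&` s @^-1` [set v]) `|` (~` B `&` [set t | 0 = v]).
  apply/seteqP; split => t /=.
    case: ifPn => [/set_mem Bt <-|nB <-]; [by left|right; split => //].
    by move=> Bt; move: nB; rewrite mem_set.
  move=> [[Bt <-]|[nB <-]]; first by rewrite mem_set.
  by case: ifPn => // /set_mem.
apply: measurableU; first exact: measurableI.
apply: measurableI; first exact: measurableC.
have [->|n] := pselect (0 = v); first by rewrite (_ : [set _ | _] = setT)//; apply/seteqP; split.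
by rewrite (_ : [set _ | _] = set0)//; apply/seteqP; split.
Qed.

(** Convergence at every point of E; exceptional null sets are removed from E instead, which leaves
    [L2sq] unchanged by [L2sq_negligible]. *)
Definition smeas E f := exists s : nat -> R -> U, (forall n, simple (s n)) /\
  forall t, E t -> (fun n => s n t) @ \oo --> f t.

Lemma smeas_simple E s : simple s -> smeas E s.
Proof. by move=> ss; exists (fun=> s); split => // t _; exact: cvg_cst. Qed.

Lemma smeas_sub E D f : D `<=` E -> smeas E f -> smeas D f.
Proof. by move=> DE [s [ss sf]]; exists s; split => // t /DE; exact: sf. Qed.

Lemma smeas_comb E (a : R[i]) f g : smeas E f -> smeas E g ->
  smeas E (fun t => a *: f t + g t).
Proof.
move=> [s [ss sf]] [s' [ss' sg]]; exists (fun n t => a *: s n t + s' n t); split.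
  by move=> n; apply: (simple_comp2 (fun x y => a *: x + y)).
by move=> t Et; apply: cvgD; [apply: cvgZr; exact: sf|exact: sg].
Qed.

Lemma smeas_B E f g : smeas E f -> smeas E g -> smeas E (fun t => f t - g t).
Proof.
move=> hf hg; have := smeas_comb (-1) hg hf.
by under eq_fun do rewrite scaleN1r addrC.
Qed.

Lemma smeas_measurable E f : measurable E -> smeas E f ->
  measurable_fun E (fun t => hnorm (f t)).
Proof.
move=> mE [s [ss sf]].
apply: (measurable_fun_cvg (h := fun n t => hnorm (s n t))).
  move=> n; apply: (measurable_funS measurableT) => //.
  move=> _ B mB; rewrite setTI.
  exact: (simple_pair (fun x _ => hnorm x) B (ss n) (ss n)).
by move=> t Et; apply: cvg_hnorm_cst; exact: sf.
Qed.

Lemma smeas_measurable_sq E f : measurable E -> smeas E f ->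
  measurable_fun E (fun t => (hnorm (f t) ^+ 2)%:E).
Proof.
move=> mE hf; apply/measurable_EFinP; apply: measurable_funX.
exact: smeas_measurable.
Qed.

Lemma L2sq_ge0 E f : (0 <= L2sq E f)%E.
Proof. by apply: integral_ge0 => t _; rewrite lee_fin exprn_ge0. Qed.

Lemma L2sq_sub D E f : D `<=` E -> (L2sq D f <= L2sq E f)%E.
Proof.
by move=> DE; apply: ge0_le_lower_integral => t Dt; rewrite ?lee_fin ?exprn_ge0//; split => //; exact: DE.
Qed.

Lemma L2sq_negligible E N f : measurable N -> mu N = 0%E -> L2sq E f = L2sq (E `\` N) f.
Proof.
move=> mN N0; apply: ge0_lower_integral_negligible => //.
by move=> t _; rewrite lee_fin exprn_ge0.
Qed.

Lemma hnorm_sq_tri f g h t :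
  hnorm (f t - h t) ^+ 2 <= 2 * hnorm (f t - g t) ^+ 2 + 2 * hnorm (g t - h t) ^+ 2.
Proof.
have h1 := hnorm_tri (g t) (f t) (h t).
have : hnorm (f t - h t) ^+ 2 <= (hnorm (f t - g t) + hnorm (g t - h t)) ^+ 2.
  by rewrite lerXn2r ?nnegrE ?addr_ge0.
have := sqr_ge0 (hnorm (f t - g t) - hnorm (g t - h t)); nra.
Qed.

Lemma L2sq_tri E f g h : measurable E -> smeas E f -> smeas E g -> smeas E h ->
  (L2sq E (fun t => f t - h t)%R <=
   2%:E * L2sq E (fun t => f t - g t)%R + 2%:E * L2sq E (fun t => g t - h t)%R)%E.
Proof.
move=> mE hf hg hh.
have mfg := smeas_measurable_sq mE (smeas_B hf hg).
have mgh := smeas_measurable_sq mE (smeas_B hg hh).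
rewrite /L2sq -!ge0_integralZl//; try by move=> t _; rewrite lee_fin exprn_ge0.
rewrite -ge0_integralD//; try by move=> t _; rewrite mule_ge0// lee_fin exprn_ge0.
- apply: ge0_le_lower_integral => t Et; rewrite -?EFinM -?EFinD ?lee_fin ?exprn_ge0//.
    by rewrite addr_ge0// mulr_ge0// exprn_ge0.
  by split => //; exact: hnorm_sq_tri.
- by apply: measurable_funeM.
- by apply: measurable_funeM.
Qed.

(** Supremum argument on [0, K]: near the supremum of the reachable end points f is almost constant,
    so a simple approximation extends beyond it unless K is reached. *)
Lemma simple_uniform f (K e : R) : {within `[0, +oo[, continuous f} -> 0 <= K -> 0 < e ->
  exists s, simple s /\ forall t, 0 <= t <= K -> hnorm (s t - f t) <= e.
Proof.
move=> /within_contP cf K0 e0.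
pose A := [set x : R | 0 <= x <= K /\ exists s, simple s /\
   forall t, 0 <= t <= x -> hnorm (s t - f t) <= e].
have A0 : A 0.
  split; first by rewrite lexx.
  exists (fun=> f 0); split; first exact: simple_cst.
  by move=> t /le_anti <-; rewrite subrr hnorm0 ltW.
have hA : has_sup A by split; [exists 0|exists K => x [/andP[]]].
have x0 : 0 <= sup A by apply: ub_le_sup => //; case: hA.
have [d d0 hd] := cf (sup A) x0 e e0.
have [x1 [/andP[x10 x1K] [s1 [ss1 hs1]]] xd] := sup_adherent d0 hA.
pose B := [set` `]-oo, x1] : interval R].
have mB : measurable B by exact: measurable_itv.
pose s t := (if t \in B then s1 t else 0) + (if t \in ~` B then f (sup A) else 0).
have ss : simple s.
  apply: (simple_comp2 (fun x y => x + y)); first exact: simple_restrict.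
  by apply: simple_restrict; [exact: measurableC|exact: simple_cst].
have BE (t : R) : (t \in B) = (t <= x1).
  by apply/idP/idP; rewrite inE /B /= in_itv.
have Am : A (Num.min K (sup A + d / 2)).
  have d2 : 0 < d / 2 by rewrite divr_gt0.
  split; first by rewrite le_min K0 addr_ge0 ?(ltW d2)//= ge_min lexx.
  exists s; split => // t /andP[t0]; rewrite le_min => /andP[tK td].
  rewrite /s in_setC BE; case: (leP t x1) => /= tx.
    by rewrite addr0; apply: hs1; rewrite t0.
  rewrite add0r hnormB; apply/ltW/hd => //.
  rewrite ltr_norml ltrBlDl; apply/andP; split; first by move: xd tx; lra.
  by apply: le_lt_trans td _; rewrite ltrD2l ltr_pdivrMr// ltr_pMr// ltr1n.
have mle : Num.min K (sup A + d / 2) <= sup A by apply: ub_le_sup => //; case: hA.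
have KA : K <= sup A + d / 2.
  move: mle; rewrite ge_min => /orP[h|]; last by lra.
  by apply: le_trans h _; rewrite lerDl divr_ge0// ltW.
move: Am; rewrite min_l// => -[_ [s' [ss' hs']]].
by exists s'.
Qed.

Lemma smeas_continuous f : {within `[0, +oo[, continuous f} -> smeas [set` `[0, +oo[] f.
Proof.
move=> cf.
have /choice[s hs] : forall n : nat, exists s, simple s /\
    forall t, 0 <= t <= n%:R -> hnorm (s t - f t) <= n.+1%:R^-1.
  by move=> n; apply: simple_uniform => //; rewrite invr_gt0.
exists s; split; first by move=> n; case: (hs n).
move=> t; rewrite itv0yE => t0.
apply: (@cvg_hnorm_le _ _ _ _ _ _ _ (fun n => n.+1%:R^-1)); last exact: (@cvg_harmonic R).
exists (Num.truncn t).+1 => // n /= tn.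
have [_] := hs n; apply; rewrite t0/=; apply/ltW.
by apply: lt_le_trans (truncnS_gt t) _; rewrite ler_nat.
Qed.

End StronglyMeasurable.

(** * Density of exponentials *)

Section ErealLimits.
Variable R : realType.
Local Open Scope ereal_scope.

Lemma ge0_cvge0P (f : nat -> \bar R) : (forall n, 0 <= f n) ->
  f @ \oo --> 0 <-> (forall e : R, (0 < e)%R -> \forall n \near \oo, f n <= e%:E).
Proof.
move=> f0; split.
  move=> /fine_cvgP[fin /cvgrPdist_lt H] e e0.
  near=> n; have fn : f n \is a fin_num by near: n.
  rewrite -(fineK fn) lee_fin; apply/ltW.
  have : (`|0 - fine (f n)| < e)%R by near: n; exact: H.
  by rewrite sub0r normrN; apply: le_lt_trans; exact: ler_norm.
move=> H; apply/fine_cvgP; split.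
  have := H 1%R ltr01; apply: filterS => n fn.
  by rewrite ge0_fin_numE//; apply: le_lt_trans fn _; rewrite ltry.
apply/cvgrPdist_le => e e0; have := H e e0; apply: filterS => n fn.
have fi : f n \is a fin_num.
  by rewrite ge0_fin_numE//; apply: le_lt_trans fn _; rewrite ltry.
rewrite sub0r normrN /= ger0_norm ?fine_ge0//.
by rewrite -lee_fin fineK.
Unshelve. all: by end_near. Qed.

End ErealLimits.

Section PowerBounds.
Variable R : realType.

Lemma bernoulli_ineq (y : R) (m : nat) : 0 <= y <= 1 -> 1 - m%:R * y <= (1 - y) ^+ m.
Proof.
move=> /andP[y0 y1]; elim: m => [|m IH]; first by rewrite mul0r subr0 expr0.
rewrite exprS -natr1; apply: (@le_trans _ _ ((1 - y) * (1 - m%:R * y))).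
  have : 0 <= m%:R :> R by [].
  nra.
by rewrite ler_wpM2l// subr_ge0.
Qed.

Lemma expR_harmonic (t : R) : (fun n => expR (n.+1%:R^-1 * t)) @ \oo --> (1 : R).
Proof.
have z : (fun n => n.+1%:R^-1 * t) @ \oo --> (0 : R).
  by rewrite -(mul0r t); apply: cvgMl; exact: (@cvg_harmonic R).
have h : expR x @[x --> (0 : R)] --> (1 : R).
  by rewrite -(@expR0 R); exact: continuous_expR.
have := cvg_comp _ _ z h; exact.
Qed.

Lemma power_decay (y : R) (m : nat) : 0 <= y <= 1 -> (1 - y) ^+ m * (1 + m%:R * y) <= 1.
Proof.
move=> /andP[y0 y1]; elim: m => [|m IH]; first by rewrite expr0 mul0r addr0 mul1r.
rewrite exprS; apply: le_trans IH.
have h : 0 <= (1 - y) ^+ m by rewrite exprn_ge0// subr_ge0.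
rewrite mulrAC mulrC ler_wpM2l// -natr1.
have : 0 <= m%:R :> R by [].
nra.
Qed.

(* With m close to th^-n, (1 - x^n)^m tends to 1 for x < th and to 0 for x > th, so
   that polynomials in exp(t) approximate indicators of half-lines. *)
Definition stepn (th : R) (n : nat) := Num.truncn (th^-1 ^+ n).

Lemma step_below (th x : R) (n : nat) : 0 < th -> 0 <= x -> x <= 1 ->
  0 <= 1 - (1 - x ^+ n) ^+ stepn th n <= (x / th) ^+ n.
Proof.
move=> th0 x0 x1; have y01 : 0 <= x ^+ n <= 1 by rewrite exprn_ge0//= exprn_ile1.
apply/andP; split.
  by rewrite subr_ge0 exprn_ile1// ?subr_ge0 ?gerBl; case/andP: y01.
have := bernoulli_ineq (stepn th n) y01.
have : (stepn th n)%:R * x ^+ n <= (x / th) ^+ n.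
  rewrite exprMn mulrC ler_wpM2l ?exprn_ge0// truncn_le.
  by rewrite exprn_ge0// invr_ge0 ltW.
lra.
Qed.

Lemma step_above (th x : R) (n : nat) : 0 < th -> 0 < x -> x <= 1 ->
  0 <= (1 - x ^+ n) ^+ stepn th n <= (th / x) ^+ n.
Proof.
move=> th0 x0 x1; have y01 : 0 <= x ^+ n <= 1.
  by rewrite exprn_ge0 ?(ltW x0)//= exprn_ile1// ltW.
have yge : 0 <= (1 - x ^+ n) ^+ stepn th n.
  by rewrite exprn_ge0// subr_ge0; case/andP: y01.
rewrite yge/=.
have h1 := power_decay (stepn th n) y01.
(* Truncation gives th^-n < m + 1 for m = [stepn th n]; the additional x^n is absorbed by 1. *)
have h2 : (x / th) ^+ n <= 1 + (stepn th n)%:R * x ^+ n.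
  have := truncnS_gt (th^-1 ^+ n); rewrite -/(stepn th n) -natr1 => /ltW h.
  have := ler_wpM2r (proj1 (andP y01)) h.
  rewrite mulrDl mul1r exprMn [x ^+ n * _]mulrC.
  by case/andP: y01; lra.
have xt0 : 0 < (x / th) ^+ n by rewrite exprn_gt0// divr_gt0.
have -> : (th / x) ^+ n = ((x / th) ^+ n)^-1 by rewrite -exprVn invf_div.
rewrite -[leRHS]mul1r ler_pdivlMr//.
by apply: le_trans h1; rewrite ler_wpM2l.
Qed.

Lemma expr_cvg0 (r : R) : 0 <= r < 1 -> (fun n => r ^+ n) @ \oo --> (0 : R).
Proof. by move=> /andP[r0 r1]; apply: cvg_expr; rewrite ger0_norm. Qed.

Lemma step_cvg0 (th x : R) : 0 < th -> 0 <= x -> x <= 1 -> x < th ->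
  (fun n => 1 - (1 - x ^+ n) ^+ stepn th n) @ \oo --> (0 : R).
Proof.
move=> th0 x0 x1 xth.
have h : (fun n => (x / th) ^+ n) @ \oo --> (0 : R).
  by apply: expr_cvg0; rewrite divr_ge0 ?(ltW th0)//= ltr_pdivrMr// mul1r.
have h0 : (fun n : nat => 0 : R) @ \oo --> (0 : R) by exact: cvg_cst.
apply: (squeeze_cvgr _ h0 h).
by apply: nearW => n; exact: step_below.
Qed.

Lemma step_cvg1 (th x : R) : 0 < th -> 0 < x -> x <= 1 -> th < x ->
  (fun n => 1 - (1 - x ^+ n) ^+ stepn th n) @ \oo --> (1 : R).
Proof.
move=> th0 x0 x1 xth.
have h : (fun n => (th / x) ^+ n) @ \oo --> (0 : R).
  by apply: expr_cvg0; rewrite divr_ge0 ?(ltW th0) ?(ltW x0)//= ltr_pdivrMr// mul1r.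
have h0 : (fun n : nat => 0 : R) @ \oo --> (0 : R) by exact: cvg_cst.
have h1 : (fun n => (1 - x ^+ n) ^+ stepn th n) @ \oo --> (0 : R).
  apply: (squeeze_cvgr _ h0 h).
  by apply: nearW => n; exact: step_above.
by rewrite -[X in _ --> X]subr0; apply: cvgB => //; exact: cvg_cst.
Qed.

Lemma cvg_scale_vector (V : normedModType R[i]) (f : nat -> R) (c : R) (w : V) :
  f @ \oo --> c -> (fun n => (f n)%:C *: w) @ \oo --> c%:C *: w.
Proof.
move=> h; apply: (@cvg_hnorm_le _ _ _ _ _ _ _ (fun n => `|f n - c| * hnorm w)).
  by apply: nearW => n; rewrite -scalerBl -rmorphB hnormZr.
have h' : (fun n => f n - c) @ \oo --> (0 : R).
  by rewrite -(subrr c); apply: cvgB => //; exact: cvg_cst.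
have h2 : (fun n => `|f n - c|) @ \oo --> (0 : R).
  by rewrite -(@normr0 _ R); apply: cvg_norm.
have h3 : (fun=> hnorm w) @ \oo --> hnorm w by exact: cvg_cst.
by rewrite -(mul0r (hnorm w)); apply: cvgM.
Qed.

End PowerBounds.

Section Density.
Variables (R : realType) (U : normedModType R[i]) (adm : (R -> U) -> Prop).
Hypothesis adm_comb : forall (a : R[i]) u v, adm u -> adm v ->
  adm (fun t => a *: u t + v t).
Hypothesis adm_exp : forall (l : R) (w : U), 0 < l -> adm (fun t => (expR (l * t))%:C *: w).
Hypothesis adm_cont : forall u, adm u -> {within `[0, +oo[, continuous u}.
Local Notation mu := (@lebesgue_measure R).

Lemma adm0 : adm (fun=> 0).
Proof.
by have := adm_exp 0 (@ltr01 R); under eq_fun do rewrite scaler0.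
Qed.

Lemma adm_sum (n : nat) (f : 'I_n -> R -> U) : (forall i, adm (f i)) ->
  adm (fun t => \sum_(i < n) f i t).
Proof.
elim: n f => [|n IH] f hf; first by under eq_fun do rewrite big_ord0; exact: adm0.
under eq_fun do rewrite big_ord_recl -[f _ _]scale1r.
apply: (adm_comb 1); first exact: hf.
by apply: (IH (fun i => f (lift ord0 i))) => i; exact: hf.
Qed.

(** The factor e^{lt} makes all exponents positive, including that of the constant term; the shift
    by tau brings e^{t - tau} into ]0, 1] on [0, tau]. *)
Lemma adm_poly (l tau : R) (p : {poly R}) (w : U) : 0 < l ->
  adm (fun t => (expR (l * t) * p.[expR (t - tau)])%:C *: w).
Proof.
move=> l0.
have -> : (fun t => (expR (l * t) * p.[expR (t - tau)])%:C *: w) =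
   (fun t => \sum_(i < size p) ((p`_i * expR (- (i%:R * tau)))%:C *:
       ((expR ((l + i%:R) * t))%:C *: w) + 0)).
  apply/funext => t; rewrite horner_coef mulr_sumr rmorph_sum scaler_suml.
  apply: eq_bigr => i _; rewrite addr0 scalerA -rmorphM; congr (_%:C *: _).
  rewrite -expRM_natl mulrBr expRD mulrDl expRD; ring.
apply: adm_sum => i; apply: adm_comb; last exact: adm0.
by apply: adm_exp; rewrite ltr_pwDl.
Qed.

Variables (tau : R) (E : set R).
Hypotheses (mE : measurable E) (Etau : E `<=` [set` `[0, tau]]).

Let E0 t : E t -> 0 <= t. Proof. by move=> /Etau; rewrite /= in_itv/= => /andP[]. Qed.
Let E1 t : E t -> t <= tau. Proof. by move=> /Etau; rewrite /= in_itv/= => /andP[]. Qed.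

Let muE : (mu E < +oo)%E.
Proof.
apply: (@le_lt_trans _ _ (mu [set` `[0, tau]])).
  by apply: le_measure; rewrite ?inE.
by rewrite lebesgue_measure_itv /=; case: ifP => _; rewrite ?sube0 ltry.
Qed.

Lemma adm_smeas u : adm u -> smeas E u.
Proof.
move=> /adm_cont/smeas_continuous; apply: smeas_sub => t Et.
by rewrite itv0yE; exact: E0.
Qed.

Definition L2cl (f : R -> U) := forall e : R, 0 < e ->
  exists2 u, adm u & (L2sq E (fun t => u t - f t)%R <= e%:E)%E.

Lemma L2sq0 (f : R -> U) : (forall t, E t -> f t = 0) -> L2sq E f = 0%E.
Proof.
move=> f0; rewrite /L2sq; apply: integral0_eq => t Et.
by rewrite f0// hnorm0 expr0n.
Qed.

Lemma L2cl_ext f g : (forall t, E t -> f t = g t) -> L2cl f -> L2cl g.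
Proof.
move=> fg hf e /hf[u au ue]; exists u => //; apply: le_trans ue.
apply: ge0_le_lower_integral => t Et; rewrite ?lee_fin ?exprn_ge0//.
by split => //; rewrite fg.
Qed.

Lemma L2cl_adm u : adm u -> L2cl u.
Proof.
move=> au e e0; exists u => //; rewrite L2sq0 ?lee_fin ?ltW//.
by move=> t _; rewrite subrr.
Qed.

Lemma L2cl_lim f : smeas E f -> (forall e : R, 0 < e -> exists g,
  [/\ L2cl g, smeas E g & (L2sq E (fun t => g t - f t)%R <= e%:E)%E]) -> L2cl f.
Proof.
move=> mf H e e0; have e4 : 0 < e / 4 by rewrite divr_gt0.
have [g [cg mg gf]] := H _ e4; have [u au ug] := cg _ e4.
exists u => //; apply: le_trans (L2sq_tri mE (adm_smeas au) mg mf) _.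
apply: (@le_trans _ _ (2%:E * (e / 4)%:E + 2%:E * (e / 4)%:E)%E).
  by apply: leeD; apply: lee_wpmul2l; rewrite ?lee_fin.
by rewrite -!EFinM -EFinD lee_fin; lra.
Qed.

Lemma L2cl_comb (a : R[i]) f g : smeas E f -> smeas E g -> L2cl f -> L2cl g ->
  L2cl (fun t => a *: f t + g t).
Proof.
move=> mf mg cf cg e e0.
pose k := 2 * (cabs a ^+ 2 + 1).
have k0 : 0 < k by rewrite mulr_gt0// ltr_wpDl// exprn_ge0// cabs_ge0.
have [u au uf] := cf _ (divr_gt0 e0 (mulr_gt0 (ltr0Sn R 1) k0)).
have [v av vg] := cg _ (divr_gt0 e0 (ltr0Sn R 3)).
exists (fun t => a *: u t + v t); first exact: adm_comb.
have m1 := smeas_measurable_sq mE (smeas_B (adm_smeas au) mf).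
have m2 := smeas_measurable_sq mE (smeas_B (adm_smeas av) mg).
apply: (@le_trans _ _ (k%:E * L2sq E (fun t => u t - f t)%R + 2%:E * L2sq E (fun t => v t - g t)%R)%E).
  rewrite /L2sq -!ge0_integralZl ?lee_fin ?(ltW k0)//; try by move=> t _; rewrite lee_fin exprn_ge0.
  rewrite -ge0_integralD//; try by move=> t _; rewrite mule_ge0// lee_fin ?exprn_ge0// ltW.
  - apply: ge0_le_lower_integral => t Et; rewrite -?EFinM -?EFinD ?lee_fin ?exprn_ge0//.
      by rewrite addr_ge0// mulr_ge0// ?exprn_ge0// ltW.
    split => //.
    have -> : a *: u t + v t - (a *: f t + g t) = a *: (u t - f t) + (v t - g t).
      by rewrite scalerBr; abel.
    set p := u t - f t; set q := v t - g t.
    have h1 : hnorm (a *: p + q) ^+ 2 <= (cabs a * hnorm p + hnorm q) ^+ 2.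
      rewrite lerXn2r ?nnegrE ?addr_ge0 ?mulr_ge0 ?cabs_ge0//.
      by rewrite -hnormZ; exact: hnormD.
    apply: le_trans h1 _; rewrite /k.
    have := sqr_ge0 (cabs a * hnorm p - hnorm q).
    have := sqr_ge0 (hnorm p); nra.
  - by apply: measurable_funeM.
  - by apply: measurable_funeM.
apply: (@le_trans _ _ (k%:E * (e / (2 * k))%:E + 2%:E * (e / 4)%:E)%E).
  by apply: leeD; apply: lee_wpmul2l; rewrite ?lee_fin// ltW.
rewrite -!EFinM -EFinD lee_fin.
have -> : k * (e / (2 * k)) = e / 2 by field; rewrite gt_eqF.
by lra.
Qed.

Lemma integrable_cst (c : R) : mu.-integrable E (fun=> c%:E).
Proof.
apply/integrableP; split; first exact: measurable_cst.
under eq_integral do rewrite abse_EFin.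
by rewrite integral_cst// lte_mul_pinfty// lee_fin.
Qed.

Lemma L2sq_dominated (u : nat -> R -> U) f (G : R -> R) :
  (forall n, smeas E (u n)) -> smeas E f -> mu.-integrable E (EFin \o G) ->
  (forall n t, E t -> hnorm (u n t - f t) ^+ 2 <= G t) ->
  {ae mu, forall t, E t -> (fun n => u n t) @ \oo --> f t} ->
  forall e : R, 0 < e -> exists n, (L2sq E (fun t => u n t - f t)%R <= e%:E)%E.
Proof.
move=> mu_ mf iG uG uf e e0.
have [|||||_ _] := @dominated_convergence _ _ R mu E mE
  (fun n t => (hnorm (u n t - f t) ^+ 2)%:E) (cst 0%E) (EFin \o G).
- by move=> n; apply: smeas_measurable_sq => //; exact: smeas_B.
- exact: measurable_cst.
- move: uf => [N [mN N0 sub]]; exists N; split => // t; apply: contra_notP => nN Et.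
  have H : E t -> (fun n => u n t) @ \oo --> f t by apply: contra_notP nN => /sub.
  have /cvg_hnormP h := H Et.
  apply/ge0_cvge0P => [n|e1 e10]; first by rewrite lee_fin exprn_ge0.
  have m0 : 0 < Num.min 1 e1 by rewrite lt_min ltr01.
  apply: filterS (h _ m0) => n; rewrite lt_min => /andP[l1 l2].
  rewrite lee_fin expr2; apply: le_trans (ltW l2).
  by rewrite ler_piMr// ltW.
- exact: iG.
- by apply: aeW => t n Et; rewrite gee0_abs ?lee_fin ?exprn_ge0//; exact: uG.
rewrite integral0 => /ge0_cvge0P h.
have [|N _ hN] := h _ _ e0; first by move=> n; exact: L2sq_ge0.
by exists N; exact: (hN N (leqnn N)).
Qed.

Lemma L2cl_dominated (u : nat -> R -> U) f (G : R -> R) :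
  (forall n, L2cl (u n)) ->
  (forall n, smeas E (u n)) -> smeas E f -> mu.-integrable E (EFin \o G) ->
  (forall n t, E t -> hnorm (u n t - f t) ^+ 2 <= G t) ->
  {ae mu, forall t, E t -> (fun n => u n t) @ \oo --> f t} -> L2cl f.
Proof.
move=> cu mu_ mf iG uG uf; apply: L2cl_lim => // e e0.
have [n hn] := L2sq_dominated mu_ mf iG uG uf e0.
by exists (u n).
Qed.

Definition ind (A : set R) (w : U) (t : R) : U := if t \in A then w else 0.

Lemma ind_simple A w : measurable A -> simple (ind A w).
Proof. by move=> mA; apply: simple_restrict => //; exact: simple_cst. Qed.

Lemma ind_smeas A w : measurable A -> smeas E (ind A w).
Proof. by move=> mA; apply: smeas_simple; exact: ind_simple. Qed.

Lemma L2cl0 : L2cl (fun=> 0). Proof. exact: L2cl_adm adm0. Qed.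

Lemma L2cl_itv (a : R) (w : U) : L2cl (ind [set` `]a, +oo[] w).
Proof.
have inE' (t : R) : (t \in [set` `]a, +oo[]) = (a < t).
  by apply/idP/idP; rewrite inE /= in_itv/= andbT.
have mI : measurable [set` `]a, +oo[ : interval R] by exact: measurable_itv.
have [ta|at_] := leP tau a.
  apply: L2cl_ext L2cl0 => t Et; rewrite /ind inE' ltNge.
  by rewrite (le_trans (E1 Et) ta).
pose th := expR (a - tau); have th0 : 0 < th by exact: expR_gt0.
(* At x = e^{t - tau} these polynomials tend to the indicator of x > th, that is, of t > a. The
   exponential factor in [u] has rate 1/(n+1) and tends to 1. *)
pose p n : {poly R} := 1 - (1 - 'X^n) ^+ stepn th n.
pose u n (t : R) := (expR (n.+1%:R^-1 * t) * (p n).[expR (t - tau)])%:C *: w.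
have pE n x : (p n).[x] = 1 - (1 - x ^+ n) ^+ stepn th n.
  by rewrite /p !hornerE.
have au n : adm (u n) by apply: adm_poly; rewrite invr_gt0.
have x01 t : E t -> 0 < expR (t - tau) <= 1.
  by move=> /E1 t1; rewrite expR_gt0 -[leRHS]expR0 ler_expR subr_le0.
have pb n t : E t -> 0 <= (p n).[expR (t - tau)] <= 1.
  move=> Et; rewrite pE; have /andP[x0 x1] := x01 t Et.
  have y01 : 0 <= expR (t - tau) ^+ n <= 1 by rewrite exprn_ge0 ?(ltW x0)//= exprn_ile1// ltW.
  have q0 : 0 <= (1 - expR (t - tau) ^+ n) ^+ stepn th n.
    by rewrite exprn_ge0// subr_ge0; case/andP: y01.
  rewrite subr_ge0 gerBl q0 andbT exprn_ile1// ?subr_ge0 ?gerBl; case/andP: y01 => //.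
have ex n t : E t -> 0 <= expR (n.+1%:R^-1 * t) <= expR tau.
  move=> Et; rewrite expR_ge0/= ler_expR.
  apply: le_trans (E1 Et); rewrite ler_piMl ?E0//.
  by rewrite invf_le1// ler1n.
pose C := (expR tau + 1) * hnorm w.
apply: (@L2cl_dominated u _ (fun=> C ^+ 2)).
- by move=> n; exact: L2cl_adm.
- by move=> n; exact: adm_smeas.
- exact: ind_smeas.
- exact: integrable_cst.
- move=> n t Et; rewrite lerXn2r ?nnegrE// ?mulr_ge0 ?addr_ge0 ?expR_ge0//.
  apply: le_trans (hnormDB _ _) _; rewrite /C mulrDl lerD//.
    rewrite hnormZr ler_wpM2r//.
    have /andP[e0' e1'] := ex n t Et; have /andP[p0' p1'] := pb n t Et.
    rewrite ger0_norm ?mulr_ge0//; apply: le_trans e1'.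
    by rewrite ler_piMr.
  rewrite mul1r /ind; case: ifP => _ //; by rewrite hnorm0.
(* At t = a the argument equals the threshold, where neither step estimate applies. *)
exists [set a]; split; [exact: measurable_set1|exact: lebesgue_measure_set1|].
move=> t /=; apply: contra_notP => ta Et.
have e1 : (fun n => expR (n.+1%:R^-1 * t)) @ \oo --> (1 : R) by exact: expR_harmonic.
have /andP[x0 x1] := x01 t Et.
have scal (c : R) : (fun n => expR (n.+1%:R^-1 * t) * (p n).[expR (t - tau)]) @ \oo --> c ->
    (fun n => u n t) @ \oo --> c%:C *: w.
  by move=> h; exact: cvg_scale_vector.
rewrite /ind inE'; case: (ltgtP t a) => [tlt|tgt|//].
- rewrite -[0](scale0r w); apply: (scal 0); rewrite -(mul1r 0).
  apply: (cvgM e1); under eq_fun do rewrite pE.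
  by apply: step_cvg0; rewrite ?(ltW x0)// ltr_expR ltrD2r.
- rewrite -[w in _ --> w](scale1r w); apply: (scal 1); rewrite -[X in _ --> X](mul1r 1).
  apply: (cvgM e1); under eq_fun do rewrite pE.
  by apply: step_cvg1 => //; rewrite ltr_expR ltrD2r.
Qed.

(** Half-lines form a pi-system generating the Borel sets; linearity handles complements, and
    dominated convergence handles disjoint countable unions. *)
Lemma L2cl_ind (A : set R) (w : U) : measurable A -> L2cl (ind A w).
Proof.
move=> mA.
have clT : L2cl (ind setT w).
  apply: L2cl_ext (L2cl_itv (-1) w) => t Et; rewrite /ind in_setT mem_set//=.
  by rewrite in_itv/= andbT; apply: lt_le_trans (E0 Et); rewrite ltrN10.
apply: (@dynkin_induction _ _ (@RGenOInfty.G R) (fun A => L2cl (ind A w))) => //.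
- exact: RGenOInfty.measurableE.
- move=> _ _ [x ->] [y ->]; exists (Num.max x y).
  by apply/seteqP; split => t /=; rewrite !in_itv/= !andbT gt_max => /andP.
- by move=> _ [x ->]; exact: L2cl_itv.
- move=> B mB cB; apply: (L2cl_ext (f := fun t => (-1) *: ind B w t + ind setT w t)).
    move=> t Et; rewrite /ind in_setT in_setC; case: (t \in B) => /=.
      by rewrite scaleN1r addNr.
    by rewrite scaler0 add0r.
  by apply: L2cl_comb => //; exact: ind_smeas.
- move=> F mF tF cF.
  pose G n := \bigcup_(k in `I_n) F k.
  have mG n : measurable (G n) by apply: bigcup_measurable.
  have cG n : L2cl (ind (G n) w).
    elim: n => [|n IH].
      apply: L2cl_ext L2cl0 => t _; rewrite /ind /G memNset//.
      by move=> [].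
    apply: (L2cl_ext (f := fun t => 1 *: ind (G n) w t + ind (F n) w t)).
      move=> t _; rewrite scale1r /ind; case: (pselect (F n t)) => Fn.
        have nG : ~ G n t.
          move=> [k /= kn Fk]; have := tF k n I I; rewrite /= => H.
          have kne : k = n by apply: H; exists t.
          by move: kn; rewrite kne ltnn.
        rewrite (memNset nG) (mem_set Fn) add0r mem_set//.
        by exists n => /=.
      rewrite [t \in F n]memNset// addr0.
      case: (pselect (G n t)) => Gn.
        rewrite !mem_set//; move: Gn => [k /= kn Fk]; exists k => //=.
        exact: ltnW.
      rewrite !memNset// => -[k /=]; rewrite ltnS leq_eqVlt => /predU1P[->//|kn Fk].
      by apply: Gn; exists k.
    by apply: L2cl_comb => //; exact: ind_smeas.
  have mU : measurable (\bigcup_k F k) by apply: bigcup_measurable.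
  apply: (@L2cl_dominated (fun n => ind (G n) w) _ (fun=> (2 * hnorm w) ^+ 2)) => //.
  + by move=> n; exact: ind_smeas.
  + exact: ind_smeas.
  + exact: integrable_cst.
  + move=> n t Et; rewrite lerXn2r ?nnegrE// ?mulr_ge0//.
    apply: le_trans (hnormDB _ _) _; rewrite mulr_natl mulr2n.
    by apply: lerD; rewrite /ind; case: ifP => _ //; rewrite hnorm0.
  + apply: aeW => t Et; case: (pselect ((\bigcup_k F k) t)) => Ft.
      rewrite [X in _ --> X]/ind mem_set//; move: Ft => [k _ Fk].
      apply: cvg_near_cst; exists k.+1 => // n /= kn.
      by rewrite /ind mem_set//; exists k.
    rewrite [X in _ --> X]/ind memNset//.
    apply: cvg_near_cst; apply: nearW => n.
    by rewrite /ind memNset// => -[k _ Fk]; apply: Ft; exists k.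
- have H := RGenOInfty.measurableE R; move: mA; by rewrite [X in X A -> _]H.
Qed.

Lemma L2cl_simple s : simple s -> L2cl s.
Proof.
move=> ss; have [/finite_seqP[r rs] _] := ss.
have : forall t, s t = 0 \/ s t \in r.
  move=> t; right; have : range s (s t) by exists t.
  by rewrite rs.
elim: r s ss {rs} => [|v r IH] s ss sr.
  by apply: L2cl_ext L2cl0 => t _; case: (sr t).
have ms := ss.2 v.
pose s1 t := if t \in ~` (s @^-1` [set v]) then s t else 0.
have ss1 : simple s1 by apply: simple_restrict => //; exact: measurableC.
apply: (L2cl_ext (f := fun t => 1 *: ind (s @^-1` [set v]) v t + s1 t)).
  move=> t _; rewrite scale1r /ind /s1 in_setC; case: ifPn => [/set_mem /= ->|_] /=.
    by rewrite addr0.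
  by rewrite add0r.
apply: L2cl_comb; [exact: ind_smeas|exact: smeas_simple|exact: L2cl_ind|apply: IH => // t].
rewrite /s1 in_setC; case: ifPn => /= [|nv]; last by left.
move=> /negP nv; case: (sr t) => [|]; first by left.
rewrite in_cons => /predU1P[sv|]; last by right.
by case: nv; apply: mem_set.
Qed.

Lemma L2cl_L2 v : smeas E v -> (L2sq E v < +oo)%E -> L2cl v.
Proof.
move=> mv fv; have [s [ss sv]] := mv.
have mhv := smeas_measurable mE mv.
(* Cutting s(n) off where it exceeds |v| + 1 provides a dominating function; at each point the cut
   is inactive for large n. *)
pose B n := [set t | E t /\ hnorm (s n t) <= hnorm (v t) + 1].
have mB n : measurable (B n).
  have -> : B n = E `&` [set t | hnorm (s n t) <= hnorm (v t) + 1].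
    by apply/seteqP; split => t [].
  apply: (emeasurable_fun_le mE (f := fun t => (hnorm (s n t))%:E)
     (g := fun t => (hnorm (v t) + 1)%:E)) => //.
    by apply/measurable_EFinP; apply: smeas_measurable => //; exact: smeas_simple.
  by apply/measurable_EFinP; apply: measurable_funD.
pose u n t := if t \in B n then s n t else 0.
have su n : simple (u n) by exact: simple_restrict.
(* (2|v| + 1)^2 <= 8 |v|^2 + 2. *)
apply: (@L2cl_dominated u _ (fun t => 8 * hnorm (v t) ^+ 2 + 2)) => //.
- by move=> n; exact: L2cl_simple.
- by move=> n; exact: smeas_simple.
- apply: (@integrableD _ _ _ mu E mE (fun t => (8 * hnorm (v t) ^+ 2)%:E) (fun=> 2%:E)) => //.
    apply: (@integrableZl _ _ _ mu E mE 8 (fun t => (hnorm (v t) ^+ 2)%:E)).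
    apply/integrableP; split; first exact: smeas_measurable_sq.
    by under eq_integral do rewrite abse_EFin ger0_norm ?exprn_ge0//.
  exact: integrable_cst.
- move=> n t Et; rewrite /u; case: ifPn => [/set_mem[_ h]|_].
    have h1 := hnormDB (s n t) (v t).
    have h2 : 0 <= hnorm (v t) by [].
    have : hnorm (s n t - v t) ^+ 2 <= (2 * hnorm (v t) + 1) ^+ 2.
      by rewrite lerXn2r ?nnegrE ?addr_ge0 ?mulr_ge0//; lra.
    have := sqr_ge0 (2 * hnorm (v t) - 1); nra.
  rewrite sub0r hnormN; have : 0 <= hnorm (v t) ^+ 2 by rewrite exprn_ge0.
  by lra.
- apply: aeW => t Et; have := sv t Et => c.
  apply: cvg_trans c; apply: near_eq_cvg.
  have /cvg_hnormP/(_ 1 ltr01) := sv t Et; apply: filterS => n h.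
  rewrite /u mem_set//; split => //.
  have := hnormD (s n t - v t) (v t); rewrite subrK; lra.
Qed.

End Density.

Lemma adm_dense (R : realType) (U : normedModType R[i]) (adm : (R -> U) -> Prop) :
  (forall (a : R[i]) u v, adm u -> adm v -> adm (fun t => a *: u t + v t)) ->
  (forall (l : R) (w : U), 0 < l -> adm (fun t => (expR (l * t))%:C *: w)) ->
  (forall u, adm u -> {within `[0, +oo[, continuous u}) ->
  forall tau v, strongly_measurable [set` `[0, +oo[] v ->
  (L2sq [set` `[0%R, tau]] v < +oo)%E -> forall e : R, 0 < e ->
  exists2 u, adm u & (L2sq [set` `[0%R, tau]] (fun t => u t - v t)%R <= e%:E)%E.
Proof.
move=> ac ae acont tau v [s [ss [N [mN N0 sub]]]] fv e e0.
pose E := [set` `[0%R, tau]] `\` N.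
have mE : measurable E by apply: measurableD => //; exact: measurable_itv.
have sv : smeas E v.
  exists s; split => // t [t0 nN].
  have h : [set` `[0, +oo[] t -> (fun n => s n t) @ \oo --> v t by apply: contra_notP nN => /sub.
  by apply: h; move: t0; rewrite /= !in_itv/= andbT => /andP[].
have [||u au ue] := @L2cl_L2 R U adm ac ae acont tau E mE _ v sv _ e e0.
- by move=> t [].
- by apply: le_lt_trans fv; apply: L2sq_sub => t [].
by exists u => //; rewrite (L2sq_negligible _ _ mN N0).
Qed.

(** * Completeness *)

Section L2Limits.
Variables (R : realType) (V : normedModType R[i]).
Local Notation mu := (@lebesgue_measure R).
Implicit Types (f g h : R -> V) (E B : set R).

Lemma cvg_addn (u : nat -> V) (l : V) N : (fun k => u (k + N)%N) @ \oo --> l <-> u @ \oo --> l.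
Proof. by rewrite (cvg_shiftn N u (nbhs l)). Qed.

Lemma limn_einf_le (u : nat -> \bar R) (c : \bar R) : (forall n, (u n <= c)%E) ->
  (limn_einf u <= c)%E.
Proof.
move=> uc; apply: le_trans (limn_einf_sup u) _.
rewrite limn_esup_lim; apply: lime_le; first exact: is_cvg_esups.
by apply: nearW => n; apply: ge_ereal_sup => _ [k _ <-].
Qed.

Lemma L2sq_fatou E (f : nat -> R -> V) g (c : \bar R) : measurable E ->
  (forall n, smeas E (f n)) -> smeas E g -> (forall n, (L2sq E (f n) <= c)%E) ->
  (forall t, E t -> (fun n => f n t) @ \oo --> g t) -> (L2sq E g <= c)%E.
Proof.
move=> mE mf mg fc fg.
apply: le_trans (limn_einf_le fc).
pose h n t := (hnorm (f n t) ^+ 2)%:E.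
have h0 n t : (0 <= h n t)%E by rewrite lee_fin exprn_ge0.
have mh n : measurable_fun E (h n) by exact: smeas_measurable_sq.
have H := @fatou _ _ R mu E mE h mh (fun n t _ => h0 n t).
apply: le_trans H.
have gE t : E t -> limn_einf (h ^~ t) = (hnorm (g t) ^+ 2)%:E.
  move=> Et; have cg : (fun n => hnorm (f n t)) @ \oo --> hnorm (g t).
    by apply: cvg_hnorm_cst; exact: fg.
  have c2 : h ^~ t @ \oo --> (hnorm (g t) ^+ 2)%:E.
    apply: cvg_EFin; first by apply: nearW.
    by rewrite /h /= expr2; under eq_fun do rewrite expr2; exact: (cvgM cg cg).
  by rewrite is_cvg_limn_einfE; [exact: (cvg_lim (@ereal_hausdorff R) c2)|apply/cvg_ex; exists (hnorm (g t) ^+ 2)%:E].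
apply: ge0_le_lower_integral => t Et.
- by rewrite lee_fin exprn_ge0.
- by rewrite gE// lee_fin exprn_ge0.
by split => //; rewrite gE.
Qed.

Definition restr B f := fun t => if t \in B then f t else 0.

Lemma smeas_restr E B f : measurable B -> smeas E f -> smeas E (restr B f).
Proof.
move=> mB [s [ss sf]]; exists (fun n => restr B (s n)); split.
  by move=> n; exact: simple_restrict.
move=> t Et; rewrite /restr; case: ifP => _; [exact: sf|exact: cvg_cst].
Qed.

Lemma L2sq_restr E B f : (L2sq E (restr B f) <= L2sq (E `&` B) f)%E.
Proof.
rewrite /L2sq integral_mkcond [leRHS]integral_mkcond.
apply: ge0_le_lower_integral => [t _|t _|t _]; rewrite ?patchE.
- by case: ifP => // _; rewrite lee_fin exprn_ge0.
- by case: ifP => // _; rewrite lee_fin exprn_ge0.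
split => //; rewrite /restr in_setI; case: (t \in E) => //=.
by case: (t \in B) => //; rewrite hnorm0 expr0n.
Qed.

Lemma strongly_measurable_smeas (D : set R) f : strongly_measurable D f ->
  exists N, [/\ measurable N, mu N = 0%E & smeas (D `\` N) f].
Proof.
move=> [s [ss [N [mN N0 sub]]]]; exists N; split => //; exists s; split => // t [Dt nN].
have h : D t -> (fun n => s n t) @ \oo --> f t by apply: contra_notP nN => /sub.
exact: h.
Qed.

Lemma itv0_sub (tau : R) : [set` `[0%R, tau]] `<=` [set` `[0%R, +oo[] .
Proof. by move=> t /=; rewrite !in_itv/= andbT => /andP[]. Qed.

Lemma L2sq_tri_ae (tau : R) f g h : {within `[0, +oo[, continuous f} ->
  strongly_measurable [set` `[0, +oo[] g -> {within `[0, +oo[, continuous h} ->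
  (L2sq `[0%R, tau] (fun t => f t - h t)%R <=
   2%:E * L2sq `[0%R, tau] (fun t => f t - g t)%R + 2%:E * L2sq `[0%R, tau] (fun t => g t - h t)%R)%E.
Proof.
move=> /smeas_continuous mf /strongly_measurable_smeas[N [mN N0 mg]] /smeas_continuous mh.
rewrite !(L2sq_negligible [set` `[0%R, tau]] _ mN N0).
have mE : measurable ([set` `[0%R, tau]] `\` N) by apply: measurableD => //; exact: measurable_itv.
apply: L2sq_tri => //.
- by apply: smeas_sub mf => t [/itv0_sub].
- by apply: smeas_sub mg => t [/itv0_sub].
- by apply: smeas_sub mh => t [/itv0_sub].
Qed.

Lemma L2sqB D f g : L2sq D (fun t => f t - g t)%R = L2sq D (fun t => g t - f t)%R.
Proof. by rewrite /L2sq; apply: eq_integral => t _; rewrite hnormB. Qed.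

End L2Limits.

Section L2Complete.
Variables (R : realType) (V : completeNormedModType R[i]) (y : nat -> R -> V) (C : R).
Local Notation mu := (@lebesgue_measure R).
Hypothesis cy : forall n, {within `[0, +oo[, continuous (y n)}.
Hypothesis C0 : 0 <= C.
Hypothesis yC : forall n m, (n <= m)%N ->
  (L2sq `[0%R, n.+1%:R] (fun t => y m t - y n t)%R <= (C * (8^-1) ^+ n)%:E)%E.

Let J n := [set` `[0%R, n.+1%:R]] : set R.
(** The weights 4^n against the rate 8^-n leave integrals of order 2^-n, so the series is finite
    almost everywhere; at such a point its terms are bounded, which makes the increments of y(n) of
    order 2^-n. *)
Let F n := (fun t => (4 ^+ n * hnorm (y n.+1 t - y n t) ^+ 2)%:E) \_ (J n).

Let F0 n t : (0 <= F n t)%E.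
Proof. by rewrite /F patchE; case: ifP => // _; rewrite lee_fin mulr_ge0// exprn_ge0. Qed.

Let mJ n : measurable (J n). Proof. exact: measurable_itv. Qed.

Let smJ n m : smeas (J m) (y n).
Proof. by apply: (smeas_sub (@itv0_sub R _)); exact: smeas_continuous. Qed.

Let mF n : measurable_fun setT (F n).
Proof.
apply/(measurable_restrictT _ (mJ n)); under eq_fun do rewrite EFinM.
by apply: measurable_funeM; apply: smeas_measurable_sq; [exact: mJ|apply: smeas_B; exact: smJ].
Qed.

Let intF n : (\int[mu]_t F n t <= (C * (2^-1) ^+ n)%:E)%E.
Proof.
rewrite /F -integral_mkcond; under eq_integral do rewrite EFinM.
rewrite ge0_integralZl//; last 2 first.
- by apply: smeas_measurable_sq; [exact: mJ|apply: smeas_B; exact: smJ].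
- by move=> t _; rewrite lee_fin exprn_ge0.
apply: (@le_trans _ _ ((4 ^+ n)%:E * (C * (8^-1) ^+ n)%:E)%E).
  by apply: lee_wpmul2l; rewrite ?lee_fin ?exprn_ge0//; exact: yC.
rewrite -EFinM lee_fin mulrCA -exprMn.
by have -> : 4 * 8^-1 = 2^-1 :> R by lra.
exact: mJ.
Qed.

Let sumF k : (\sum_(0 <= n < k) \int[mu]_t F n t <= (2 * C * (1 - (2^-1) ^+ k))%:E)%E.
Proof.
elim: k => [|k IH]; first by rewrite big_nil expr0 subrr mulr0.
rewrite big_nat_recr//=; apply: le_trans (leeD IH (intF k)) _.
by rewrite -EFinD lee_fin exprS; lra.
Qed.

Let finS : {ae mu, forall t, (\sum_(0 <= n <oo) F n t < +oo)%E}.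
Proof.
have S0 t : (0 <= \sum_(0 <= n <oo) F n t)%E by exact: nneseries_ge0.
have [] : mu.-integrable setT (fun t => \sum_(0 <= n <oo) F n t)%E.
  apply/integrableP; split.
    by exact: (@ge0_emeasurable_sum _ _ R setT F xpredT).
  under eq_integral do rewrite gee0_abs//.
  rewrite integral_nneseries//; apply: (@le_lt_trans _ _ (2 * C)%:E); last exact: ltry.
  apply: lime_le; first by apply: is_cvg_nneseries => n _ _; exact: integral_ge0.
  apply: nearW => k; apply: le_trans (sumF k) _; rewrite lee_fin.
  by rewrite ler_piMr ?mulr_ge0// gerBl exprn_ge0.
move=> /(integrable_ae measurableT) [N [mN N0 sub]]; exists N; split => // t h; apply: sub => /= H.
by apply: h; have := H I; rewrite ge0_fin_numE.
Qed.

Lemma half_cvg0 (c r : R) : 0 <= r < 1 -> (fun n => c * r ^+ n) @ \oo --> (0 : R).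
Proof.
move=> r1; have h := expr_cvg0 r1.
have h' : (fun=> c) @ \oo --> c by exact: cvg_cst.
by rewrite -(mulr0 c); apply: cvgM.
Qed.

Let cvgS t : 0 <= t -> (\sum_(0 <= n <oo) F n t < +oo)%E -> exists l : V, (fun n => y n t) @ \oo --> l.
Proof.
move=> t0 St; have S0 : (0 <= \sum_(0 <= n <oo) F n t)%E by exact: nneseries_ge0.
set s := fine (\sum_(0 <= n <oo) F n t)%E.
have Fs n : (F n t <= s%:E)%E.
  rewrite fineK ?ge0_fin_numE//; apply: le_trans (nneseries_lim_ge n.+1 _) => //.
  by rewrite big_nat_recr//= leeDr// sume_ge0.
have s0 : 0 <= s by rewrite fine_ge0.
(* From this index on, t lies in [0, n + 1] and F n t is the weighted increment rather than 0. *)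
pose N := Num.truncn t.
have step n : (N <= n)%N -> hnorm (y n.+1 t - y n t) <= Num.sqrt s * (2^-1) ^+ n.
  move=> Nn; have Jt : t \in J n.
    rewrite inE /J /= in_itv/= t0/=; apply/ltW/(lt_le_trans (truncnS_gt t)).
    by rewrite ler_nat.
  have := Fs n; rewrite /F patchE Jt lee_fin => h.
  rewrite -(@ler_pXn2r _ 2)// ?nnegrE ?mulr_ge0 ?exprn_ge0// exprMn sqr_sqrtr//.
  rewrite -exprM mulnC exprM -[leLHS]mul1r.
  have -> : (2^-1 ^+ 2) = 4^-1 :> R by field.
  by rewrite exprVn ler_pdivlMr ?exprn_gt0// mul1r mulrC.
have tele n k : (N <= n)%N ->
    hnorm (y (n + k)%N t - y n t) <= Num.sqrt s * (2 * (2^-1 ^+ n - 2^-1 ^+ (n + k))).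
  move=> Nn; elim: k => [|k IH]; first by rewrite addn0 !subrr hnorm0 !mulr0.
  rewrite addnS; apply: le_trans (hnorm_tri (y (n + k)%N t) _ _) _.
  have := step (n + k)%N (leq_trans Nn (leq_addr _ _)) => h.
  apply: le_trans (lerD h IH) _; rewrite exprS -mulrDr ler_wpM2l ?sqrtr_ge0//.
  lra.
have [l hl] : exists l : V, (fun k => y (k + N)%N t) @ \oo --> l.
  apply: (cauchy_hnorm_bound (a := fun n => (Num.sqrt s * 2) * (2^-1) ^+ n)).
    by apply: half_cvg0; rewrite invr_ge0 ler0n/= invf_lt1// ltr1n.
  move=> m n nm; rewrite -(subnKC nm) addnAC.
  apply: le_trans (tele _ _ (leq_addl _ _)) _.
  rewrite -mulrA ler_wpM2l ?sqrtr_ge0// ler_wpM2l//.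
  apply: (@le_trans _ _ (2^-1 ^+ (n + N))); first by rewrite gerBl exprn_ge0.
  by rewrite exprD ler_piMr ?exprn_ge0// exprn_ile1// ?invr_ge0// invf_le1// ler1n.
by exists l; apply/(cvg_addn (fun n => y n t) l N).
Qed.

Lemma L2loc_complete : exists f : R -> V, [/\ strongly_measurable `[0, +oo[ f,
    cvg_L2loc y f,
    forall n c, (forall m, (n <= m)%N -> (L2sq `[0%R, n.+1%:R] (y m) <= c)%E) ->
      (L2sq `[0%R, n.+1%:R] f <= c)%E
  & forall c, (forall n, (L2sq `[0%R, n.+1%:R] (y n) <= c)%E) -> (L2sq `[0%R, +oo[ f <= c)%E].
Proof.
have [N [mN N0 sub]] := finS.
have lim t : exists l : V, 0 <= t /\ ~ N t -> (fun n => y n t) @ \oo --> l.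
  have [[t0 nN]|h] := pselect (0 <= t /\ ~ N t); last by exists 0.
  have [|l hl] := cvgS t0; last by exists l.
  by apply: contra_notP nN => h; apply: sub.
have [f hf] := choice lim; exists f.
pose E := [set` `[0%R, +oo[] `\` N.
have mE : measurable E by apply: measurableD => //; exact: measurable_itv.
have yf t : E t -> (fun n => y n t) @ \oo --> f t.
  by move=> []; rewrite itv0yE => t0 nN; apply: hf.
(* A diagonal choice makes the limit strongly measurable: s(n) is within 1/(n+1) of y(n) on [0, n],
   which contains any given t eventually. *)
have /choice[s hs] : forall n : nat, exists s, simple s /\
    forall t, 0 <= t <= n%:R -> hnorm (s t - y n t) <= n.+1%:R^-1.
  by move=> n; apply: simple_uniform => //; rewrite invr_gt0.
have sf t : E t -> (fun n => s n t) @ \oo --> f t.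
  move=> Et; have t0 : 0 <= t by case: Et; rewrite itv0yE.
  have h1 : (fun n => s n t - y n t) @ \oo --> (0 : V).
    apply: (@cvg_hnorm_le _ _ _ _ _ _ _ (fun n => n.+1%:R^-1)); last exact: (@cvg_harmonic R).
    exists (Num.truncn t).+1 => // n /= tn; rewrite subr0.
    have [_] := hs n; apply; rewrite t0/=; apply/ltW.
    by apply: lt_le_trans (truncnS_gt t) _; rewrite ler_nat.
  have h2 := yf t Et.
  have : (fun n => (s n t - y n t) + y n t) @ \oo --> 0 + f t by exact: cvgD.
  by rewrite add0r; under eq_fun do rewrite subrK.
have mf : smeas E f by exists s; split => // n; case: (hs n).
have JE n : J n `\` N `<=` E by move=> t [/itv0_sub].
have mJN n : measurable (J n `\` N) by exact: measurableD.
have sJN n m : smeas (J n `\` N) (y m) by apply: smeas_sub (smJ m n) => t [].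
have sJf n : smeas (J n `\` N) f by apply: smeas_sub mf; exact: JE.
split.
- exists s; split; first by move=> n; case: (hs n).
  exists N; split => // t; apply: contra_notP => nN Dt.
  by apply: sf; split.
- move=> tau tau0; apply/ge0_cvge0P => [n|e e0]; first exact: L2sq_ge0.
  have : (fun n => C * (8^-1) ^+ n) @ \oo --> (0 : R).
    by apply: half_cvg0; rewrite invr_ge0 ler0n/= invf_lt1// ltr1n.
  move=> /cvgrPdist_le/(_ e e0) h.
  have h' : \forall n \near \oo, (Num.truncn tau <= n)%N by exact: nbhs_infty_ge.
  apply: filterS2 h h' => n; rewrite sub0r normrN => he hn.
  have : C * 8^-1 ^+ n <= e by apply: le_trans he; exact: ler_norm.
  rewrite -lee_fin; apply: le_trans.
  apply: (@le_trans _ _ (L2sq (J n) (fun t => y n t - f t))).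
    apply: L2sq_sub => t /=; rewrite /J /= !in_itv/= => /andP[-> h1] /=.
    apply: (le_trans h1).
    apply/ltW/(lt_le_trans (truncnS_gt tau)); by rewrite ler_nat.
  rewrite (L2sq_negligible _ _ mN N0) L2sqB.
  apply: (@L2sq_fatou _ _ _ (fun k t => y (k + n)%N t - y n t)) => //.
  + by move=> k; exact: smeas_B.
  + exact: smeas_B.
  + move=> k; apply: le_trans (yC (leq_addl k n)).
    by apply: L2sq_sub => t [].
  + move=> t /JE Et; apply: cvgB; last exact: cvg_cst.
    by apply/(cvg_addn (fun k => y k t) (f t) n); exact: yf.
- move=> n c hc; rewrite (L2sq_negligible _ _ mN N0).
  apply: (@L2sq_fatou _ _ (J n `\` N) (fun k t => y (k + n)%N t)) => //.
  + move=> k; apply: le_trans (hc _ (leq_addl k n)).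
    by apply: L2sq_sub => t [].
  + by move=> t /JE Et; apply/(cvg_addn (fun k => y k t) (f t) n); exact: yf.
(* The bound on y(n) holds on [0, n + 1] only; cut off there, the sequence still converges on the
   half-line and Fatou's lemma applies to all of it. *)
- move=> c hc; rewrite (L2sq_negligible _ _ mN N0).
  apply: (@L2sq_fatou _ _ E (fun k => restr (J k) (y k))) => //.
  + move=> n; apply: smeas_restr => //.
    have sub0 : E `<=` [set` `[(0:R), +oo[] by move=> t [].
    by apply: (smeas_sub sub0); exact: smeas_continuous.
  + move=> n; apply: le_trans (L2sq_restr _ _ _) _.
    by apply: le_trans (hc n); apply: L2sq_sub => t [].
  + move=> t Et; have t0 : 0 <= t by case: Et; rewrite itv0yE.
    apply: cvg_trans (yf t Et); apply: near_eq_cvg.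
    exists (Num.truncn t) => // n /= tn; rewrite /restr mem_set//.
    rewrite /J /= in_itv/= t0/=; apply/ltW/(lt_le_trans (truncnS_gt t)).
    by rewrite ler_nat.
Qed.

End L2Complete.

(** * Stability of dissipative nodes *)

Section DissipativeNode.
Variables (R : realType) (U X Y : hilbertType R) (S : node U X Y) (a b : R).
Local Notation mu := (@lebesgue_measure R).
Hypothesis nS : is_system_node S.
Hypotheses (a0 : 0 < a) (b0 : 0 < b).
Hypothesis energy : forall x u w y, nrel S x u w y ->
  rdot w x <= b * hnorm u ^+ 2 - a * hnorm y ^+ 2.

Let energy_b_ge0 : 0 <= b. Proof. exact: ltW. Qed.

Lemma dissipative_node_contraction : has_contraction_semigroup S.
Proof.
have [T gT] := node_gen nS; exists T; split => //.
apply: (dissipative_contraction gT) => x Dx.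
have := energy (nrel_dom nS Dx); rewrite hnorm0 expr0n mulr0 sub0r => h.
by apply: le_trans h _; rewrite oppr_le0 mulr_ge0 ?exprn_ge0// ltW.
Qed.

Lemma trajectory_cont z0 u z y : trajectory S z0 u z y ->
  {within `[0, +oo[, continuous u} /\ {within `[0, +oo[, continuous y}.
Proof.
move=> /(trajectoryP nS)[[f1 [f2 [u1 _]]] _ [dz [[z1 cdz] H]]].
have cu := derivative_on_cont u1; split => //.
exact: (output_cont nS (derivative_on_cont z1) cdz cu H).
Qed.

Lemma within_hnormsq (V : normedModType R[i]) (f : R -> V) (k : R) :
  {within `[0, +oo[, continuous f} ->
  {within `[0, +oo[, continuous (fun t => k * hnorm (f t) ^+ 2)}.
Proof.
move=> /subspace_continuousP cf; apply/subspace_continuousP => t t0.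
have h : (fun t => hnorm (f t)) @ within [set` `[0, +oo[] (nbhs t) --> hnorm (f t).
  by apply: cvg_hnorm_cst; exact: cf.
have h2 : (fun=> k) @ within [set` `[0, +oo[] (nbhs t) --> k by exact: cvg_cst.
by apply: cvgM => //; rewrite expr2; apply: cvgM.
Qed.

Lemma L2sq_scale (V : normedModType R[i]) (f : R -> V) (k t : R) : 0 <= k ->
  {within `[0, +oo[, continuous f} ->
  (\int[mu]_(s in `[0%R, t]) (k * hnorm (f s) ^+ 2)%:E)%E = (k%:E * L2sq `[0%R, t] f)%E.
Proof.
move=> k0 cf; under eq_integral do rewrite EFinM.
apply: ge0_integralZl => //.
- apply: smeas_measurable_sq; first exact: measurable_itv.
  by apply: (smeas_sub (@itv0_sub R _)); exact: smeas_continuous.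
- by move=> s _; rewrite lee_fin exprn_ge0.
Qed.

Lemma L2sq_finite (V : normedModType R[i]) (f : R -> V) (t : R) :
  {within `[0, +oo[, continuous f} -> L2sq `[0%R, t] f \is a fin_num.
Proof.
move=> cf; rewrite ge0_fin_numE ?L2sq_ge0//.
have /integrableP[_] := @within_integrable _ _ t (within_hnormsq (k := 1) cf).
apply: le_lt_trans; apply: ge0_le_lower_integral => s Ds.
- by rewrite lee_fin exprn_ge0.
- by [].
by split => //=; rewrite mul1r ger0_norm ?exprn_ge0.
Qed.

(** The input enters through a real bound d, so one statement serves trajectories and their
    differences; the output energy is a real f, which allows real arithmetic. *)
Lemma trajectory_energy z0 u z y (t d : R) : trajectory S z0 u z y -> 0 < t ->
  (L2sq `[0%R, t] u <= d%:E)%E ->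
  exists2 f : R, L2sq `[0%R, t] y = f%:E &
  0 <= f /\ hnorm (z t) ^+ 2 + 2 * a * f <= hnorm z0 ^+ 2 + 2 * b * d.
Proof.
move=> H t0 ud; have [cu cy] := trajectory_cont H.
have fy := L2sq_finite t cy; exists (fine (L2sq `[0%R, t] y)); first by rewrite fineK.
split; first by rewrite fine_ge0// L2sq_ge0.
have [_ z00 [dz [C1z Hz]]] := (trajectoryP nS _ _ _ _).1 H.
have := @energy_inequality R X z dz (fun s => 2 * a * hnorm (y s) ^+ 2)
  (fun s => 2 * b * hnorm (u s) ^+ 2) t t0 C1z.
move=> /(_ (within_hnormsq (k := 2 * a) cy) (within_hnormsq (k := 2 * b) cu)).
have a20 : 0 <= 2 * a by rewrite mulr_ge0// ltW.
have b20 : 0 <= 2 * b by rewrite mulr_ge0// ltW.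
move=> /(_ (fun s _ => mulr_ge0 a20 (exprn_ge0 2 (hnorm_ge0 _)))).
move=> /(_ (fun s _ => mulr_ge0 b20 (exprn_ge0 2 (hnorm_ge0 _)))) E.
set I := L2sq _ _ in fy *.
rewrite -lee_fin; have -> : (hnorm (z t) ^+ 2 + 2 * a * fine I)%:E = ((hnorm (z t) ^+ 2)%:E + (2 * a)%:E * I)%E.
  by rewrite EFinD [(_ * fine I)%:E]EFinM fineK.
apply: (@le_trans _ _ ((hnorm (z 0) ^+ 2)%:E +
   \int[mu]_(s in `[0%R, t]) (2 * b * hnorm (u s) ^+ 2)%:E)%E); last first.
  by rewrite z00 L2sq_scale// [leRHS]EFinD leeD2l// [leRHS]EFinM lee_wpmul2l.
rewrite -L2sq_scale//; apply: E => s s0.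
by have := energy (Hz s s0); lra.
Qed.

Lemma trajectory_state z0 u z y (t d : R) : trajectory S z0 u z y -> 0 <= t ->
  0 <= d -> (L2sq `[0%R, t] u <= d%:E)%E ->
  hnorm (z t) ^+ 2 <= hnorm z0 ^+ 2 + 2 * b * d.
Proof.
move=> H; rewrite le_eqVlt => /predU1P[<-|t0] d0 ud.
  have [_ -> _] := (trajectoryP nS _ _ _ _).1 H.
  by rewrite lerDl !mulr_ge0.
have [f _ [f0 h]] := trajectory_energy H t0 ud.
by apply: le_trans h; rewrite lerDl !mulr_ge0// ltW.
Qed.

Lemma trajectory_output z0 u z y (t d : R) : trajectory S z0 u z y -> 0 < t ->
  (L2sq `[0%R, t] u <= d%:E)%E ->
  (L2sq `[0%R, t] y <= ((hnorm z0 ^+ 2 + 2 * b * d) / (2 * a))%:E)%E.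
Proof.
move=> H t0 ud; have [f -> [f0 h]] := trajectory_energy H t0 ud.
rewrite lee_fin ler_pdivlMr ?mulr_gt0//.
have : 0 <= hnorm (z t) ^+ 2 by rewrite exprn_ge0.
by move: h; lra.
Qed.

Lemma dissipative_well_posed : well_posed S.
Proof.
exists 1, ((1 + 2 * b) * (1 + (2 * a)^-1)); split => //.
  by rewrite mulr_ge0// addr_ge0 ?invr_ge0// mulr_ge0// ltW.
move=> z0 u z y H; have [cu cy] := trajectory_cont H.
have fu := L2sq_finite 1 cu; set d := fine (L2sq `[0%R, 1] u).
have ud : L2sq `[0%R, 1] u = d%:E by rewrite /d fineK.
have d0 : 0 <= d by rewrite fine_ge0// L2sq_ge0.
have ud' : (L2sq `[0%R, 1%R] u <= d%:E)%E by rewrite ud.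
have [f -> [f0 h]] := trajectory_energy H ltr01 ud'.
rewrite ud -!EFinD -EFinM lee_fin.
set p := hnorm (z 1) ^+ 2 in h *; have p0 : 0 <= p by rewrite exprn_ge0.
set q := hnorm z0 ^+ 2 in h *; have q0 : 0 <= q by rewrite exprn_ge0.
have a20 : 0 < 2 * a by rewrite mulr_gt0.
have h1 : f <= (q + 2 * b * d) * (2 * a)^-1.
  by rewrite ler_pdivlMr//; lra.
have h2 : p <= q + 2 * b * d by apply: le_trans h; rewrite lerDl mulr_ge0// ltW.
have h3 : q + 2 * b * d <= (1 + 2 * b) * (q + d).
  by have := mulr_ge0 (ltW b0) q0; lra.
apply: (@le_trans _ _ ((q + 2 * b * d) * (1 + (2 * a)^-1))); first lra.
by rewrite [leRHS]mulrAC ler_wpM2r// addr_ge0// invr_ge0 ltW.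
Qed.

Lemma trajectory_comb (k : R[i]) x u z y x' u' z' y' :
  trajectory S x u z y -> trajectory S x' u' z' y' ->
  trajectory S (k *: x + x') (fun t => k *: u t + u' t)
    (fun t => k *: z t + z' t) (fun t => k *: y t + y' t).
Proof.
move=> /(trajectoryP nS)[Cu z0 [dz [Cz H]]] /(trajectoryP nS)[Cu' z0' [dz' [Cz' H']]].
apply/(trajectoryP nS); split; [exact: C2_comb|by rewrite z0 z0'|].
exists (fun t => k *: dz t + dz' t); split; first exact: C1_comb.
by move=> t t0; apply: (nrel_comb nS); [exact: H|exact: H'].
Qed.

Lemma trajectory_B x u z y x' u' z' y' :
  trajectory S x u z y -> trajectory S x' u' z' y' ->
  trajectory S (x - x') (fun t => u t - u' t) (fun t => z t - z' t) (fun t => y t - y' t).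
Proof.
move=> H H'; have := trajectory_comb (-1) H' H.
rewrite scaleN1r addrC; congr (trajectory S _ _ _ _); apply/funext => t;
  by rewrite scaleN1r addrC.
Qed.

(* A translate of the domain is all that compatibility with u(0) leaves of the initial
   states; in this form linear combinations of realizable inputs are realizable. *)
Definition realizable (u : R -> U) := exists q, forall x, ndom S (x - q) ->
  exists z y, trajectory S x u z y.

Lemma realizable_comb (k : R[i]) u v : realizable u -> realizable v ->
  realizable (fun t => k *: u t + v t).
Proof.
move=> [q hq] [p hp]; exists (k *: q + p) => x Dx.
have [z [y H]] : exists z y, trajectory S q u z y.
  by apply: hq; rewrite subrr; exact: nD0 nS.
have [z' [y' H']] : exists z y, trajectory S (x - k *: q) v z y.
  by apply: hp; rewrite -addrA -opprD.
exists (fun t => k *: z t + z' t), (fun t => k *: y t + y' t).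
by have := trajectory_comb k H H'; rewrite addrC subrK.
Qed.

(** Contractivity puts every l > 0 into the resolvent set, so e^{lt} (lI - A)^-1 B w is available as
    a particular solution. *)
Lemma realizable_exp (l : R) w : 0 < l -> realizable (fun t => (expR (l * t))%:C *: w).
Proof.
move=> l0; have [T [gT Tc]] := dissipative_node_contraction.
have rs : rho S l%:C.
  apply: (shifted_resolvent (w := 0) gT) => // x; rewrite expR0 mul1r; exact: Tc.
exists (Rext S l%:C (nB S w)) => x Dx.
have [z [y [H _]]] := exp_trajectory nS gT rs Dx; exists z, y.
by move: H; congr (trajectory S _ _ _ _); apply/funext => t; rewrite /cexp -rmorphM/= sin0 cos0 mulr1.
Qed.

Lemma realizable_cont u : realizable u -> {within `[0, +oo[, continuous u}.
Proof.
move=> [q hq]; have [z [y H]] : exists z y, trajectory S q u z y.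
  by apply: hq; rewrite subrr; exact: nD0 nS.
by have [] := trajectory_cont H.
Qed.

(** The input is chosen first; the initial states compatible with it form a translate of the domain,
    which is dense. *)
Lemma realizable_approx z0 v (n : nat) (e : R) : L2 v -> 0 < e ->
  exists p : X * (R -> U) * (R -> X) * (R -> Y),
   [/\ trajectory S p.1.1.1 p.1.1.2 p.1.2 p.2, hnorm (p.1.1.1 - z0) <= e &
     (L2sq `[0%R, n.+1%:R] (fun t => p.1.1.2 t - v t)%R <= e%:E)%E].
Proof.
move=> [mv fv] e0.
have fvn : (L2sq [set` `[0%R, n.+1%:R]] v < +oo)%E.
  by apply: le_lt_trans fv; apply: L2sq_sub; exact: (@itv0_sub R).
have [u [q hq] hu] := adm_dense realizable_comb realizable_exp realizable_cont mv fvn e0.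
have [d Dd hd] := (denseP _).1 (node_dense nS) (z0 - q) e e0.
have [z [y H]] := hq (d + q) ltac:(by rewrite addrK).
exists (d + q, u, z, y); split => //=.
by move/ltW: hd; congr (_ <= _); congr hnorm; abel.
Qed.

(** The energy estimate is used twice: on differences of approximating trajectories it gives
    convergence of states and outputs, and on the trajectories themselves it gives bounds uniform in
    time. *)
Lemma realizable_extension z0 v : L2 v -> exists z y,
  [/\ ext_trajectory S z0 v z y, L2 y &
    exists M : R, forall t : R, 0 <= t -> hnorm (z t) <= M].
Proof.
move=> Lv; have [mv fv] := Lv.
(* The rate that [L2loc_complete] requires of the outputs. *)
pose r := 8^-1 : R.
have r0 : 0 < r by rewrite invr_gt0.
have rn n : 0 < r ^+ n by rewrite exprn_gt0.
have r1 : r < 1 by rewrite invf_lt1// ltr1n.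
have rmono n m : (n <= m)%N -> r ^+ m <= r ^+ n.
  by move=> nm; apply: ler_wiXn2l => //; exact: ltW.
have rle1 n : r ^+ n <= 1 by rewrite exprn_ile1// ltW.
have /choice[p hp] := fun n => realizable_approx z0 n Lv (rn n).
pose x n := (p n).1.1.1; pose u n := (p n).1.1.2; pose z n := (p n).1.2; pose y n := (p n).2.
have traj n : trajectory S (x n) (u n) (z n) (y n) by case: (hp n).
have hx n : hnorm (x n - z0) <= r ^+ n by case: (hp n).
have hu n : (L2sq `[0%R, n.+1%:R] (fun t => u n t - v t)%R <= (r ^+ n)%:E)%E by case: (hp n).
have cu n : {within `[0, +oo[, continuous (u n)} by case: (trajectory_cont (traj n)).
have cy n : {within `[0, +oo[, continuous (y n)} by case: (trajectory_cont (traj n)).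
have sub n m : (n <= m)%N -> [set` `[0%R, n.+1%:R : R]] `<=` [set` `[0%R, m.+1%:R : R]].
  move=> nm t /=; rewrite !in_itv/= => /andP[-> h] /=.
  by apply: le_trans h _; rewrite ler_nat.
have du n m : (n <= m)%N -> (L2sq `[0%R, n.+1%:R] (fun t => u m t - u n t)%R <= (4 * r ^+ n)%:E)%E.
  move=> nm; apply: le_trans (L2sq_tri_ae _ (cu m) mv (cu n)) _.
  apply: (@le_trans _ _ (2%:E * (r ^+ n)%:E + 2%:E * (r ^+ n)%:E)%E).
    apply: leeD; apply: lee_wpmul2l; rewrite ?lee_fin//.
      apply: le_trans (L2sq_sub _ (sub _ _ nm)) _; apply: le_trans (hu m) _.
      by rewrite lee_fin; exact: rmono.
    by rewrite L2sqB.
  by rewrite -!EFinM -EFinD lee_fin; lra.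
have dx n m : (n <= m)%N -> hnorm (x m - x n) ^+ 2 <= 4 * r ^+ n.
  move=> nm; have h : hnorm (x m - x n) <= 2 * r ^+ n.
    apply: le_trans (hnorm_tri z0 _ _) _; rewrite [hnorm (z0 - _)]hnormB.
    by have := hx m; have := hx n; have := rmono _ _ nm; lra.
  have : hnorm (x m - x n) ^+ 2 <= (2 * r ^+ n) ^+ 2.
    by rewrite lerXn2r ?nnegrE// mulr_ge0// ltW.
  by have := rle1 n; have := rn n; nra.
have dtraj n m := trajectory_B (traj m) (traj n).
(* Initial states differ by at most 4 r^n in squared norm, and so do inputs; the latter enter with
   the factor 2b. *)
pose C := 4 + 8 * b; have C0 : 0 < C by rewrite addr_gt0 ?mulr_gt0.
have bound n m : (n <= m)%N -> hnorm (x m - x n) ^+ 2 + 2 * b * (4 * r ^+ n) <= C * r ^+ n.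
  by move=> nm; have := dx _ _ nm; rewrite /C; lra.
have dz n m (t : R) : (n <= m)%N -> 0 <= t -> t <= n.+1%:R ->
    hnorm (z m t - z n t) ^+ 2 <= C * r ^+ n.
  move=> nm t0 tn; apply: le_trans (bound _ _ nm).
  apply: (trajectory_state (dtraj n m) t0); first by rewrite mulr_ge0// ltW.
  apply: le_trans (du _ _ nm); apply: L2sq_sub => s /=; rewrite !in_itv/= => /andP[-> h] /=.
  exact: le_trans h tn.
have dy n m : (n <= m)%N ->
    (L2sq `[0%R, n.+1%:R] (fun t => y m t - y n t)%R <= (C / (2 * a) * r ^+ n)%:E)%E.
  move=> nm; apply: le_trans (trajectory_output (dtraj n m) (ltr0Sn R n) (du _ _ nm)) _.
  rewrite lee_fin [leRHS]mulrAC ler_wpM2r ?invr_ge0 ?mulr_ge0 ?(ltW a0)//; exact: bound.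
pose W := fine (L2sq `[0%R, +oo[ v).
have WE : L2sq `[0%R, +oo[ v = W%:E by rewrite fineK// ge0_fin_numE ?L2sq_ge0.
have W0 : 0 <= W by rewrite fine_ge0// L2sq_ge0.
have c0 : {within `[0, +oo[, continuous (fun _ : R => 0 : U)} by move=> t; exact: cvg_cst.
have bu n m : (n <= m)%N -> (L2sq `[0%R, n.+1%:R] (u m) <= (2 + 2 * W)%:E)%E.
  move=> nm; have := L2sq_tri_ae n.+1%:R (cu m) mv c0.
  under [L2sq _ (fun t => u m t - 0)]eq_integral do rewrite subr0.
  under [L2sq _ (fun t => v t - 0)]eq_integral do rewrite subr0.
  move=> h; apply: le_trans h _.
  rewrite [leRHS]EFinD [(2 * W)%:E]EFinM; apply: leeD; last first.
    apply: lee_wpmul2l; rewrite ?lee_fin// -WE; apply: L2sq_sub; exact: (@itv0_sub R).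
  rewrite -[leRHS]mule1; apply: lee_wpmul2l; rewrite ?lee_fin//.
  apply: le_trans (L2sq_sub _ (sub _ _ nm)) _; apply: le_trans (hu m) _.
  by rewrite lee_fin.
(* The energy bound for all approximants: |x(n)| <= |z0| + 1, and the input energy is at most 2 r^n
   + 2W <= 2 + 2W. *)
pose B := (hnorm z0 + 1) ^+ 2 + 2 * b * (2 + 2 * W).
have xB n : hnorm (x n) ^+ 2 + 2 * b * (2 + 2 * W) <= B.
  rewrite lerD2r lerXn2r ?nnegrE ?addr_ge0//.
  have := hnormD (x n - z0) z0; rewrite subrK; have := hx n; have := rle1 n; lra.
have zB n (t : R) : 0 <= t -> t <= n.+1%:R -> hnorm (z n t) ^+ 2 <= B.
  move=> t0 tn; apply: le_trans (xB n).
  apply: (trajectory_state (traj n) t0); first by rewrite addr_ge0 ?mulr_ge0.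
  apply: le_trans (bu n n (leqnn n)); apply: L2sq_sub => s /=; rewrite !in_itv/= => /andP[-> h] /=.
  exact: le_trans h tn.
have yB n m : (n <= m)%N -> (L2sq `[0%R, n.+1%:R] (y m) <= (B / (2 * a))%:E)%E.
  move=> nm; apply: le_trans (trajectory_output (traj m) (ltr0Sn R n) (bu _ _ nm)) _.
  by rewrite lee_fin ler_wpM2r ?invr_ge0 ?mulr_ge0 ?(ltW a0).
have rcvg c : (fun n => c * r ^+ n) @ \oo --> (0 : R) by apply: half_cvg0; rewrite (ltW r0).
have zlim t : exists l : X, 0 <= t -> (fun n => z n t) @ \oo --> l.
  have [t0|tn] := leP 0 t; last by exists 0.
  have [|l hl] := @cauchy_hnorm _ X (fun n => z n t); last by exists l.
  move=> e e0; have e2 : 0 < e ^+ 2 by rewrite exprn_gt0.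
  have /cvgrPdist_lt/(_ _ e2)[N1 _ hN1] := rcvg C.
  pose N := maxn N1 (Num.truncn t).
  have hN n : (N <= n)%N -> C * r ^+ n < e ^+ 2.
    rewrite geq_max => /andP[h _]; have := hN1 _ h; rewrite /= sub0r normrN.
    by apply: le_lt_trans; exact: ler_norm.
  have tN n : (N <= n)%N -> t <= n.+1%:R.
    rewrite geq_max => /andP[_ h]; apply/ltW/(lt_le_trans (truncnS_gt t)).
    by rewrite ler_nat.
  have main m n : (N <= n)%N -> (n <= m)%N -> hnorm (z m t - z n t) < e.
    move=> Nn nm; rewrite -(@ltr_pXn2r _ 2)// ?nnegrE//; last exact: ltW.
    by apply: le_lt_trans (hN _ Nn); apply: dz => //; exact: tN.
  exists N => m n Nm Nn; case: (leqP n m) => [|/ltnW] nm; first exact: main.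
  by rewrite hnormB; exact: main.
have [zf hz] := choice zlim.
have C'0 : 0 <= C / (2 * a) by rewrite divr_ge0 ?(ltW C0)// mulr_ge0// ltW.
have [yf [myf cyf yf1 yf2]] := L2loc_complete cy C'0 dy.
have tn (t : R) : exists n : nat, t <= n.+1%:R.
  by exists (Num.truncn t); apply/ltW/truncnS_gt.
have Lyf : L2 yf.
  split => //; apply: le_lt_trans (yf2 _ (fun n => yB n n (leqnn n))) _; exact: ltry.
have loc (V : normedModType R[i]) (f : R -> V) : L2 f -> L2loc f.
  move=> [mf ff]; split => // tau _; apply: le_lt_trans ff; apply: L2sq_sub.
  exact: (@itv0_sub R).
exists zf, yf; split => //; last first.
  exists (Num.sqrt B) => t t0; have [n0 hn0] := tn t.
  apply: (hnorm_cvg_le (hz t t0)); exists n0 => // n /= nn.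
  rewrite -(@ler_pXn2r _ 2)// ?nnegrE ?sqrtr_ge0// sqr_sqrtr; last first.
    by apply: le_trans (zB n0 t t0 hn0); rewrite exprn_ge0.
  by apply: zB => //; apply: le_trans hn0 _; rewrite ler_nat.
split; first exact: loc.
split; first exact: loc.
exists x, u, z, y; split => //.
split.
  apply: (cvg_hnorm_le (g := fun n => 1 * r ^+ n)); last exact: rcvg.
  by apply: nearW => n; rewrite mul1r.
move=> tau tau0; apply/ge0_cvge0P => [n|e e0]; first exact: L2sq_ge0.
have [n0 hn0] := tn tau.
have /cvgrPdist_lt/(_ _ e0)[N1 _ hN1] := rcvg 1.
exists (maxn n0 N1) => // n /=; rewrite geq_max => /andP[n0n N1n].
apply: (@le_trans _ _ (r ^+ n)%:E).
  apply: le_trans (hu n); apply: L2sq_sub => s /=; rewrite !in_itv/= => /andP[-> h] /=.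
  by apply: le_trans h _; apply: le_trans hn0 _; rewrite ler_nat.
have := hN1 _ N1n; rewrite /= sub0r normrN mul1r lee_fin => h.
by apply/ltW; apply: le_lt_trans h; exact: ler_norm.
Qed.

Lemma L2_zero : L2 (fun=> 0 : U).
Proof.
split.
  exists (fun _ _ => 0); split; first by move=> n; exact: simple_cst.
  by apply: aeW => t _; exact: cvg_cst.
rewrite /L2sq integral0_eq ?ltry// => t _; by rewrite hnorm0 expr0n.
Qed.

Lemma dissipative_system_stable : system_stable S.
Proof.
split; first exact: dissipative_well_posed.
- by move=> v /(realizable_extension 0)[z [y [H _ M]]]; exists z, y.
- by move=> z0; have [z [y [H Ly _]]] := realizable_extension z0 L2_zero; exists z, y.
- by move=> v /(realizable_extension 0)[z [y [H Ly _]]]; exists z, y.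
Qed.

End DissipativeNode.

(** * Stability of every closed loop *)

(** A bound M for T(1) is at most e^M, which is all that [shifted_resolvent] asks for. It gives an
    arbitrary closed loop a resolvent point in common with [S]. *)
Lemma resolvent_half_plane (R : realType) (U X Y : hilbertType R) (S : node U X Y) :
  is_system_node S -> exists w : R, forall s : R[i], w < complex.Re s -> rho S s.
Proof.
move=> nS; have [T gT] := node_gen nS; have [C0T _] := gT.
have [M M0 HM] := C0_bound C0T 1.
exists M => s; apply: (shifted_resolvent gT) => x.
apply: le_trans (HM 1 x _) _; first by rewrite ler01 lexx.
rewrite ler_wpM2r//; apply: le_trans (expR_ge1Dx M); lra.
Qed.

Theorem theorem4p2 (R : realType) (U X : hilbertType R) (S : node U X U)
    (E Ep : U -> U) (kappa : R) :
  is_system_node S ->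
  bounded_op E -> selfadjoint E ->
  impedance_passive (shift_node S E) ->
  is_positive_part E Ep ->
  let c := opnorm Ep in
  let kappa0 : \bar R := if c == 0 then +oo%E else (c^-1)%:E in
  0 < kappa -> (kappa%:E < kappa0)%E ->
  let K := fun u : U => - (kappa%:C *: u) in
  well_posed_feedback S K /\
  forall SK : node U X U, is_closed_loop S K SK ->
    system_stable SK /\ has_contraction_semigroup SK.
Proof.
move=> nS bE saE passive pE c kappa0 k0 kk0 K.
have c0 : 0 <= c by exact: opnorm_ge0.
have kc : kappa * c < 1.
  move: kk0; rewrite /kappa0; case: eqVneq => [->|cn0]; first by rewrite mulr0.
  by rewrite lte_fin -[c^-1]mul1r ltr_pdivlMr// lt_def cn0.
have Ec u : rdot (E u) u <= c * hnorm u ^+ 2 by exact: positive_part_bound.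
(* Shown for every closed loop before one is constructed; it then supplies the well-posedness of the
   constructed one. *)
have closed SK : is_closed_loop S K SK -> system_stable SK /\ has_contraction_semigroup SK.
  move=> HK; have [nSK _] := HK.
  have [w hw] := resolvent_half_plane nSK.
  (* A common point of the half-planes Re s > 0, which lies in [rho S], and Re s > w, which lies in
     [rho SK]. *)
  pose s : R[i] := (Num.max w 0 + 1)%:C.
  have sw : w < complex.Re s by rewrite /= ltr_pwDr// le_max lexx.
  have s0 : 0 < complex.Re s by rewrite /= ltr_pwDr// le_max lexx orbT.
  have rel := closed_loop_feedback_relation nS nSK HK (right_half_plane nS bE passive s0) (hw s sw).
  have energy x v w' y (H : nrel SK x v w' y) :=
    closed_loop_energy nS bE passive Ec k0 kc (rel _ _ _ _ H).
  split; first exact: (dissipative_system_stable nSK (gain_y_gt0 k0 kc) (gain_v_gt0 k0 kc) energy).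
  exact: (dissipative_node_contraction nSK (gain_y_gt0 k0 kc) energy).
have [SK [nSK relK]] := closed_loop_realization nS bE passive Ec k0 kc.
have HK : is_closed_loop S K SK by exact: feedback_relation_closed_loop.
split => //; split; last by exists SK; split => //; have [[]] := closed SK HK.
split; last by exists SK.
- apply/bounded_opP; have := bopZ (- kappa%:C) (@bop_id _ U).
  by under eq_fun do rewrite scaleNr.
- exists 0 => s s0; split; first exact: (right_half_plane nS bE passive).
  have [P hP] := feedback_invertible nS bE passive Ec k0 kc s0; exists P.
  by move: hP; rewrite /K; under [in X in _ -> X]eq_fun do rewrite opprK.
Qed.
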